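(* Consider a sequence of linear models indexed by $n$, $$Y = X b^0 + \epsilon,$$ where $X\in\mathbb{R}^{n\times p}$ has i.i.d. entries from $N(0,1/n)$, $\epsilon\sim N(0,\sigma^2 I_{n})$ is independent of $X$, $b^0\in\mathbb{R}^p$, $p=p_n$, and $k=k_n=\#\{j: b^0_j\neq 0\}$. Suppose there exists $\delta>0$ such that $$\min_{j:\, b^0_j\neq 0}|b^0_j| \ge 2\sigma(1+\delta)\sqrt{2\log p},$$ and suppose $p\to\infty$, $k/p\to 0$ and $k^2\log p/n\to 0$. Then for any $q\in(0,1)$, the SLOPE estimator $$\hat b=\operatorname{argmin}_{b\in\mathbb{R}^p}\Big\{\tfrac12\|Y-Xb\|_2^2+\sum_{i=1}^p\lambda_i|b|_{(i)}\Big\}$$ with tuning sequence $\lambda_i=\lambda_i(q,\delta)=\sigma(1+\delta)\,\Phi^{-1}\!\left(1-\frac{qi}{2p}\right)$, $i=1,\dots,p$, satisfies $$FDR\to 0\quad\text{and}\quad \Pi\to 1\qquad (n\to\infty).$$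
   Context: $|b|_{(1)}\ge\dots\ge|b|_{(p)}$ denote the ordered absolute values of the entries of $b$; $\Phi$ is the standard normal cumulative distribution function. With $V=\#\{j: b^0_j=0,\ \hat b_j\neq 0\}$, $R=\#\{j:\hat b_j\neq 0\}$, $TR=\#\{j: b^0_j\neq 0,\ \hat b_j\neq 0\}$, the False Discovery Rate is $FDR=\mathbb{E}\big(V/(R\vee 1)\big)$ and the Power is $\Pi=\mathbb{E}(TR)/k$. *)

(* Defs.v *)
From HB Require Import structures.
From mathcomp Require Import all_boot all_order all_algebra.
From mathcomp Require Import all_classical all_reals all_analysis.
Set Implicit Arguments.
Unset Strict Implicit.
Unset Printing Implicit Defensive.
Import Order.TTheory GRing.Theory Num.Theory.
Local Open Scope classical_set_scope.
Local Open Scope ring_scope.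

Section Slope.
Context {R : realType}.

Definition Phi (x : R) : R := fine (normal_prob 0 1 `]-oo, x]).

Definition Phi_inv (u : R) : R := inf [set x : R | u <= Phi x].

Definition sorted_abs (p : nat) (b : 'cV[R]_p) : seq R :=
  sort (fun x y : R => y <= x) [seq `|b i 0| | i <- enum 'I_p].

(** SLOPE penalty  sum_{i=1}^p lambda_i |b|_(i)  (index i : 'I_p stands for i+1). *)
Definition slope_penalty (p : nat) (lam : 'I_p -> R) (b : 'cV[R]_p) : R :=
  \sum_(i < p) lam i * nth 0 (sorted_abs b) i.

Definition sqnorm (n : nat) (v : 'cV[R]_n) : R := \sum_(i < n) v i 0 ^+ 2.

Definition slope_obj (n p : nat) (X : 'M[R]_(n, p)) (Y : 'cV[R]_n)
    (lam : 'I_p -> R) (b : 'cV[R]_p) : R :=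
  2^-1 * sqnorm (Y - X *m b) + slope_penalty lam b.

Definition is_slope_solution (n p : nat) (X : 'M[R]_(n, p)) (Y : 'cV[R]_n)
    (lam : 'I_p -> R) (bh : 'cV[R]_p) : Prop :=
  forall b : 'cV[R]_p, slope_obj X Y lam bh <= slope_obj X Y lam b.

Definition slope_lambda (sigma delta q : R) (p : nat) (i : 'I_p) : R :=
  sigma * (1 + delta) * Phi_inv (1 - q * (i.+1)%:R / (2 * p%:R)).

Definition mutually_independent d (T : measurableType d) (P : probability T R)
    (I : finType) (Z : I -> T -> R) : Prop :=
  forall B : I -> set R, (forall i, measurable (B i)) ->
    P (\bigcap_(i in [set: I]) (Z i @^-1` B i)) = (\prod_(i : I) P (Z i @^-1` B i))%E.

(** Z has law N(m, s^2) (s = standard deviation). *)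
Definition has_normal_law d (T : measurableType d) (P : probability T R)
    (Z : T -> R) (m s : R) : Prop :=
  measurable_fun setT Z /\
  forall B : set R, measurable B -> P (Z @^-1` B) = normal_prob m s B.

Definition nsupp (p : nat) (b : 'cV[R]_p) : nat := #|[set j : 'I_p | b j 0 != 0]|.
Definition nfalse_disc (p : nat) (b0 bh : 'cV[R]_p) : nat :=
  #|[set j : 'I_p | (b0 j 0 == 0) && (bh j 0 != 0)]|.
Definition ntrue_disc (p : nat) (b0 bh : 'cV[R]_p) : nat :=
  #|[set j : 'I_p | (b0 j 0 != 0) && (bh j 0 != 0)]|.

Definition design_noise_family d (T : measurableType d) (n p : nat)
    (X : T -> 'M[R]_(n, p)) (eps : T -> 'cV[R]_n) :
    ('I_n * 'I_p + 'I_n)%type -> T -> R :=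
  fun a w => match a with
             | inl ij => X w ij.1 ij.2
             | inr i => eps w i 0
             end.

End Slope.
Arguments slope_lambda {R} sigma delta q p i.

(* Main.v *)
(* The objective at the solution bh is only ever compared with its value at other
   points; no optimality conditions are needed. Let z = X^T eps,
   S = supp b0, k = #S, t_i = lambda_i, and fix a suitable rho < 1. With
   probability tending to 1:
   - |eps|^2 <= (1 + kap)^2 n sigma^2 and every column of X has norm close to 1;
   - the i-th largest |z_j| is at most rho t_i for every i;
   - at most eta k coordinates form the set G = {j : |z_j| > rho t_k};
   - the i-th largest off-diagonal entry of each row of X^T X is at most xi_i, of
     order sqrt ((log (p / i) + log p / i) / n).
   On this event put I = S u G, so that #I <= 2k. Comparing bh with b0 (after
   shrinking the error towards b0, by convexity) bounds the error restricted to I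
   by a multiple of sigma sqrt (k log (p / k)); comparing bh with its restriction
   to I then shows that bh vanishes off I, because the scores off I stay below the
   weights of rank > #I by a fixed factor. So there are at most eta k false
   discoveries. Finally, perturbing a zero coordinate of bh in S contradicts the
   signal strength, so all k signals are found, and the FDR is at most eta plus
   the probability of the bad event. The exceptional probabilities are Chernoff
   bounds for the number of exceedances among independent normal variables,
   conditionally on the noise or on one column of X. *)
Require Import Defs.
From HB Require Import structures.
From mathcomp Require Import all_boot all_order all_algebra.
From mathcomp Require Import all_classical all_reals all_analysis.
From mathcomp Require Import measurable_realfun zify ring lra.
Set Implicit Arguments.
Unset Strict Implicit.
Unset Printing Implicit Defensive.
Import Order.TTheory GRing.Theory Num.Theory.
Import HBNNSimple.
Local Open Scope classical_set_scope.
Local Open Scope ring_scope.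

(** * Integration against normal laws *)

(** The obstacle is the cross term between [I] and its complement. The last weights are of constant
    order, so a uniform correlation bound of order sqrt (log p / n), multiplied by an l1 error of
    order k sqrt (log (p / k)) on [I], would leave k^2 log p log (p / k) / n under a square root,
    which need not vanish. Comparing the correlations with the weights rank by rank, at ranks #I +
    i, gains exactly the factor log (p / k). All constants descend from one margin: (1 + kap)^2 < 1
    + delta gives rho < 1, and 1 - rho is shared between the scores off [I], the cross term, the
    column norms and the loss of weight when a rank is shifted by #I. That loss is a small fraction
    of the weight because k / p tends to 0. For the same reason the quantile at rank k tends to
    infinity, so that the margin makes exceedances of rho t_k number o(k) instead of a fixed
    fraction of k; this is why the FDR tends to 0 and does not merely stay below a level. *)

Lemma ge0_integral_density d (T : measurableType d) (R : realType)
    (mu nu : {measure set T -> \bar R}) (g : T -> R) :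
  measurable_fun setT g -> (forall x, 0 <= g x) ->
  (forall A, measurable A -> nu A = \int[mu]_(x in A) (g x)%:E)%E ->
  forall f : T -> \bar R, measurable_fun setT f -> (forall x, 0 <= f x)%E ->
  (\int[nu]_x f x = \int[mu]_x (f x * (g x)%:E))%E.
Proof.
move=> mg g0 nuE f mf f0.
have Hs (h : {nnsfun T >-> R}) :
    (\int[nu]_x (h x)%:E = \int[mu]_x ((h x)%:E * (g x)%:E))%E.
  under [LHS]eq_integral do rewrite fimfunE -fsumEFin//.
  rewrite [LHS]ge0_integral_fsum//; last 2 first.
    - by move=> r; exact/measurable_EFinP/measurableT_comp.
    - by move=> n x _; rewrite EFinM nnfun_muleindic_ge0.
  under [RHS]eq_integral.
    move=> x xD; rewrite fimfunE -fsumEFin// ge0_mule_fsuml; last first.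
      by move=> r; rewrite EFinM nnfun_muleindic_ge0.
    over.
  rewrite [RHS]ge0_integral_fsum//; last 2 first.
    - move=> r; apply: emeasurable_funM.
        by exact/measurable_EFinP/measurableT_comp.
      exact/measurable_EFinP.
    - move=> n x _; apply: mule_ge0; last by rewrite lee_fin.
      by rewrite EFinM nnfun_muleindic_ge0.
  apply: eq_fsbigr => r _.
  rewrite integralZl_indic_nnsfun//.
  under [RHS]eq_integral do rewrite EFinM -muleA.
  (* A negative [r] is not a value of the nonnegative [h]: its preimage is empty and both sides
     vanish. *)
  have [r0|r0] := leP 0 r; last first.
    rewrite (_ : h @^-1` [set r] = set0); last first.
      apply/seteqP; split => // x /= hx.
      by have : 0 <= h x by []; rewrite hx leNgt r0.
    rewrite integral_indic// set0I measure0 mule0 -[LHS](integral0 mu setT).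
    by apply: eq_integral => x _; rewrite indicE in_set0 mul0e mule0.
  rewrite ge0_integralZl//=.
  - rewrite integral_indic// setIT nuE//; congr (_ * _)%E.
    rewrite integral_mkcond; apply: eq_integral => x _.
    by rewrite patchE indicE; case: ifPn => _; rewrite ?mul1e ?mul0e.
  - apply: emeasurable_funM; last exact/measurable_EFinP.
    exact/measurable_EFinP/measurable_indic.
  - by move=> x _; rewrite -EFinM lee_fin mulr_ge0.
pose f_ := nnsfun_approx measurableT mf.
transitivity (limn (fun n => \int[nu]_x (f_ n x)%:E))%E.
  rewrite -monotone_convergence//=.
  - apply: eq_integral => ? /[!inE] xD; apply/esym/cvg_lim => //=.
    exact: cvg_nnsfun_approx.
  - by move=> n; exact/measurable_EFinP/measurable_funTS.
  - by move=> n ? _; rewrite lee_fin.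
  - by move=> ? _ ? ? mn; rewrite lee_fin; exact/lefP/nd_nnsfun_approx.
rewrite (_ : (fun n => _) = (fun n => \int[mu]_x ((f_ n x)%:E * (g x)%:E)))%E; last first.
  by apply/funext => n; exact: Hs.
rewrite -monotone_convergence//=.
- apply: eq_integral => x _; apply/cvg_lim => //=.
  apply: cvgeZr => //; exact: cvg_nnsfun_approx.
- move=> n; apply: emeasurable_funM; last exact/measurable_EFinP.
  by exact/measurable_EFinP/measurable_funTS.
- by move=> n x _; rewrite -EFinM lee_fin mulr_ge0.
- move=> x _ a b ab; rewrite -!EFinM lee_fin ler_wpM2r//.
  by exact/lefP/nd_nnsfun_approx.
Qed.

Section normal.
Context {R : realType}.
Implicit Types (m s a x y : R).
Local Notation leb := (@lebesgue_measure R).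

Lemma ge0_integral_normal_prob m s (f : R -> \bar R) :
  measurable_fun setT f -> (forall x, 0 <= f x)%E ->
  (\int[normal_prob m s]_x f x = \int[leb]_x (f x * (normal_pdf m s x)%:E))%E.
Proof.
move=> mf f0; apply: ge0_integral_density => //.
- exact: measurable_normal_pdf.
- by move=> x; exact: normal_pdf_ge0.
Qed.

Lemma measurable_affine m s : measurable_fun setT (fun y : R => m + s * y).
Proof. by apply: measurable_funD => //; apply: measurable_funM. Qed.

(* The library states this substitution for continuous integrands only. *)
Lemma ge0_integral_affine m s (f : R -> \bar R) : s != 0 ->
  measurable_fun setT f -> (forall x, 0 <= f x)%E ->
  (\int[leb]_x f x = `|s|%:E * \int[leb]_y f (m + s * y)%R)%E.
Proof.
move=> s0 mf f0.
have ns0 : 0 < `|s| by rewrite normr_gt0.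
have mA := measurable_affine m s.
pose k := NngNum (ltW ns0).
pose nu0 : {measure set (measurableTypeR R) -> \bar R} :=
  mscale k (pushforward leb ((fun y : R => m + s * y) : measurableTypeR R -> measurableTypeR R)).
pose nu := nu0 mA.
have E A : measurable A -> leb A = nu A.
  apply: lebesgue_measure_unique => X /ocitvP[->|[[a b] /= ab ->]].
    by rewrite !measure0.
  rewrite /nu /nu0/= /mscale/= /pushforward/=.
  have [sp|sn] := ltP 0 s.
    rewrite (_ : _ @^-1` _ = `](a - m) / s, (b - m) / s]%classic); last first.
      apply/seteqP; split => y /=; rewrite !in_itv/= ltr_pdivrMr// ler_pdivlMr// ltrBlDl lerBrDl (mulrC y)//.
    rewrite !lebesgue_measure_itv/= !lte_fin ab ltr_pM2r ?invr_gt0// ltrD2r ab.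
    rewrite -!EFinB -EFinM gtr0_norm// -mulrBl mulrC divfK//; congr EFin; ring.
  have {}sn : s < 0 by rewrite lt_neqAle s0 sn.
  rewrite (_ : _ @^-1` _ = `[(b - m) / s, (a - m) / s[%classic); last first.
    apply/seteqP; split => y /=; rewrite !in_itv/= ler_ndivrMr// ltr_ndivlMr// ltrBlDl lerBrDl (mulrC y) andbC//.
  rewrite !lebesgue_measure_itv/= !lte_fin ab ltr_nM2r ?invr_lt0// ltrD2r ab.
  rewrite -!EFinB -EFinM ltr0_norm// -mulrBl mulrC mulrN divfK//.
  congr EFin; ring.
rewrite (eq_measure_integral nu); last by move=> A mA' _; exact: E.
rewrite /nu /nu0 ge0_integral_mscale//=.
by rewrite ge0_integral_pushforward.
Qed.

Lemma normal_pdf_affine m s y : s != 0 ->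
  `|s| * normal_pdf m s (m + s * y) = normal_pdf 0 1 y.
Proof.
move=> s0; have ns0 : 0 < `|s| by rewrite normr_gt0.
rewrite !normal_pdfE ?oner_neq0// /normal_peak /normal_fun subr0 addrAC subrr add0r.
rewrite expr1n mul1r -mulrnAr sqrtrM ?sqr_ge0// sqrtr_sqr invfM mulrA mulrA divff ?gt_eqF//.
rewrite mul1r; congr (_ * expR _).
by field.
Qed.

Lemma normal_pdfNs m s : normal_pdf m (- s) = normal_pdf m s.
Proof. by rewrite /normal_pdf oppr_eq0 /normal_peak /normal_fun sqrrN. Qed.

Lemma measurable_normal_pdf_joint d (T : measurableType d) (f g : T -> R) s :
  measurable_fun setT f -> measurable_fun setT g ->
  measurable_fun setT (fun t => normal_pdf (f t) s (g t)).
Proof.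
move=> mf mg; rewrite /normal_pdf; have [_|s0] := eqVneq s 0.
  by apply: measurableT_comp => //; exact: measurable_indic.
apply: measurable_funM => //; rewrite /normal_fun.
apply: measurableT_comp => //; apply: measurable_funM => //.
apply: measurableT_comp => //; apply: measurable_funX => //.
exact: measurable_funB.
Qed.

Lemma ge0_integral_stdnormal_affine m s (f : R -> \bar R) : s != 0 ->
  measurable_fun setT f -> (forall x, 0 <= f x)%E ->
  (\int[normal_prob 0 1]_y f (m + s * y)%R =
   \int[leb]_u (f u * (normal_pdf m s u)%:E))%E.
Proof.
move=> s0 mf f0.
have mA := measurable_affine m s.
have mfA : measurable_fun setT (fun y : R => f (m + s * y)) := measurableT_comp mf mA.
rewrite (ge0_integral_normal_prob 0 1 mfA (fun y => f0 _)).
have mfp : measurable_fun setT (fun u => f u * (normal_pdf m s u)%:E)%E.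
  by apply: emeasurable_funM => //; apply/measurable_EFinP; exact: measurable_normal_pdf.
have fp0 u : (0 <= f u * (normal_pdf m s u)%:E)%E.
  by rewrite mule_ge0// lee_fin normal_pdf_ge0.
rewrite (ge0_integral_affine m s0 mfp fp0) -ge0_integralZl//=.
- apply: eq_integral => y _; rewrite muleCA -EFinM normal_pdf_affine//.
- apply: emeasurable_funM; first exact: mfA.
  apply/measurable_EFinP; exact: (measurable_normal_pdf_joint _ (f:=cst m)).
Qed.

(** Completing the square: the joint density of [x] and [u = a x + s y] is the marginal density of
    [u] times the conditional density of [x] given [u]. *)
Lemma normal_pdf_mul a s c x u : s != 0 -> c != 0 -> c ^+ 2 = a ^+ 2 + s ^+ 2 ->
  normal_pdf (a * x) s u * normal_pdf 0 1 x =
  normal_pdf 0 c u * normal_pdf (a * u / c ^+ 2) (s / c) x.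
Proof.
move=> s0 c0 cE; rewrite !normal_pdfE ?oner_neq0 ?mulf_neq0 ?invr_eq0//.
rewrite mulrACA [RHS]mulrACA; congr (_ * _).
  rewrite /normal_peak -!invfM; congr (_^-1).
  have H (t : R) : 0 <= t ^+ 2 * pi *+ 2.
    by rewrite mulrn_wge0// mulr_ge0 ?sqr_ge0 ?pi_ge0.
  by rewrite -(sqrtrM _ (H s)) -(sqrtrM _ (H c)); congr (Num.sqrt _); field.
rewrite /normal_fun -!expRD; congr expR.
rewrite (_ : s ^+ 2 = c ^+ 2 - a ^+ 2); last by rewrite cE; ring.
have sc : c ^+ 2 - a ^+ 2 != 0.
  by rewrite cE (_ : _ - _ = s ^+ 2) ?sqrf_eq0//; ring.
by rewrite expr_div_n (_ : s ^+ 2 = c ^+ 2 - a ^+ 2); [field; rewrite c0 sc|rewrite cE; ring].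
Qed.

(** Tonelli and [normal_pdf_mul]: the conditional density integrates to 1. Signs and zeros are
    allowed because [a] and [s] will come from arbitrary coefficients of a linear combination. *)
Lemma stdnormal_semigroup a s (f : R -> \bar R) :
  measurable_fun setT f -> (forall x, 0 <= f x)%E ->
  (\int[normal_prob 0 1]_x \int[normal_prob 0 1]_y f (a * x + s * y)%R =
   \int[normal_prob 0 1]_x f (Num.sqrt (a ^+ 2 + s ^+ 2) * x)%R)%E.
Proof.
move=> mf f0.
(* For [s = 0] the inner law is a point mass; what remains is that the law of [a * x] depends on the
   absolute value of [a] only. *)
have [->|s0] := eqVneq s 0.
  under eq_integral => x _.
    under eq_integral do rewrite mul0r addr0.
    rewrite integral_cst//= probability_setT mule1.
    over.
  rewrite expr0n addr0 sqrtr_sqr.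
  have [->|a0] := eqVneq a 0; first by rewrite normr0.
  have H b : b != 0 -> (\int[normal_prob 0 1]_x f (b * x)%R = \int[leb]_u (f u * (normal_pdf 0 b u)%:E))%E.
    by move=> b0; rewrite -ge0_integral_stdnormal_affine//; apply: eq_integral => x _; rewrite add0r.
  have [a_ge0|a_lt0] := leP 0 a; first by rewrite ger0_norm.
  rewrite (H _ a0) (H `|a|); last by rewrite normr_eq0.
  by rewrite (ltr0_norm a_lt0); apply: eq_integral => x _; rewrite normal_pdfNs.
set c := Num.sqrt _.
have c2 : c ^+ 2 = a ^+ 2 + s ^+ 2 by rewrite sqr_sqrtr// addr_ge0 ?sqr_ge0.
have c0 : c != 0.
  rewrite gt_eqF// sqrtr_gt0 ltr_wpDl ?sqr_ge0// lt_neqAle sqr_ge0 eq_sym sqrf_eq0.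
  by rewrite s0.
have mF : measurable_fun setT (fun z : R * R =>
    f z.2 * (normal_pdf (a * z.1) s z.2)%:E)%E.
  apply: emeasurable_funM; first exact: measurableT_comp.
  apply/measurable_EFinP; apply: measurable_normal_pdf_joint => //.
  exact: measurable_funM.
under eq_integral do rewrite ge0_integral_stdnormal_affine//.
rewrite (_ : (\int[normal_prob 0 1]_x f (c * x)%R)%E = \int[leb]_u (f u * (normal_pdf 0 c u)%:E))%E; last first.
  by rewrite -ge0_integral_stdnormal_affine//; apply: eq_integral => x _; rewrite add0r.
rewrite (ge0_integral_normal_prob 0 1); last 2 first.
- have F0 (z : R * R) : (0 <= f z.2 * (normal_pdf (a * z.1) s z.2)%:E)%E.
    by rewrite mule_ge0// lee_fin normal_pdf_ge0.
  by have := measurable_fun_fubini_tonelli_F (m2 := leb) _ mF F0.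
- move=> x; apply: integral_ge0 => u _.
  by rewrite mule_ge0// lee_fin normal_pdf_ge0.
transitivity (\int[leb]_x \int[leb]_u (f u * (normal_pdf (a * x) s u)%:E * (normal_pdf 0 1 x)%:E))%E.
  apply: eq_integral => x _; rewrite -ge0_integralZr; [by []|by []| | |].
  - apply: emeasurable_funM => //; apply/measurable_EFinP.
    exact: measurable_normal_pdf.
  - by move=> u _; rewrite mule_ge0// lee_fin normal_pdf_ge0.
  - by rewrite lee_fin normal_pdf_ge0.
have mG : measurable_fun setT (fun z : R * R =>
    f z.2 * (normal_pdf (a * z.1) s z.2)%:E * (normal_pdf 0 1 z.1)%:E)%E.
  apply: emeasurable_funM => //; apply/measurable_EFinP.
  exact: (measurable_normal_pdf_joint _ (f:=cst 0)).
have G0 (z : R * R) :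
    (0 <= f z.2 * (normal_pdf (a * z.1) s z.2)%:E * (normal_pdf 0 1 z.1)%:E)%E.
  by rewrite !mule_ge0// lee_fin normal_pdf_ge0.
rewrite [LHS](fubini_tonelli (m1 := leb) (m2 := leb) _ mG G0).
apply: eq_integral => u _.
transitivity (\int[leb]_x (f u * (normal_pdf 0 c u)%:E * (normal_pdf (a * u / c ^+ 2) (s / c) x)%:E))%E.
  by apply: eq_integral => x _ /=; rewrite -!muleA -!EFinM (@normal_pdf_mul _ _ c).
rewrite ge0_integralZl; [by rewrite integral_normal_pdf mule1|by []| | |].
- by apply/measurable_EFinP; exact: measurable_normal_pdf.
- by move=> x _; rewrite lee_fin normal_pdf_ge0.
- by rewrite mule_ge0// lee_fin normal_pdf_ge0.
Qed.

End normal.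

(** * Normal tails and quantiles *)

Section tail.
Context {R : realType}.
Implicit Types (s x y u v : R).
Local Notation leb := (@lebesgue_measure R).
Local Notation gam := (@normal_prob R 0 1).

Definition tail x : R := fine (gam `]x, +oo[).

Lemma tailE x : (tail x)%:E = gam `]x, +oo[.
Proof. by rewrite fineK// fin_num_measure. Qed.

Lemma tail_ge0 x : 0 <= tail x. Proof. exact: fine_ge0. Qed.

Lemma tail_decr x y : x <= y -> tail y <= tail x.
Proof.
move=> xy; rewrite -lee_fin !tailE; apply: le_measure; rewrite ?inE//.
by move=> z /=; rewrite !in_itv/= !andbT; exact: le_lt_trans.
Qed.

Lemma Phi_tail x : Phi x = 1 - tail x.
Proof.
rewrite /Phi; have : gam `]-oo, x] = (1 - gam `]x, +oo[)%E.
  by rewrite -[`]-oo, x]%classic]setCK setCitvl probability_setC.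
by move=> ->; rewrite -tailE.
Qed.

Lemma normal_pdf01E x : normal_pdf 0 1 x = normal_peak 1 * expR (- x ^+ 2 / 2).
Proof. by rewrite normal_pdfE ?oner_neq0// /normal_fun subr0 expr1n. Qed.

Lemma normal_probE (A : set R) : gam A = (\int[leb]_x ((\1_A x)%:E * (normal_pdf 0 1 x)%:E))%E.
Proof.
rewrite /normal_prob integral_mkcond; apply: eq_integral => x _.
by rewrite patchE indicE; case: ifPn => _; rewrite ?mul1e ?mul0e.
Qed.

(** After translation by [s] the density ratio at [z > x] is [expR (- z * s - s ^+ 2 / 2)]. This
    single inequality yields the Gaussian tail bound (at [x = 0]), the growth of quantiles [qt_log]
    and the gain in [tail_qt_scale]. *)
Lemma tail_shift x s : 0 <= x -> 0 <= s ->
  tail (x + s) <= expR (- (x * s) - s ^+ 2 / 2) * tail x.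
Proof.
move=> x0 s0; rewrite -lee_fin EFinM !tailE !normal_probE.
have mi (y : R) : measurable_fun setT (fun z : R => (\1_(`]y, +oo[%classic) z)%:E : \bar R).
  by apply/measurable_EFinP; exact: measurable_indic.
have mp : measurable_fun setT (fun z : R => (normal_pdf 0 1 z)%:E : \bar R).
  by apply/measurable_EFinP; exact: measurable_normal_pdf.
have mip y : measurable_fun setT (fun z : R => (\1_(`]y, +oo[%classic) z)%:E * (normal_pdf 0 1 z)%:E : \bar R)%E.
  exact: emeasurable_funM.
have ip0 y z : (0 <= (\1_(`]y, +oo[%classic) z)%:E * (normal_pdf 0 1 z)%:E :> \bar R)%E.
  by rewrite mule_ge0// lee_fin normal_pdf_ge0.
rewrite (ge0_integral_affine s (oner_neq0 R) (mip (x + s)) (ip0 (x + s))) normr1 mul1e.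
rewrite -(ge0_integralZl leb measurableT (mip x) (fun z _ => ip0 x z)) ?lee_fin ?expR_ge0//.
apply: ge0_le_integral => //.
- have mA := measurable_affine s 1.
  exact: (measurableT_comp (mip (x + s)) mA).
- by apply: measurable_funeM; exact: mip.
move=> z _; rewrite mul1r (addrC s z) !indicE !mem_setE !in_itv/= !andbT ltrD2r.
have [xz|zx] := ltP x z; last by rewrite !mul0e mule0.
rewrite !mul1e -EFinM lee_fin !normal_pdf01E mulrCA ler_wpM2l ?normal_peak_ge0//.
rewrite -expRD ler_expR; have : x * s <= z * s by rewrite ler_wpM2r// ltW.
by rewrite sqrrD => ?; lra.
Qed.

Lemma tail_sym x : gam `]-oo, - x[ = (tail x)%:E.
Proof.
rewrite tailE !normal_probE.
have m1 : measurable_fun setT (fun z : R => (\1_(`]-oo, (- x)[%classic) z)%:E * (normal_pdf 0 1 z)%:E : \bar R)%E.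
  apply: emeasurable_funM; apply/measurable_EFinP; [exact: measurable_indic|].
  exact: measurable_normal_pdf.
have h0 z : (0 <= (\1_(`]-oo, (- x)[%classic) z)%:E * (normal_pdf 0 1 z)%:E :> \bar R)%E.
  by rewrite mule_ge0// lee_fin normal_pdf_ge0.
have N10 : (-1 : R) != 0 by rewrite oppr_eq0 oner_neq0.
rewrite (ge0_integral_affine 0 N10 m1 h0) normrN1 mul1e; apply: eq_integral => z _.
rewrite add0r mulN1r !normal_pdf01E sqrrN !indicE !mem_setE !in_itv/= ltrN2 andbT.
by [].
Qed.

Lemma gam_set1 x : gam [set x] = 0%E.
Proof.
by rewrite /normal_prob integral_set1.
Qed.

Lemma tail_two_sided x : 0 <= x -> gam [set z | x < `|z|] = (2 * tail x)%:E.
Proof.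
move=> x0; have -> : [set z | x < `|z|] = `]-oo, (- x)[%classic `|` `]x, +oo[%classic.
  apply/seteqP; split => z /=; rewrite !in_itv/= andbT ltr_normr [x < - z]ltrNr.
    by move=> /orP[]; [right|left].
  by move=> [->|->]; rewrite ?orbT.
have dis : `]-oo, (- x)[%classic `&` `]x, +oo[%classic = set0.
  apply/seteqP; split => z //= []; rewrite !in_itv/= andbT => a b.
  by move: a b x0; lra.
have := tail_sym x; have := tailE x; move: dis.
set A := `]-oo, (- x)[%classic; set B := `]x, +oo[%classic => dis hB hA.
have mA : measurable (A : set R) by exact: measurable_itv.
have mB : measurable (B : set R) by exact: measurable_itv.
have U := measureU (normal_prob 0 1) mA mB dis.
apply: (etrans U); rewrite mulr_natl mulr2n.
exact: (congr2 (fun a b => (a + b)%E) hA (esym hB)).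
Qed.

Lemma tail0 : tail 0 = 2^-1.
Proof.
have := tail_two_sided (lexx 0).
have -> : [set z : R | 0 < `|z|] = ~` [set 0].
  by apply/seteqP; split => z /=; rewrite normr_gt0 => /eqP.
have e1 : gam [set~ 0] = (1 - 0)%E.
  apply: (etrans (probability_setC (normal_prob 0 1) (measurable_set1 0))).
  exact: (congr1 (fun a => (1 - a)%E) (gam_set1 0)).
by rewrite e1 sube0 => -[]; lra.
Qed.

Lemma peak_le1 : normal_peak 1 <= 1 :> R.
Proof.
have h : 1 <= Num.sqrt (1 ^+ 2 * pi *+ 2) :> R.
  rewrite -[leLHS]sqrtr1 ler_wsqrtr// expr1n mul1r mulr2n.
  by have := @pi_ge2 R; lra.
by rewrite /normal_peak invf_le1//; apply: lt_le_trans h.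
Qed.

Lemma gam_itv_oc x y : x <= y ->
  (gam `]x, y] <= (y - x)%:E)%E.
Proof.
move=> xy; rewrite /normal_prob.
apply: (@le_trans _ _ (\int[leb]_(z in `]x, y]) 1)%E).
  apply: ge0_le_integral => //.
  - by move=> z _; rewrite lee_fin normal_pdf_ge0.
  - by apply: measurable_funTS; apply/measurable_EFinP; exact: measurable_normal_pdf.
  - move=> z _; rewrite lee_fin; apply: le_trans peak_le1.
    by apply: normal_pdf_ub; exact: oner_neq0.
rewrite integral_cst//= lebesgue_measure_itv/= lte_fin mul1e.
by case: ltP => // yx; rewrite lee_fin subr_ge0.
Qed.

Lemma tail_diff x y : x <= y -> (tail x)%:E = (gam `]x, y] + (tail y)%:E)%E.
Proof.
move=> xy; rewrite !tailE.
have mA : measurable `]x, y] by exact: measurable_itv.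
have mB : measurable `]y, +oo[ by exact: measurable_itv.
have dis : `]x, y] `&` `]y, +oo[ = set0.
  apply/seteqP; split => z //= []; rewrite !in_itv/= andbT => /andP[_ a] b.
  by have := le_lt_trans a b; rewrite ltxx.
have U := measureU (normal_prob 0 1) mA mB dis.
apply: etrans (etrans _ U) _ => //; congr (gam _).
by apply: itv_bndbnd_setU; rewrite bnd_simp.
Qed.

Lemma tail_lipschitz x y : x <= y -> tail x <= tail y + (y - x).
Proof.
move=> xy; rewrite -lee_fin (tail_diff xy) EFinD [leRHS]addeC leeD2r//.
exact: gam_itv_oc.
Qed.

Definition tail_const : R := normal_peak 1 * expR (- 1).

Lemma tail_const_gt0 : 0 < tail_const.
Proof. by rewrite mulr_gt0 ?expR_gt0// normal_peak_gt0// oner_neq0. Qed.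

(** The mass of an interval of length one suffices, by [(x + 1)^2 / 2 <= x^2 + 1]. The exponent is
    twice the true one, which is harmless: lower bounds on quantiles are used up to constant
    factors. *)
Lemma tail_lower x : 0 <= x -> tail_const * expR (- x ^+ 2) <= tail x.
Proof.
move=> x0; have xy : x <= x + 1 by rewrite lerDl.
rewrite -lee_fin (tail_diff xy); apply: (@le_trans _ _ (gam `]x, x + 1])); last first.
  by rewrite leeDl// lee_fin tail_ge0.
rewrite /normal_prob.
apply: (@le_trans _ _ (\int[leb]_(z in `]x, (x + 1)%R]) (tail_const * expR (- x ^+ 2))%:E)%E).
  rewrite integral_cst//= lebesgue_measure_itv/= lte_fin ltrDl ltr01.
  by rewrite -EFinB -EFinM lee_fin addrAC subrr add0r mulr1.
apply: ge0_le_integral => //.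
- by move=> z _; rewrite lee_fin mulr_ge0 ?expR_ge0 ?(ltW tail_const_gt0).
- by apply: measurable_funTS; apply/measurable_EFinP; exact: measurable_normal_pdf.
move=> z /=; rewrite in_itv/= => /andP[xz zx]; rewrite lee_fin normal_pdf01E /tail_const.
rewrite -mulrA ler_wpM2l ?normal_peak_ge0// -expRD ler_expR.
have z2 : z ^+ 2 <= (x + 1) ^+ 2.
  by rewrite ler_sqr ?nnegrE ?addr_ge0//; exact: le_trans (ltW xz).
have := sqr_ge0 (x - 1); move: z2; rewrite sqrrB sqrrD expr1n mulr1; lra.
Qed.

Definition qt v : R := Phi_inv (1 - v).

Let A v := [set x | 1 - v <= Phi x].

Let AE v x : A v x <-> tail x <= v.
Proof. by rewrite /A /= Phi_tail lerD2l lerN2. Qed.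

Lemma tail_expR s : 0 <= s -> tail s <= expR (- s ^+ 2 / 2).
Proof.
move=> s0; have := tail_shift (lexx 0) s0; rewrite add0r mul0r oppr0 add0r tail0 => h.
rewrite mulNr; apply: le_trans h _.
by rewrite ler_piMr ?expR_ge0//; lra.
Qed.

Section quantile.
Variable v : R.
Hypothesis v_gt0 : 0 < v.
Hypothesis v_lt : v < 2^-1.

Let lnv_ge0 : 0 <= - ln v.
Proof.
have v1 : v <= 1 by move: v_lt; lra.
by rewrite oppr_ge0 ln_le0.
Qed.

Let A_bound : A v (Num.sqrt (2 * - ln v)).
Proof.
apply/AE; apply: le_trans (tail_expR (sqrtr_ge0 _)) _.
rewrite sqr_sqrtr ?mulr_ge0// mulrN opprK mulrC mulKf// lnK//.
Qed.

Let A_lb y : v < tail y -> lbound (A v) y.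
Proof.
move=> vy x /AE tx; rewrite leNgt; apply/negP => /ltW/tail_decr yx.
by have := lt_le_trans vy yx; rewrite ltNge tx.
Qed.

Let A_has_inf : has_inf (A v).
Proof.
split; first by exists (Num.sqrt (2 * - ln v)).
by exists 0; apply: A_lb; rewrite tail0.
Qed.

Lemma qt_le x : tail x <= v -> qt v <= x.
Proof. by move=> tx; apply: ge_inf; [case: A_has_inf|apply/AE]. Qed.

Lemma le_qt y : v < tail y -> y <= qt v.
Proof. by move=> vy; apply: lb_le_inf; [case: A_has_inf|exact: A_lb]. Qed.

(** The tail equals one half at 0 and decreases with slope at most 1. This keeps the last weights
    away from 0, where logarithmic bounds say nothing. *)
Lemma qt_lower : (2^-1 - v) / 2 <= qt v.
Proof.
apply: le_qt; set y := _ / 2; have y0 : 0 <= y by rewrite /y; move: v_lt; lra.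
by have := tail_lipschitz y0; rewrite tail0 subr0; move: v_lt; rewrite /y; lra.
Qed.

Lemma qt_gt0 : 0 < qt v.
Proof. by apply: lt_le_trans qt_lower; rewrite divr_gt0// subr_gt0. Qed.

(** The infimum defining the quantile is attained in the limit because [tail] is Lipschitz. *)
Lemma tail_qt : tail (qt v) <= v.
Proof.
apply/ler_addgt0Pr => e e0.
have [x /AE tx xe] := inf_adherent e0 A_has_inf.
apply: le_trans (tail_lipschitz (qt_le tx)) _.
apply: lerD => //; rewrite lerBlDl; exact: ltW.
Qed.

Lemma qt_sq_ub : qt v ^+ 2 <= 2 * - ln v.
Proof.
have h : qt v <= Num.sqrt (2 * - ln v) by apply: ge_inf; [case: A_has_inf|].
rewrite -(sqr_sqrtr (_ : 0 <= 2 * - ln v)) ?mulr_ge0//.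
by rewrite ler_sqr ?nnegrE ?sqrtr_ge0// ltW// qt_gt0.
Qed.

Lemma qt_sq_lb : ln (tail_const / v) <= qt v ^+ 2.
Proof.
have h := le_trans (tail_lower (ltW qt_gt0)) tail_qt.
have c0 := tail_const_gt0.
rewrite -ler_expR lnK ?posrE ?divr_gt0// ler_pdivrMr//.
have := ler_wpM2l (expR_ge0 (qt v ^+ 2)) h.
by rewrite mulrCA -expRD subrr expR0 mulr1.
Qed.

End quantile.

Lemma qt_decr u v : 0 < u -> u <= v -> v < 2^-1 -> qt v <= qt u.
Proof.
move=> u0 uv v2; have v0 := lt_le_trans u0 uv; have u2 := le_lt_trans uv v2.
by apply: qt_le => //; apply: le_trans uv; exact: tail_qt.
Qed.

(** [tail_shift] from [qt v] by the amount [s] with [expR (- qt v * s) = u / v]. *)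
Lemma qt_log u v : 0 < u -> u <= v -> v < 2^-1 -> qt u <= qt v + ln (v / u) / qt v.
Proof.
move=> u0 uv v2; have v0 := lt_le_trans u0 uv; have u2 := le_lt_trans uv v2.
have q0 := qt_gt0 v0 v2.
have l0 : 0 <= ln (v / u) by rewrite ln_ge0// ler_pdivlMr// mul1r.
apply: qt_le => //.
have s0 : 0 <= ln (v / u) / qt v by rewrite divr_ge0// ltW.
apply: le_trans (tail_shift (ltW q0) s0) _.
rewrite mulrCA divff ?gt_eqF// mulr1.
apply: (@le_trans _ _ (expR (- ln (v / u)) * v)).
  rewrite ler_pM ?expR_ge0 ?tail_ge0 ?tail_qt// ler_expR.
  by rewrite lerBlDr lerDl divr_ge0// sqr_ge0.
by rewrite expRN lnK ?posrE ?divr_gt0// invf_div divfK// gt_eqF.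
Qed.

(** Here a relative margin [k] above the quantile becomes a probability factor that vanishes as the
    quantile grows. *)
Lemma tail_qt_scale v k : 0 < v -> v < 2^-1 -> 0 <= k ->
  tail ((1 + k) * qt v) <= expR (- (k * qt v ^+ 2)) * v.
Proof.
move=> v0 v2 k0; have q0 := qt_gt0 v0 v2.
have s0 : 0 <= k * qt v by rewrite mulr_ge0// ltW.
rewrite mulrDl mul1r; apply: le_trans (tail_shift (ltW q0) s0) _.
rewrite ler_pM ?expR_ge0 ?tail_ge0 ?tail_qt// ler_expR.
by rewrite mulrCA -expr2 lerBlDr lerDl divr_ge0// sqr_ge0.
Qed.

Lemma qt_large K v : 0 <= K -> 0 < v -> v < 2^-1 -> v < tail_const * expR (- K ^+ 2) -> K <= qt v.
Proof.
move=> K0 v0 v2 h; apply: le_qt => //; exact: lt_le_trans h (tail_lower K0).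
Qed.

End tail.

(** * Independent blocks *)

(** Independence identifies the law of the pair with the product of the laws; the rest is Tonelli.
    It stands in for conditioning on [V]. *)
Lemma decoupling d d1 d2 (T : measurableType d) (T1 : measurableType d1)
    (T2 : measurableType d2) (R : realType) (P : probability T R)
    (U : T -> T1) (V : T -> T2) (F : T1 * T2 -> \bar R) :
  measurable_fun setT U -> measurable_fun setT V ->
  (forall A B, measurable A -> measurable B ->
    P (U @^-1` A `&` V @^-1` B) = P (U @^-1` A) * P (V @^-1` B))%E ->
  measurable_fun setT F -> (forall z, 0 <= F z)%E ->
  (\int[P]_w F (U w, V w) = \int[P]_w \int[P]_v F (U v, V w))%E.
Proof.
move=> mU mV indep mF F0.
pose mixU := isMeasurableFun.Build _ _ _ _ _ mU.
pose pU : {mfun T >-> T1} := HB.pack U mixU.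
pose mixV := isMeasurableFun.Build _ _ _ _ _ mV.
pose pV : {mfun T >-> T2} := HB.pack V mixV.
have mUV : measurable_fun setT (fun w => (U w, V w)) by exact: measurable_fun_pair.
pose mixUV := isMeasurableFun.Build _ _ _ _ _ mUV.
pose pUV : {mfun T >-> (T1 * T2)%type} := HB.pack (fun w => (U w, V w)) mixUV.
pose muU : probability T1 R := distribution P pU.
pose muV : probability T2 R := distribution P pV.
pose muUV : probability (T1 * T2)%type R := distribution P pUV.
have E X : measurable X -> (muU \x muV)%E X = muUV X.
  apply: product_measure_unique => A B mA mB.
  exact: indep.
transitivity (\int[muUV]_z F z)%E.
  by rewrite ge0_integral_distribution.
transitivity (\int[muU \x muV]_z F z)%E.
  by apply: eq_measure_integral => A mA _; exact/esym/E.
rewrite fubini_tonelli2//.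
rewrite (ge0_integral_distribution pV)//=; last 2 first.
- exact: measurable_fun_fubini_tonelli_G.
- by move=> y; apply: integral_ge0.
apply: eq_integral => w _.
rewrite /fubini_G (ge0_integral_distribution pU)//.
exact: measurable_fun_pair1.
Qed.

Section blocks.
Context d (T : measurableType d) (R : realType) (P : probability T R).
Context (I : finType) (Z : I -> T -> R).
Hypothesis mZ : forall i, measurable_fun setT (Z i).

(* Coordinates outside A are set to 0, so that all blocks live in the same space. *)
Definition block (A : pred I) (w : T) : #|I|.-tuple R :=
  [tuple if A (enum_val i) then Z (enum_val i) w else 0 | i < #|I|].

Lemma tnth_block A w i : tnth (block A w) (enum_rank i) = if A i then Z i w else 0.
Proof. by rewrite tnth_mktuple enum_rankK. Qed.

Lemma measurable_block A : measurable_fun setT (block A).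
Proof.
apply/measurable_fun_tnthP => i.
rewrite (_ : _ \o _ = fun w => if A (enum_val i) then Z (enum_val i) w else 0).
  by case: (A _).
by apply/funext => w /=; rewrite tnth_mktuple.
Qed.

(** A pi-system generating the sigma-algebra of tuples: independence of two blocks is verified on it
    and then extended. *)
Definition rectangle n : set (set (n.-tuple R)) :=
  [set B | exists C : 'I_n -> set R, (forall i, measurable (C i)) /\
     B = [set t | forall i, C i (tnth t i)]].

Lemma rectangle_setI n : setI_closed (@rectangle n).
Proof.
move=> _ _ [C [mC ->]] [D [mD ->]]; exists (fun i => C i `&` D i); split.
  by move=> i; exact: measurableI.
apply/seteqP; split => t /=; first by move=> [HC HD] i.
by move=> H; split => i; have [] := H i.
Qed.

Lemma measurable_rectangle n (B : set (n.-tuple R)) : rectangle B -> measurable B.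
Proof.
move=> [C [mC ->]].
rewrite (_ : [set t | _] = \bigcap_(i in [set: 'I_n]) ((fun t => tnth t i) @^-1` C i)); last first.
  by apply/seteqP; split => t /= H i; [move=> _|]; exact: H.
apply: fin_bigcap_measurable => [|i _]; first exact: finite_finset.
by rewrite -[X in measurable X]setTI; exact: measurable_tnth.
Qed.

Lemma rectangle_generates n : @measurable _ (n.-tuple R) = <<s @rectangle n >>.
Proof.
apply/seteqP; split; last first.
  apply: smallest_sub; first exact: sigma_algebra_measurable.
  exact: measurable_rectangle.
apply: smallest_sub; first exact: smallest_sigma_algebra.
move=> B; rewrite -bigcup_seq => -[i /= _ [C mC <-]].
apply: sub_sigma_algebra; exists (fun j => if j == i then C else setT); split.
  by move=> j; case: ifP.
rewrite setTI; apply/seteqP; split => t /=.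
  by move=> Ct j; case: eqP => // ->.
by move=> /(_ i); rewrite eqxx.
Qed.

Hypothesis indepZ : mutually_independent P Z.

Lemma measurable_preimage_block A B : measurable B -> measurable (block A @^-1` B).
Proof. by move=> mB; rewrite -[X in measurable X]setTI; exact: measurable_block. Qed.

(** Outside [A] the block is identically 0: a side containing 0 imposes nothing there, and a side
    missing 0 empties the preimage, which is [block_rectangle0]. *)
Lemma block_rectangle (A : pred I) (C : 'I_#|I| -> set R) :
  (forall i, ~~ A i -> C (enum_rank i) 0) ->
  block A @^-1` [set t | forall i, C i (tnth t i)] =
  \bigcap_(i in [set: I]) (Z i @^-1` (if A i then C (enum_rank i) else setT)).
Proof.
move=> C0; apply/seteqP; split => w /=.
  by move=> H i _; have := H (enum_rank i); rewrite tnth_block /=; case: (A i).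
move=> H i; rewrite -(enum_valK i) tnth_block.
by have := H (enum_val i) Logic.I; case: ifPn => // /C0.
Qed.

Lemma block_rectangle0 (A : pred I) (C : 'I_#|I| -> set R) i :
  ~~ A i -> ~ C (enum_rank i) 0 ->
  block A @^-1` [set t | forall i, C i (tnth t i)] = set0.
Proof.
move=> Ai Ci; apply/seteqP; split => // w /= /(_ (enum_rank i)).
by rewrite tnth_block (negbTE Ai).
Qed.

Lemma block_independent_rectangle (A : pred I) (B C : set (#|I|.-tuple R)) :
  rectangle B -> rectangle C ->
  (P (block A @^-1` B `&` block (predC A) @^-1` C) =
   P (block A @^-1` B) * P (block (predC A) @^-1` C))%E.
Proof.
move=> [B' [mB ->]] [C' [mC ->]].
have [[i [Ai Bi]]|hB] := pselect (exists i, ~~ A i /\ ~ B' (enum_rank i) 0).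
  by rewrite (block_rectangle0 Ai Bi) set0I measure0 mul0e.
have [[i [Ai Ci]]|hC] := pselect (exists i, ~~ predC A i /\ ~ C' (enum_rank i) 0).
  by rewrite (block_rectangle0 Ai Ci) setI0 measure0 mule0.
have {}hB i : ~~ A i -> B' (enum_rank i) 0.
  by move=> Ai; apply: contrapT => H; apply: hB; exists i.
have {}hC i : ~~ predC A i -> C' (enum_rank i) 0.
  by move=> Ai; apply: contrapT => H; apply: hC; exists i.
rewrite (block_rectangle hB) (block_rectangle hC) -bigcapI.
rewrite (_ : \bigcap_(i in _) _ = \bigcap_(i in [set: I])
   (Z i @^-1` (if A i then B' (enum_rank i) else C' (enum_rank i)))); last first.
  by apply: eq_bigcapr => i _ /=; case: (A i); rewrite /= ?setIT ?setTI.
rewrite !indepZ; last 3 first.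
- by move=> i; case: ifP.
- by move=> i; case: ifP.
- by move=> i; case: ifP.
rewrite -big_split/=; apply: eq_bigr => i _.
by case: (A i) => /=; rewrite preimage_setT probability_setT ?mule1 ?mul1e.
Qed.

Lemma block_independent (A : pred I) (B C : set (#|I|.-tuple R)) :
  measurable B -> measurable C ->
  (P (block A @^-1` B `&` block (predC A) @^-1` C) =
   P (block A @^-1` B) * P (block (predC A) @^-1` C))%E.
Proof.
move=> mB mC.
(* With [E] fixed, both sides are finite measures in [D] that agree on rectangles. Applying this to
   each argument in turn passes from pairs of rectangles to all measurable pairs. *)
have extend (V : T -> #|I|.-tuple R) (E : set T) : measurable_fun setT V -> measurable E ->
    (forall D, rectangle D -> P (E `&` V @^-1` D) = P E * P (V @^-1` D))%E ->
    (forall D, measurable D -> P (E `&` V @^-1` D) = P E * P (V @^-1` D))%E.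
  move=> mV mE H D mD.
  pose m1 : {measure set (#|I|.-tuple R) -> \bar R} := pushforward (mrestr P mE) V.
  have PE0 : 0 <= fine (P E) by rewrite fine_ge0.
  pose m2 : {measure set (#|I|.-tuple R) -> \bar R} :=
    mscale (NngNum PE0) (pushforward P V).
  have PEE : (fine (P E))%:E = P E by rewrite fineK// fin_num_measure.
  have m1E X : m1 mV X = P (V @^-1` X `&` E) by [].
  have m2E X : m2 mV X = (P E * P (V @^-1` X))%E by rewrite -PEE.
  suff: m1 mV D = m2 mV D by rewrite m1E m2E setIC.
  apply: (measure_unique (@rectangle #|I|) (fun=> setT)) => //.
  - exact: rectangle_generates.
  - exact: rectangle_setI.
  - by move=> _; exists (fun=> setT); split => //; apply/seteqP; split.
  - by rewrite bigcup_const.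
  - by move=> A' rA; rewrite [LHS]m1E [RHS]m2E setIC H.
  - move=> k; rewrite [X in (X < _)%E]m1E preimage_setT setTI.
    by rewrite ltey_eq fin_num_measure.
have mb := measurable_block.
have mp := measurable_preimage_block.
apply: (extend (block (predC A))) => // [|D rD]; first exact: mp.
rewrite setIC [RHS]muleC.
have mD : measurable (block (predC A) @^-1` D).
  by apply: mp; exact: measurable_rectangle.
have rect D' : rectangle D' ->
    (P (block (predC A) @^-1` D `&` block A @^-1` D') =
     P (block (predC A) @^-1` D) * P (block A @^-1` D'))%E.
  by move=> rD'; rewrite setIC [RHS]muleC; exact: block_independent_rectangle.
exact: (extend (block A) _ (mb A) mD rect B mB).
Qed.

Lemma block_decoupling (A : pred I) (F : #|I|.-tuple R * #|I|.-tuple R -> \bar R) :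
  measurable_fun setT F -> (forall z, 0 <= F z)%E ->
  (\int[P]_w F (block A w, block (predC A) w) =
   \int[P]_w \int[P]_v F (block A v, block (predC A) w))%E.
Proof.
move=> mF F0; apply: decoupling => //.
- exact: measurable_block.
- exact: measurable_block.
- by move=> B C mB mC; exact: block_independent.
Qed.

End blocks.

(** * Linear and quadratic forms in independent normal variables *)

Section gaussian_family.
Context d (T : measurableType d) (R : realType) (P : probability T R).
Local Notation gam := (@normal_prob R 0 1).

Lemma ge0_integral_normal_law (Y : T -> R) s (g : R -> \bar R) :
  s != 0 -> has_normal_law P Y 0 s -> measurable_fun setT g -> (forall x, 0 <= g x)%E ->
  (\int[P]_w g (Y w) = \int[gam]_z g (s * z)%R)%E.
Proof.
move=> s0 [mY law] mg g0.
pose mix := isMeasurableFun.Build _ _ T (measurableTypeR R) Y mY.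
pose pY : {mfun T >-> measurableTypeR R} := HB.pack Y mix.
transitivity (\int[distribution P pY]_x g x)%E.
  by rewrite ge0_integral_distribution.
transitivity (\int[normal_prob 0 s]_x g x)%E.
  by apply: eq_measure_integral => A mA _; exact: law.
rewrite (ge0_integral_normal_prob 0 s mg g0).
rewrite -(ge0_integral_stdnormal_affine 0 s0 mg g0).
by apply: eq_integral => x _; rewrite add0r.
Qed.

Lemma measurable_tnth1 d' (T' : measurableType d') N (h : T' -> N.-tuple R) i :
  measurable_fun setT h -> measurable_fun setT (fun x => tnth (h x) i).
Proof. by move=> mh; exact: (measurableT_comp (measurable_tnth i) mh). Qed.

Context (I : finType) (Z : I -> T -> R).
Hypothesis mZ : forall i, measurable_fun setT (Z i).
Hypothesis indepZ : mutually_independent P Z.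

Section equal_law.
Context (K : eqType) (e : K -> I) (s : R).
Hypothesis e_inj : injective e.
Hypothesis s_gt0 : 0 < s.
Let s_neq0 : s != 0. Proof. by rewrite gt_eqF. Qed.
Hypothesis lawZ : forall k, has_normal_law P (Z (e k)) 0 s.

(** Induction, splitting off one variable. Arbitrary nonnegative test functions are essential: the
    induction hypothesis is applied to [g], the average of [f] over the variable split off, and
    [stdnormal_semigroup] merges the two averages. *)
Lemma linear_comb_law (c : K -> R) (r : seq K) (f : R -> \bar R) : uniq r ->
  measurable_fun setT f -> (forall x, 0 <= f x)%E ->
  (\int[P]_w f (\sum_(k <- r) c k * Z (e k) w)%R =
   \int[gam]_z f (s * Num.sqrt (\sum_(k <- r) c k ^+ 2) * z)%R)%E.
Proof.
elim: r f => [|a r IH] f /=.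
  move=> _ mf f0; under eq_integral do rewrite big_nil.
  under [RHS]eq_integral do rewrite big_nil sqrtr0 mulr0 mul0r.
  by rewrite !integral_cst//= !probability_setT.
move=> /andP[ar ur] mf f0.
pose A : pred I := pred1 (e a).
pose F (z : #|I|.-tuple R * #|I|.-tuple R) : \bar R :=
  f (c a * tnth z.1 (enum_rank (e a)) + \sum_(k <- r) c k * tnth z.2 (enum_rank (e k))).
have mF : measurable_fun setT F.
  apply: (measurableT_comp mf); apply: measurable_funD.
    by apply: measurable_funM => //; apply: measurable_tnth1.
  by apply: measurable_sum => k; apply: measurable_funM => //; apply: measurable_tnth1.
have F0 z : (0 <= F z)%E by exact: f0.
have tA w : tnth (block Z A w) (enum_rank (e a)) = Z (e a) w.
  by rewrite tnth_block /A /= eqxx.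
have tB w k : k \in r -> tnth (block Z (predC A) w) (enum_rank (e k)) = Z (e k) w.
  move=> kr; rewrite tnth_block /A /= (inj_eq e_inj); case: eqP => // ka.
  by move: ar; rewrite -ka kr.
pose S w := \sum_(k <- r) c k * Z (e k) w.
have mS : measurable_fun setT S.
  by apply: measurable_sum => k; apply: measurable_funM.
have -> : (\int[P]_w f (\sum_(k <- (a :: r)) c k * Z (e k) w)%R =
           \int[P]_w F (block Z A w, block Z (predC A) w))%E.
  apply: eq_integral => w _; rewrite /F /= tA big_cons; congr (f (_ + _)).
  by rewrite big_seq [RHS]big_seq; apply: eq_bigr => k kr; rewrite tB.
rewrite (block_decoupling mZ indepZ A mF F0).
pose g (m : R) : \bar R := (\int[gam]_z f (m + s * c a * z)%R)%E.
have mf2 : measurable_fun setT (fun z : R * R => f (z.1 + s * c a * z.2)%R).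
  by apply: (measurableT_comp mf); apply: measurable_funD => //; apply: measurable_funM.
have mg : measurable_fun setT g.
  exact: (measurable_fun_fubini_tonelli_F (m2 := gam) _ mf2 (fun z => f0 _)).
have g0 m : (0 <= g m)%E by apply: integral_ge0.
transitivity (\int[P]_w g (S w))%E.
  apply: eq_integral => w _; rewrite /F /=.
  under eq_integral => v _.
    rewrite tA (_ : \sum_(k <- r) _ = S w); last first.
      by rewrite big_seq [RHS]big_seq; apply: eq_bigr => k kr; rewrite tB.
    over.
  have mh : measurable_fun setT (fun x : R => f (c a * x + S w)%R).
    by apply: (measurableT_comp mf); apply: measurable_funD => //; apply: measurable_funM.
  rewrite (ge0_integral_normal_law s_neq0 (lawZ a) mh (fun z => f0 _)) /g.
  by apply: eq_integral => z _; congr (f _); ring.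
rewrite (IH g ur mg g0) /g stdnormal_semigroup//.
apply: eq_integral => z _; congr (f (_ * _)).
rewrite big_cons !exprMn sqr_sqrtr; last by apply: sumr_ge0 => i _; rewrite sqr_ge0.
by rewrite -mulrDr addrC sqrtrM ?sqr_ge0// sqrtr_sqr gtr0_norm.
Qed.

Lemma square_exp_law (c M : R) (r : seq K) : uniq r ->
  (\int[gam]_z (expR (c * s ^+ 2 * z ^+ 2))%:E <= M%:E)%E ->
  (\int[P]_w (expR (c * \sum_(k <- r) Z (e k) w ^+ 2))%:E <= (M ^+ size r)%:E)%E.
Proof.
move=> ur HM.
have M0 : 0 <= M.
  by rewrite -lee_fin; apply: le_trans HM; apply: integral_ge0 => z _; rewrite lee_fin expR_ge0.
elim: r ur => [_|a r IH] /=.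
  under eq_integral do rewrite big_nil mulr0 expR0.
  by rewrite integral_cst//= probability_setT mule1 expr0.
move=> /andP[ar ur]; have {}IH := IH ur.
pose A : pred I := pred1 (e a).
pose E (y : #|I|.-tuple R) := expR (c * \sum_(k <- r) tnth y (enum_rank (e k)) ^+ 2).
pose h (x : R) := expR (c * x ^+ 2).
pose F (z : #|I|.-tuple R * #|I|.-tuple R) : \bar R :=
  (h (tnth z.1 (enum_rank (e a))) * E z.2)%:E.
have mh : measurable_fun setT h.
  by apply: measurableT_comp => //; apply: measurable_funM => //; exact: measurable_funX.
have mE0 : measurable_fun setT E.
  apply: measurableT_comp => //; apply: measurable_funM => //.
  by apply: measurable_sum => k; apply: measurable_funX; exact: measurable_tnth1.
have mF : measurable_fun setT F.
  apply/measurable_EFinP; apply: measurable_funM; last exact: (measurableT_comp mE0).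
  by apply: (measurableT_comp mh); exact: measurable_tnth1.
have F0 z : (0 <= F z)%E by rewrite lee_fin mulr_ge0 ?expR_ge0.
have tA w : tnth (block Z A w) (enum_rank (e a)) = Z (e a) w.
  by rewrite tnth_block /A /= eqxx.
have EB w : E (block Z (predC A) w) = expR (c * \sum_(k <- r) Z (e k) w ^+ 2).
  rewrite /E; congr (expR (_ * _)); rewrite big_seq [RHS]big_seq.
  apply: eq_bigr => k kr; rewrite tnth_block /A /= (inj_eq e_inj); case: eqP => // ka.
  by move: ar; rewrite -ka kr.
have -> : (\int[P]_w (expR (c * \sum_(k <- (a :: r)) Z (e k) w ^+ 2))%:E =
           \int[P]_w F (block Z A w, block Z (predC A) w))%E.
  by apply: eq_integral => w _; rewrite /F /= tA EB big_cons mulrDr expRD.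
rewrite (block_decoupling mZ indepZ A mF F0).
have mE : measurable_fun setT (fun w => (expR (c * \sum_(k <- r) Z (e k) w ^+ 2))%:E : \bar R).
  apply/measurable_EFinP; apply: measurableT_comp => //; apply: measurable_funM => //.
  by apply: measurable_sum => k; exact: measurable_funX.
pose M' := (\int[gam]_z (expR (c * s ^+ 2 * z ^+ 2))%:E)%E.
have M'0 : (0 <= M')%E by apply: integral_ge0 => z _; rewrite lee_fin expR_ge0.
have -> : (\int[P]_w \int[P]_v F (block Z A v, block Z (predC A) w) =
    \int[P]_w (M' * (expR (c * \sum_(k <- r) Z (e k) w ^+ 2))%:E))%E.
  apply: eq_integral => w _; rewrite /F /=.
  under eq_integral do rewrite tA EB EFinM.
  have mhE : measurable_fun setT (fun x : R => (h x)%:E : \bar R) by exact/measurable_EFinP.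
  have hE0 x : (0 <= (h x)%:E :> \bar R)%E by rewrite lee_fin expR_ge0.
  rewrite (ge0_integralZr P measurableT (measurableT_comp mhE (mZ (e a)))) ?lee_fin ?expR_ge0//; last first.
    by move=> x _; exact: hE0.
  rewrite (ge0_integral_normal_law s_neq0 (lawZ a) mhE hE0) /M'; congr (_ * _)%E.
  by apply: eq_integral => z _; rewrite /h exprMn mulrA.
rewrite (ge0_integralZl P measurableT mE) //.
rewrite exprS EFinM; apply: lee_pmul => //.
by apply: integral_ge0 => w _; rewrite lee_fin expR_ge0.
Qed.

End equal_law.

(** The integrand times the density is [t] times the normal density of variance [(1 - 2 * c)^-1], so
    the integral is exactly [t]. The bound follows from [1 + x <= expR x], since [(1 - 2c)(1 + 2c +
    8c^2) - 1 = 4c^2 (1 - 4c)]. *)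
Lemma integral_expR_sq (c : R) : c <= 4^-1 ->
  (\int[gam]_z (expR (c * z ^+ 2))%:E <= (expR (c + 4 * c ^+ 2))%:E)%E.
Proof.
move=> c4; have c2 : 0 < 1 - 2 * c by move: c4; lra.
pose t := (Num.sqrt (1 - 2 * c))^-1.
have t0 : 0 < t by rewrite invr_gt0 sqrtr_gt0.
have t2 : t ^+ 2 = (1 - 2 * c)^-1 by rewrite exprVn sqr_sqrtr// ltW.
have mexp : measurable_fun setT (fun z : R => (expR (c * z ^+ 2))%:E : \bar R).
  apply/measurable_EFinP; apply: measurableT_comp => //; apply: measurable_funM => //.
rewrite (ge0_integral_normal_prob 0 1 mexp); last by move=> z; rewrite lee_fin expR_ge0.
have -> : (\int[@lebesgue_measure R]_z ((expR (c * z ^+ 2))%:E * (normal_pdf 0 1 z)%:E) =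
           \int[@lebesgue_measure R]_z (t%:E * (normal_pdf 0 t z)%:E))%E.
  apply: eq_integral => z _; rewrite -!EFinM; congr EFin.
  rewrite !normal_pdfE ?oner_neq0 ?gt_eqF// mulrCA mulrA.
  have -> : normal_peak 1 = t * normal_peak t :> R.
    rewrite /normal_peak -mulrnAr sqrtrM ?sqr_ge0// sqrtr_sqr normr1 mul1r.
    by rewrite -[in RHS]mulrnAr sqrtrM ?sqr_ge0// sqrtr_sqr gtr0_norm// invfM mulrA divff ?mul1r// gt_eqF.
  rewrite -!mulrA; congr (_ * (_ * _)); rewrite /normal_fun -expRD !subr0 t2; congr expR.
  by field; rewrite gt_eqF.
rewrite ge0_integralZl//; last 3 first.
- by apply/measurable_EFinP; exact: measurable_normal_pdf.
- by move=> z _; rewrite lee_fin normal_pdf_ge0.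
- by rewrite lee_fin ltW.
rewrite integral_normal_pdf mule1 lee_fin.
rewrite -(@ler_pXn2r _ 2)// ?nnegrE ?expR_ge0 ?(ltW t0)// t2 -expRM_natl.
rewrite -(ler_pM2l c2) divff ?gt_eqF//.
apply: le_trans (_ : _ <= (1 - 2 * c) * (1 + 2 * (c + 4 * c ^+ 2))) _; last first.
  by rewrite ler_pM2l// expR_ge1Dx.
rewrite -subr_ge0 (_ : _ - _ = 4 * c ^+ 2 * (1 - 4 * c)); last by ring.
have c4' : 0 <= 1 - 4 * c by move: c4; lra.
by rewrite mulr_ge0// mulr_ge0 ?sqr_ge0.
Qed.

Section columns.
Context (n : nat) (K : eqType) (X : 'I_n -> K -> I) (W : 'I_n -> I) (s v M : R) (f : R -> R).
Hypothesis X_inj : forall i i' j j', X i j = X i' j' -> i = i' /\ j = j'.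
Hypothesis s_gt0 : 0 < s.
Hypothesis lawX : forall i j, has_normal_law P (Z (X i j)) 0 s.
Hypothesis mf : measurable_fun setT f.
Hypothesis f_ge0 : forall x, 0 <= f x.
Hypothesis f_int : forall t, 0 <= t -> t ^+ 2 <= v ->
  (\int[gam]_z (f (s * t * z))%:E <= M%:E)%E.

Definition bounded_part (w : T) : R := if \sum_i Z (W i) w ^+ 2 <= v then 1 else 0.
Definition inner (j : K) (w : T) : R := \sum_i Z (W i) w * Z (X i j) w.

Lemma measurable_bounded_part : measurable_fun setT bounded_part.
Proof.
apply: measurable_fun_ifT => //; apply: measurable_fun_ler => //.
by apply: measurable_sum => i; exact: measurable_funX.
Qed.

(** Given the [W] variables, inner products with distinct columns are independent centred normals
    whose common variance is [s ^+ 2] times the sum of squares. The factor [bounded_part] keeps that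
    sum in the range of [f_int], so each column costs at most [M]. [W] will be the noise or one
    column of the design. *)
Lemma columns_product (js : seq K) : uniq js -> 0 <= v ->
  (forall i i' j, j \in js -> X i j != W i') ->
  (\int[P]_w (bounded_part w * \prod_(j <- js) f (inner j w))%:E <= (M ^+ size js)%:E)%E.
Proof.
move=> ujs v0; elim: js ujs => [_ _|j js IH] /=.
  under eq_integral do rewrite big_nil mulr1.
  rewrite expr0 -(@probability_setT _ _ _ P) -[X in (_ <= X)%E]mul1e -integral_cst//.
  apply: ge0_le_integral => //.
  - by move=> w _; rewrite lee_fin /bounded_part; case: ifP.
  - apply/measurable_EFinP; exact: measurable_bounded_part.
  - by move=> w _; rewrite lee_fin /bounded_part; case: ifP.
move=> /andP[jjs ujs] XW; have {}IH : (\int[P]_w (bounded_part w * \prod_(j <- js) f (inner j w))%:E <= (M ^+ size js)%:E)%E.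
  by apply: IH => // i i' k kjs; apply: XW; rewrite inE kjs orbT.
(* The block [A] is the single column [j]; the other columns and [W] lie in the complementary block,
   by [X_inj] and [XW]. *)
pose A : pred I := fun a => [exists i, X i j == a].
pose B (y : #|I|.-tuple R) : R :=
  if \sum_i tnth y (enum_rank (W i)) ^+ 2 <= v then 1 else 0.
pose G (y : #|I|.-tuple R) : R := B y *
  \prod_(k <- js) f (\sum_i tnth y (enum_rank (W i)) * tnth y (enum_rank (X i k))).
pose F (z : #|I|.-tuple R * #|I|.-tuple R) : \bar R :=
  (f (\sum_i tnth z.2 (enum_rank (W i)) * tnth z.1 (enum_rank (X i j))) * G z.2)%:E.
have B0 y : 0 <= B y by rewrite /B; case: ifP.
have G0 y : 0 <= G y by rewrite mulr_ge0// prodr_ge0.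
have F0 z : (0 <= F z)%E by rewrite lee_fin mulr_ge0.
have mB : measurable_fun setT B.
  apply: measurable_fun_ifT => //; apply: measurable_fun_ler => //.
  by apply: measurable_sum => i; apply: measurable_funX; exact: measurable_tnth1.
have mG : measurable_fun setT G.
  apply: measurable_funM => //; apply: measurable_prod => k _; apply: measurableT_comp => //.
  by apply: measurable_sum => i; apply: measurable_funM; exact: measurable_tnth1.
have mF : measurable_fun setT F.
  apply/measurable_EFinP; apply: measurable_funM; last exact: (measurableT_comp mG).
  apply: (measurableT_comp mf); apply: measurable_sum => i.
  by apply: measurable_funM; exact: measurable_tnth1.
have tW w i : tnth (block Z (predC A) w) (enum_rank (W i)) = Z (W i) w.
  rewrite tnth_block /= /A; case: existsP => //= -[i' /eqP h].
  by have := XW i' i j (mem_head _ _); rewrite h eqxx.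
have tX w i : tnth (block Z A w) (enum_rank (X i j)) = Z (X i j) w.
  by rewrite tnth_block /A; case: existsP => // -[]; exists i.
have tX' w i k : k \in js -> tnth (block Z (predC A) w) (enum_rank (X i k)) = Z (X i k) w.
  move=> kjs; rewrite tnth_block /= /A; case: existsP => //= -[i' /eqP /X_inj[_ jk]].
  by move: jjs; rewrite jk kjs.
pose G' w := bounded_part w * \prod_(k <- js) f (inner k w).
have GE w : G (block Z (predC A) w) = G' w.
  rewrite /G /G' /B /bounded_part; congr (_ * _).
    by under eq_bigr do rewrite tW.
  rewrite big_seq [RHS]big_seq; apply: eq_bigr => k kjs; congr f.
  by apply: eq_bigr => i _; rewrite tW tX'.
have FE v' w : F (block Z A v', block Z (predC A) w) =
    ((f (\sum_i Z (W i) w * Z (X i j) v'))%:E * (G' w)%:E)%E.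
  rewrite /F /= GE EFinM; congr ((f _)%:E * _)%E.
  by apply: eq_bigr => i _; rewrite tW tX.
have -> : (\int[P]_w (bounded_part w * \prod_(k <- (j :: js)) f (inner k w))%:E =
   \int[P]_w F (block Z A w, block Z (predC A) w))%E.
  by apply: eq_integral => w _; rewrite FE big_cons -EFinM; congr EFin; rewrite mulrCA.
rewrite (block_decoupling mZ indepZ A mF F0).
have mG' : measurable_fun setT G'.
  rewrite (_ : G' = G \o block Z (predC A)); last by apply/funext => w /=; rewrite GE.
  by apply: measurableT_comp => //; exact: measurable_block.
have G'0 w : 0 <= G' w by rewrite -GE.
have M0 : 0 <= M.
  rewrite -lee_fin; apply: le_trans (f_int (lexx 0) _); last by rewrite expr0n.
  by apply: integral_ge0 => z _; rewrite lee_fin.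
apply: (@le_trans _ _ (\int[P]_w (M%:E * (G' w)%:E))%E); last first.
  have mG'E : measurable_fun setT (fun w => (G' w)%:E : \bar R) by exact/measurable_EFinP.
  rewrite (ge0_integralZl P measurableT mG'E) ?lee_fin//; last by move=> w _; rewrite lee_fin.
  by rewrite exprS EFinM; apply: lee_wpmul2l => //; rewrite lee_fin.
have mb := measurable_block mZ.
have mFT : measurable_fun setT (fun z : T * T => F (block Z A z.1, block Z (predC A) z.2)).
  apply: (measurableT_comp mF); apply: measurable_fun_pair.
    exact: (measurableT_comp (mb A)).
  exact: (measurableT_comp (mb (predC A))).
apply: ge0_le_integral => //.
- by move=> w _; apply: integral_ge0.
- exact: (measurable_fun_fubini_tonelli_G (m1 := P) _ mFT (fun z => F0 _)).
- by apply/measurable_EFinP; exact: measurable_funM.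
move=> w _; under eq_integral do rewrite FE.
have mfw (c : 'I_n -> R) : measurable_fun setT (fun v' => (f (\sum_i c i * Z (X i j) v'))%:E : \bar R).
  apply/measurable_EFinP; apply: measurableT_comp => //; apply: measurable_sum => i.
  exact: measurable_funM.
rewrite ge0_integralZr//; [|by move=> z _; rewrite lee_fin|by rewrite lee_fin].
have [Gw|/negbTE Gw] := boolP (\sum_i Z (W i) w ^+ 2 <= v); last first.
  by rewrite /G' /bounded_part Gw mul0r !mule0.
apply: lee_wpmul2r; first by rewrite lee_fin.
have mfE : measurable_fun setT (fun x : R => (f x)%:E : \bar R) by exact/measurable_EFinP.
have Xj_inj : injective (X ^~ j) by move=> i i' /X_inj[].
rewrite (@linear_comb_law _ (X ^~ j) s Xj_inj s_gt0 (fun i => lawX i j) (fun i => Z (W i) w)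
   (index_enum 'I_n) (fun x => (f x)%:E) (index_enum_uniq _) mfE); last by move=> x; rewrite lee_fin.
apply: f_int; first exact: sqrtr_ge0.
by rewrite sqr_sqrtr//; apply: sumr_ge0 => i _; rewrite sqr_ge0.
Qed.

End columns.
End gaussian_family.

(** * Concentration *)

Section concentration.
Context d (T : measurableType d) (R : realType) (P : probability T R).
Local Notation gam := (@normal_prob R 0 1).

Lemma markov_ge0 (g : T -> R) (x M : R) : measurable_fun setT g -> (forall w, 0 <= g w) ->
  0 < x -> (\int[P]_w (g w)%:E <= M%:E)%E ->
  (P [set w | (x <= g w)%R] <= (x^-1 * M)%:E)%E.
Proof.
move=> mg g0 x0 gM.
have mgE : measurable_fun setT (EFin \o g) by exact/measurable_EFinP.
have := le_integral_abse P measurableT mgE x0; rewrite setTI.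
have -> : [set w | (x%:E <= `|(EFin \o g) w|)%E] = [set w | x <= g w].
  by apply/seteqP; split => w /=; rewrite lee_fin ger0_norm.
have -> : (\int[P]_w `|(EFin \o g) w| = \int[P]_w (g w)%:E)%E.
  by apply: eq_integral => w _ /=; rewrite ger0_norm.
move=> h; have {}h := le_trans h gM.
by rewrite EFinM lee_pdivlMl.
Qed.

Context (I : finType) (Z : I -> T -> R).
Hypothesis mZ : forall i, measurable_fun setT (Z i).
Hypothesis indepZ : mutually_independent P Z.

(** Exponential Markov inequality. The sign [sg] treats the upper and the lower deviation at
    once. *)
Lemma chi_square_tail (K : eqType) (e : K -> I) (s eta sg : R) (r : seq K) :
  injective e -> 0 < s -> (forall k, has_normal_law P (Z (e k)) 0 s) ->
  uniq r -> 0 < eta -> eta <= 2 -> sg ^+ 2 = 1 ->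
  (P [set w | ((size r)%:R * s ^+ 2 * eta <=
       sg * (\sum_(k <- r) Z (e k) w ^+ 2 - (size r)%:R * s ^+ 2))%R] <=
   (expR (- ((size r)%:R * eta ^+ 2 / 16)))%:E)%E.
Proof.
move=> ei s0 law ur e0 e2 sg2; set N := (size r)%:R.
(* With [x] the absolute value of [c * s ^+ 2], the exponent per variable is [4 x^2 - x eta],
   minimal at [x = eta / 8] with value [- eta^2 / 16]. The bound [eta <= 2] keeps [x] within the
   range of [integral_expR_sq]. *)
pose c := sg * eta / 8 / s ^+ 2.
have s2 : 0 < s ^+ 2 by rewrite exprn_gt0.
have cs : c * s ^+ 2 = sg * eta / 8 by rewrite /c divfK// gt_eqF.
have sg1 : sg <= 1.
  by rewrite leNgt; apply/negP => h; have := sqr_ge0 (sg - 1); rewrite sqrrB sg2; lra.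
have c4 : c * s ^+ 2 <= 4^-1.
  rewrite cs; have : sg * eta <= 1 * eta by rewrite ler_wpM2r// ltW.
  by move: e2; lra.
pose M := expR (c * s ^+ 2 + 4 * (c * s ^+ 2) ^+ 2).
have HM : (\int[gam]_z (expR (c * s ^+ 2 * z ^+ 2))%:E <= M%:E)%E by exact: integral_expR_sq.
have := square_exp_law mZ indepZ ei s0 law ur HM.
set g := fun w => expR (c * \sum_(k <- r) Z (e k) w ^+ 2).
have mg : measurable_fun setT g.
  apply: measurableT_comp => //; apply: measurable_funM => //.
  by apply: measurable_sum => k; exact: measurable_funX.
move=> hM; have := markov_ge0 mg (fun w => expR_ge0 _) (expR_gt0 (N * (sg * eta / 8 + eta ^+ 2 / 8))) hM.
have diffE S : c * S - N * (sg * eta / 8 + eta ^+ 2 / 8) =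
    eta / 8 / s ^+ 2 * (sg * (S - N * s ^+ 2) - N * s ^+ 2 * eta).
  by rewrite /c; field; rewrite gt_eqF.
have H S : (N * (sg * eta / 8 + eta ^+ 2 / 8) <= c * S) =
    (N * s ^+ 2 * eta <= sg * (S - N * s ^+ 2)).
  by rewrite -subr_ge0 diffE pmulr_rge0 ?subr_ge0// divr_gt0// divr_gt0.
have -> : [set w | expR (N * (sg * eta / 8 + eta ^+ 2 / 8)) <= g w] =
   [set w | N * s ^+ 2 * eta <= sg * (\sum_(k <- r) Z (e k) w ^+ 2 - N * s ^+ 2)].
  apply/seteqP; split => w /=; by rewrite /g ler_expR H.
move=> h; apply: le_trans h _; rewrite lee_fin -expRN -expRM_natl -expRD ler_expR.
rewrite cs -/N le_eqVlt; apply/orP; left; apply/eqP.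
have -> : (sg * eta / 8) ^+ 2 = eta ^+ 2 / 64.
  by rewrite !exprMn sg2; field.
by field.
Qed.

Section columns.
Context (n : nat) (K : eqType) (X : 'I_n -> K -> I) (W : 'I_n -> I) (s v t : R).
Hypothesis X_inj : forall i i' j j', X i j = X i' j' -> i = i' /\ j = j'.
Hypothesis s_gt0 : 0 < s.
Hypothesis v_gt0 : 0 < v.
Hypothesis t_ge0 : 0 <= t.
Hypothesis lawX : forall i j, has_normal_law P (Z (X i j)) 0 s.

Let S (j : K) (w : T) : R := \sum_i Z (W i) w * Z (X i j) w.

(** The bound on the sum of squares is part of the event, so that the conditional variance is
    controlled without conditioning on another event. *)
Definition exceed (js : seq K) (r : nat) : set T :=
  [set w | \sum_i Z (W i) w ^+ 2 <= v /\ (r <= count (fun j => t < `|S j w|)%R js)%N].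

Let step (a x : R) := if t < `|x| then a else 1.

Let measurable_step a : measurable_fun setT (step a).
Proof.
apply: measurable_fun_ifT => //; apply: measurable_fun_ltr => //.
Qed.

Let prod_step a js w : \prod_(j <- js) step a (S j w) = a ^+ count (fun j => t < `|S j w|) js.
Proof.
elim: js => [|j js IH]; first by rewrite big_nil.
by rewrite big_cons IH /step /=; case: ifP => _; rewrite ?mul1r// exprS.
Qed.

Let exceedE a js r : 1 < a ->
  exceed js r = [set w | a ^+ r <= bounded_part Z W v w * \prod_(j <- js) step a (S j w)].
Proof.
move=> a1; apply/seteqP; split => w; rewrite /exceed /= prod_step /bounded_part.
  by move=> [-> rc]; rewrite mul1r ler_eXn2l.
have a0 : 0 < a ^+ r by rewrite exprn_gt0// (lt_trans _ a1).
case: ifP => [hv h|_]; last by rewrite mul0r leNgt a0.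
by split => //; move: h; rewrite mul1r ler_eXn2l.
Qed.

Let measurable_prod_step a js :
  measurable_fun setT (fun w => bounded_part Z W v w * \prod_(j <- js) step a (S j w)).
Proof.
apply: measurable_funM; first exact: measurable_bounded_part.
apply: measurable_prod => j _; apply: (measurableT_comp (measurable_step a)).
by apply: measurable_sum => i; exact: measurable_funM.
Qed.

Lemma measurable_exceed js r : measurable (exceed js r).
Proof.
rewrite (@exceedE 2); last by rewrite ltr1n.
rewrite -[X in measurable X]setTI.
have := measurable_prod_step 2 js measurableT (measurable_itv `[2 ^+ r, +oo[).
by congr measurable; congr (_ `&` _); apply/seteqP; split => w /=; rewrite in_itv/= andbT.
Qed.

(* Given W with sum of squares at most v, the inner products are independent
   centred normals of variance at most s^2 v: this is the Chernoff bound for the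
   number of exceedances, with weight 1 / r0 per exceedance. *)
Lemma exceed_prob (js : seq K) (r : nat) (r0 : R) : uniq js ->
  (forall i i' j, j \in js -> X i j != W i') -> 0 < r0 < 1 ->
  (size js)%:R * (2 * tail (t / (s * Num.sqrt v))) <= r0 * r%:R ->
  (P (exceed js r) <= ((r0 * expR (1 - r0)) ^+ r)%:E)%E.
Proof.
move=> ujs XW /andP[r00 r01] hr; pose a := r0^-1.
have a1 : 1 < a by rewrite invf_gt1.
have a0 : 0 < a by rewrite invr_gt0.
set pi := 2 * _ in hr.
have pi0 : 0 <= pi by rewrite mulr_ge0// tail_ge0.
pose M := 1 + (a - 1) * pi.
have sv0 : 0 < s * Num.sqrt v by rewrite mulr_gt0// sqrtr_gt0.
have step0 x : 0 <= step a x by rewrite /step; case: ifP => // _; exact: ltW.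
have int_step u : 0 <= u -> u ^+ 2 <= v -> (\int[gam]_z (step a (s * u * z))%:E <= M%:E)%E.
  move=> u0 uv; pose B := [set z : R | t / (s * Num.sqrt v) < `|z|].
  have mB : measurable B.
    rewrite -[B]setTI (_ : B = (fun z : R => `|z|) @^-1` `]t / (s * Num.sqrt v), +oo[%classic).
      by apply: (normr_measurable measurableT); exact: measurable_itv.
    by apply/seteqP; split => z; rewrite /B /= in_itv/= andbT.
  have gB : gam B = (pi%:E)%E by apply: tail_two_sided; rewrite divr_ge0// ltW.
  have uv' : u <= Num.sqrt v by rewrite -(ger0_norm u0) -sqrtr_sqr ler_wsqrtr.
  apply: (@le_trans _ _ (\int[gam]_z ((1 + (a - 1) * \1_B z)%:E))%E).
    apply: ge0_le_integral => //.
    - by move=> z _; rewrite lee_fin.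
    - apply/measurable_EFinP; apply: (measurableT_comp (measurable_step a)).
      exact: measurable_funM.
    - apply/measurable_EFinP; apply: measurable_funD => //; apply: measurable_funM => //.
    move=> z _; rewrite lee_fin /step indicE; case: ifP => h; last first.
      by rewrite lerDl mulr_ge0// subr_ge0 ltW.
    rewrite (_ : z \in B); first by rewrite mulr1 addrC subrK.
    rewrite inE /B /= ltr_pdivrMr//; apply: lt_le_trans h _.
    rewrite !normrM (gtr0_norm s_gt0) (ger0_norm u0) mulrC ler_wpM2l//.
    by rewrite ler_wpM2l// ltW.
  under eq_integral do rewrite EFinD EFinM.
  have mI : measurable_fun setT (fun z : R => (\1_B z)%:E : \bar R).
    by apply/measurable_EFinP; exact: measurable_indic.
  have I0 z : (0 <= (a - 1)%:E * (\1_B z)%:E :> \bar R)%E.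
    by rewrite -EFinM lee_fin mulr_ge0// subr_ge0 ltW.
  rewrite (ge0_integralD gam measurableT) ?(ge0_integralZl gam measurableT mI)//; last first.
  - by apply: measurable_funeM.
  - by rewrite lee_fin subr_ge0 ltW.
  rewrite integral_cst//= integral_indic// setIT.
  rewrite (_ : normal_prob 0 1 setT = 1%E); last exact: probability_setT.
  by rewrite mul1e [X in (1 + _ * X)%E]gB.
have := columns_product mZ indepZ X_inj s_gt0 lawX (measurable_step a) step0 int_step ujs (ltW v_gt0) XW.
move=> h; rewrite (exceedE js r a1).
have g0 w : 0 <= bounded_part Z W v w * \prod_(j <- js) step a (S j w).
  by rewrite mulr_ge0 ?prodr_ge0// /bounded_part; case: ifP.
have ar0 : 0 < a ^+ r by rewrite exprn_gt0.
apply: le_trans (markov_ge0 (measurable_prod_step a js) g0 ar0 h) _.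
rewrite lee_fin /a -exprVn invrK exprMn ler_wpM2l ?exprn_ge0 ?(ltW r00)//.
(* [M] is at most [expR ((a - 1) * pi)]. By hypothesis the expected count is at most [r0 * r], and
   [(a - 1) * r0 = 1 - r0]. *)
apply: (@le_trans _ _ (expR ((a - 1) * pi) ^+ size js)).
  by rewrite lerXn2r ?nnegrE ?expR_ge0 ?expR_ge1Dx// addr_ge0// mulr_ge0// subr_ge0 ltW.
rewrite -!expRM_natl ler_expR mulrCA.
apply: (@le_trans _ _ ((a - 1) * (r0 * r%:R))); first by rewrite ler_wpM2l// subr_ge0 ltW.
by rewrite /a mulrA mulrBl mulVf ?gt_eqF// mul1r mulrC.
Qed.

End columns.
End concentration.

(** * The sorted l1 norm *)

Section weighted_sums.
Context {R : realType}.
Implicit Types (t : nat -> R) (s : seq R).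

Definition decr t := forall i j, (i <= j)%N -> t j <= t i.
Definition wsum t s := \sum_(i < size s) t i * nth 0 s i.
Local Notation geR := (fun x y : R => y <= x).

Lemma wsum_cons t x s : wsum t (x :: s) = t 0 * x + wsum (t \o S) s.
Proof. by rewrite /wsum big_ord_recl. Qed.

Lemma wsum_cat t s1 s2 :
  wsum t (s1 ++ s2) = wsum t s1 + wsum (fun i => t (size s1 + i)%N) s2.
Proof.
elim: s1 t => [|x s1 IH] t; first by rewrite {2}/wsum big_ord0 add0r.
by rewrite /= !wsum_cons IH addrA; congr (_ + _); apply: eq_bigr => i _ /=; rewrite addSn.
Qed.

Lemma wsum_nseq0 t n : wsum t (nseq n 0) = 0.
Proof. by rewrite /wsum big1// => i _; rewrite nth_nseq if_same mulr0. Qed.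

Lemma decrS t : decr t -> decr (t \o S).
Proof. by move=> dt i j ij; apply: dt. Qed.

Let geR_trans : transitive geR. Proof. by move=> y x z /= xy yz; exact: le_trans yz xy. Qed.
Let geR_total : total geR. Proof. by move=> x y; exact: le_total. Qed.
Let geR_anti : antisymmetric geR.
Proof. by move=> x y /andP[a b]; apply/eqP; rewrite eq_le a b. Qed.

(** Exchanging adjacent entries gains [(a - b) * (y - x) >= 0]. This is the induction step of the
    rearrangement inequality [wsum_sort]. *)
Lemma wsum_insert t x s : decr t -> t 0 * x + wsum (t \o S) s <= wsum t (merge geR [:: x] s).
Proof.
elim: s t => [|y s IH] t dt; first by rewrite /= wsum_cons.
rewrite [merge _ _ _]/=; case: ifPn => [yx|]; first by rewrite [leRHS]wsum_cons.
rewrite -ltNge => xy; rewrite !wsum_cons.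
apply: (le_trans _ (lerD (lexx _) (IH _ (decrS dt)))) => /=.
have := dt 0 1 isT; move: (t 0) (t 1%N) => a b ba.
rewrite !addrA lerD2r -subr_ge0.
rewrite (_ : _ - _ = (a - b) * (y - x)); last by ring.
by rewrite mulr_ge0// subr_ge0// ltW.
Qed.

Lemma wsum_sort t s s' : decr t -> perm_eq s s' -> sorted geR s' -> wsum t s <= wsum t s'.
Proof.
elim: s t s' => [|x s IH] t s' dt ps ss'.
  by move: ps; rewrite perm_sym => /perm_nilP ->.
pose s'' := sort geR s.
have -> : s' = merge geR [:: x] s''.
  apply: (sorted_eq geR_trans geR_anti) => //.
    by apply: merge_sorted => //; exact: sort_sorted.
  have : perm_eq (merge geR [:: x] s'') ([:: x] ++ s'') by exact/permPl/perm_merge.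
  move=> H; rewrite perm_sym (perm_trans H)// (perm_trans _ ps)//.
  by rewrite perm_cons perm_sort.
apply: le_trans (wsum_insert _ _ dt).
rewrite wsum_cons lerD2l; apply: IH; [exact: decrS| |exact: sort_sorted].
by rewrite perm_sym perm_sort.
Qed.

Lemma wsum_le t t' s : (forall i, t i <= t' i) -> (forall x, x \in s -> 0 <= x) ->
  wsum t s <= wsum t' s.
Proof.
by move=> tt' s0; apply: ler_sum => i _; rewrite ler_wpM2r// s0// mem_nth.
Qed.

End weighted_sums.

Section sorted_penalty.
Context {R : realType} (p : nat).
Implicit Types (t : nat -> R) (b : 'cV[R]_p) (I : pred 'I_p).
Local Notation geR := (fun x y : R => y <= x).

(** Weights are functions on [nat] so that they can be shifted: [J (fun i => t (m + i)%N)] is the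
    penalty available once the first [m] ranks are taken. *)
Definition J t b := slope_penalty (fun i : 'I_p => t i) b.

Let sorted_size b : size (sorted_abs b) = p.
Proof. by rewrite size_sort size_map size_enum_ord. Qed.

Lemma J_wsum t b : J t b = wsum t (sorted_abs b).
Proof. by rewrite /J /slope_penalty /wsum sorted_size. Qed.

Lemma sorted_absP b : sorted geR (sorted_abs b).
Proof. by apply: sort_sorted => x y; exact: le_total. Qed.

(** With [J_attained], this makes [J t b] a maximum of weighted sums over orderings of the
    coordinates. Norm properties then reduce to one ordering, fixed by the left-hand side. *)
Lemma J_ge t b (s : seq 'I_p) : decr t -> perm_eq s (enum 'I_p) ->
  wsum t [seq `|b i 0| | i <- s] <= J t b.
Proof.
move=> dt ps; rewrite J_wsum; apply: wsum_sort => //; last exact: sorted_absP.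
by rewrite perm_sym perm_sort perm_sym perm_map.
Qed.

Lemma J_le t b s : decr t -> perm_eq (sorted_abs b) s -> sorted geR s -> J t b <= wsum t s.
Proof. by rewrite J_wsum => dt ps ss; exact: wsum_sort. Qed.

Lemma J_attained t b : exists s, [/\ perm_eq s (enum 'I_p),
   sorted (fun i j : 'I_p => `|b j 0| <= `|b i 0|) s & J t b = wsum t [seq `|b i 0| | i <- s]].
Proof.
exists (sort (fun i j : 'I_p => `|b j 0| <= `|b i 0|) (enum 'I_p)); split.
- by rewrite perm_sort.
- by apply: sort_sorted => i j; exact: le_total.
- by rewrite J_wsum /sorted_abs sort_map.
Qed.

Lemma wsum_map t (f : 'I_p -> R) s : perm_eq s (enum 'I_p) ->
  wsum t [seq f i | i <- s] = \sum_(i < p) t i * f (nth i s i).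
Proof.
move=> ps; have sz : size s = p by rewrite (perm_size ps) size_enum_ord.
rewrite /wsum size_map sz; apply: eq_bigr => i _.
by rewrite (nth_map i)// sz.
Qed.

Lemma sum_perm (f : 'I_p -> R) s : perm_eq s (enum 'I_p) ->
  \sum_j f j = \sum_(i < p) f (nth i s i).
Proof.
move=> ps; have := wsum_map (fun=> 1) f ps.
under [X in _ = X -> _]eq_bigr do rewrite mul1r.
move=> <-; have -> (L : seq R) : wsum (fun=> 1) L = \sum_(i < size L) nth 0 L i.
  by apply: eq_bigr => i _; rewrite mul1r.
rewrite -(big_mkord xpredT (fun i => nth 0 [seq f i | i <- s] i)) -(big_nth 0 xpredT id).
by rewrite big_map (perm_big _ ps)/= big_enum.
Qed.

Lemma J_ge0 t b : (forall i, 0 <= t i) -> 0 <= J t b.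
Proof.
move=> t0; have [s [ps _ ->]] := J_attained t b.
by rewrite wsum_map//; apply: sumr_ge0 => i _; rewrite mulr_ge0.
Qed.

Lemma J_triangle t a b : (forall i, 0 <= t i) -> decr t -> J t (a + b) <= J t a + J t b.
Proof.
move=> t0 dt; have [s [ps _ ->]] := J_attained t (a + b).
apply: le_trans (lerD (J_ge a dt ps) (J_ge b dt ps)).
rewrite !wsum_map// -big_split/=; apply: ler_sum => i _.
by rewrite -mulrDr ler_wpM2l// mxE ler_normD.
Qed.

Lemma J_scale t c b : decr t -> J t (c *: b) <= `|c| * J t b.
Proof.
move=> dt; have [s [ps _ ->]] := J_attained t (c *: b).
apply: le_trans (ler_wpM2l (normr_ge0 c) (J_ge b dt ps)).
rewrite !wsum_map// mulr_sumr; apply: ler_sum => i _.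
by rewrite mxE normrM mulrCA.
Qed.

Lemma J_le_l1 t b : decr t -> J t b <= t 0 * \sum_j `|b j 0|.
Proof.
move=> dt; have [s [ps _ ->]] := J_attained t b.
rewrite wsum_map// (sum_perm (fun j => `|b j 0|) ps) mulr_sumr; apply: ler_sum => i _.
by rewrite ler_wpM2r// dt.
Qed.

Lemma J_mono t t' b : (forall i, t i <= t' i) -> decr t' -> J t b <= J t' b.
Proof.
move=> tt' dt'; have [s [ps _ ->]] := J_attained t b.
apply: le_trans (J_ge b dt' ps); apply: wsum_le => // x /mapP[i _ ->]; exact: normr_ge0.
Qed.

Definition restr I b : 'cV[R]_p := \col_j (if I j then b j 0 else 0).

Lemma restrE I b j : restr I b j 0 = if I j then b j 0 else 0.
Proof. by rewrite mxE. Qed.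

Lemma restrD I b : b = restr I b + restr (predC I) b.
Proof.
by apply/matrixP => i j; rewrite ord1 !mxE /=; case: (I i) => /=; rewrite ?addr0 ?add0r.
Qed.

Definition order I b : seq 'I_p :=
  sort (fun i j : 'I_p => `|b j 0| <= `|b i 0|) [seq j <- enum 'I_p | I j].

Lemma size_order I b : size (order I b) = #|I|.
Proof. by rewrite size_sort cardE enumT. Qed.

Lemma mem_order I b j : (j \in order I b) = I j.
Proof. by rewrite mem_sort mem_filter mem_enum andbT. Qed.

Lemma J_restr t I b : decr t -> J t (restr I b) <= wsum t [seq `|b j 0| | j <- order I b].
Proof.
move=> dt.
pose z := nseq (size [seq j <- enum 'I_p | predC I j]) (0 : R).
apply: (@le_trans _ _ (wsum t ([seq `|b j 0| | j <- order I b] ++ z))); last first.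
  by rewrite wsum_cat wsum_nseq0 addr0.
apply: J_le => //.
- rewrite /sorted_abs perm_sort; pose f j := `|restr I b j 0|.
  have -> : [seq `|b j 0| | j <- order I b] = map f (order I b).
    by apply/eq_in_map => j; rewrite mem_order /f restrE => ->.
  have -> : z = map f [seq j <- enum 'I_p | predC I j].
    rewrite /z; elim: (enum _) => //= j L IH.
    by case Ij: (I j) => //=; rewrite IH /f restrE Ij normr0.
  rewrite -map_cat; apply: perm_map.
  apply: (@perm_trans _ ([seq j <- enum 'I_p | I j] ++ [seq j <- enum 'I_p | predC I j])).
    by rewrite perm_sym; apply/permPl; exact: perm_filterC.
  by rewrite perm_cat2r perm_sym perm_sort.
- have tr : transitive geR by move=> y x w /= xy yw; exact: le_trans yw xy.
  have : sorted geR [seq `|b j 0| | j <- order I b].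
    rewrite sorted_map; apply: sort_sorted => i j; exact: le_total.
  rewrite !sorted_pairwise// pairwise_cat => ->; apply/andP; split.
    apply/allrelP => x y /mapP[j _ ->]; rewrite mem_nseq => /andP[_ /eqP ->].
    exact: normr_ge0.
  by rewrite /= -sorted_pairwise// /z; elim: size => //= -[|n]//= ->; rewrite lexx.
Qed.

(** Listing the coordinates of [I] first and the others after them, each group sorted, is one
    admissible ordering in [J_ge]; the second group meets the weights from rank [#|I|] on. *)
Lemma J_split t I b : decr t ->
  J t (restr I b) + J (fun i => t (#|I| + i)%N) (restr (predC I) b) <= J t b.
Proof.
move=> dt; have dt' : decr (fun i => t (#|I| + i)%N).
  by move=> i j ij; apply: dt; rewrite leq_add2l.
apply: le_trans (lerD (J_restr I b dt) (J_restr (predC I) b dt')) _.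
have := J_ge b dt (_ : perm_eq (order I b ++ order (predC I) b) (enum 'I_p)).
rewrite map_cat wsum_cat size_map size_order; apply.
apply: uniq_perm; [|exact: enum_uniq|].
- have u (A : pred 'I_p) : uniq (order A b) by rewrite sort_uniq filter_uniq// enum_uniq.
  rewrite cat_uniq; apply/and3P; split; [exact: u| |exact: u].
  by apply/hasPn => j; rewrite !mem_order /=.
- by move=> j; rewrite mem_cat !mem_order mem_enum /= orbN.
Qed.

(* |a|_(i) <= t_i for every i *)
Definition dominated t (a : 'I_p -> R) :=
  forall i : 'I_p, (#|[pred j : 'I_p | (t i < `|a j|)%R]| <= i)%N.

(** Duality for the sorted l1 norm. Order the coordinates by the size of [a]: if the entry at
    position [i] exceeded [t i], so would the [i] entries before it, giving [i + 1] exceedances. *)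
Lemma dominated_sum t a b : decr t -> dominated t a ->
  \sum_j `|a j| * `|b j 0| <= J t b.
Proof.
move=> dt da.
pose r := fun i j : 'I_p => `|a j| <= `|a i|.
have rtot : total r by move=> i j; exact: le_total.
have rtr : transitive r by move=> y x w xy yw; exact: le_trans yw xy.
have ps : perm_eq (sort r (enum 'I_p)) (enum 'I_p) by rewrite perm_sort.
set s := sort r _ in ps.
have ss : sorted r s by exact: sort_sorted.
have sz : size s = p by rewrite (perm_size ps) size_enum_ord.
have us : uniq s by rewrite (perm_uniq ps) enum_uniq.
apply: le_trans (J_ge b dt ps); rewrite wsum_map// (sum_perm (fun j => `|a j| * `|b j 0|) ps).
apply: ler_sum => i _; rewrite ler_wpM2r// leNgt; apply/negP => ti.
have := da i; rewrite leqNgt => /negP; apply.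
have ut : uniq (take i.+1 s) by exact: take_uniq.
have st : size (take i.+1 s) = i.+1 by rewrite size_takel// sz.
rewrite -st -(card_uniqP ut); apply: subset_leq_card; apply/fintype.subsetP => j jt.
rewrite inE; apply: lt_le_trans ti _.
have [l ll <-] : exists2 l, (l < i.+1)%N & nth i s l = j.
  by move/(nthP i): jt => [l]; rewrite st => ll <-; exists l; rewrite ?nth_take.
have [li|li] := ltnP l i; last first.
  by rewrite (_ : l = i)//; apply/eqP; rewrite eqn_leq -ltnS ll.
have := sorted_ltn_nth rtr i ss; apply => //; rewrite inE sz//.
by rewrite (leq_trans ll).
Qed.

(** Young's inequality for each rank. The coefficient [8^-1] is half of the [4^-1] in [quad_lower],
    so that the quadratic term can be absorbed. *)
Lemma J_restr_sq t I b : (forall i, 0 <= t i) -> decr t ->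
  2 * J t (restr I b) <= 8 * (\sum_(i < #|I|) t i ^+ 2) + 8^-1 * \sum_j (restr I b j 0) ^+ 2.
Proof.
move=> t0 dt.
apply: le_trans (ler_wpM2l _ (J_restr I b dt)) _ => //.
rewrite /wsum size_map size_order.
have -> : \sum_j restr I b j 0 ^+ 2 = \sum_(i < #|I|) nth 0 [seq `|b j 0| | j <- order I b] i ^+ 2.
  rewrite -(big_mkord xpredT (fun i => nth 0 [seq `|b i 0| | i <- order I b] i ^+ 2)).
  rewrite -(size_order I b) -(size_map (fun j => `|b j 0|)).
  rewrite -(big_nth 0 xpredT (fun x => x ^+ 2)) big_map.
  rewrite [RHS](perm_big [seq j <- enum 'I_p | I j]) ?perm_sort//= big_filter big_enum_cond/= [RHS]big_mkcond.
  by apply: eq_bigr => j _; rewrite restrE; case: (I j); rewrite ?real_normK ?num_real ?expr0n.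
rewrite !mulr_sumr -big_split/=; apply: ler_sum => i _.
move: (t i) (nth _ _ _) => x y.
rewrite -subr_ge0 (_ : _ - _ = 8^-1 * (8 * x - y) ^+ 2); last by field.
by rewrite mulr_ge0// sqr_ge0.
Qed.

(* The largest entry gets the positive weight t 0. *)
Lemma J_eq0 t b : (forall i, 0 <= t i) -> decr t -> J t b <= 0 -> 0 < t 0 -> b = 0.
Proof.
move=> t0 dt Jb tpos; apply/matrixP => i j; rewrite ord1 mxE.
apply/eqP; rewrite -normr_le0 leNgt; apply/negP => bi.
have := Jb; rewrite leNgt => /negP; apply.
have ps : perm_eq (i :: rem i (enum 'I_p)) (enum 'I_p).
  by rewrite perm_sym; apply: perm_to_rem; rewrite mem_enum.
apply: lt_le_trans (J_ge b dt ps); rewrite /= wsum_cons ltr_pwDl ?mulr_gt0//.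
apply: sumr_ge0 => l _; rewrite mulr_ge0//; first exact: t0.
by have /mapP[? _ ->] := mem_nth 0 (ltn_ord l); exact: normr_ge0.
Qed.

End sorted_penalty.

(** * Deterministic error bound *)

Section deterministic.
Context {R : realType} (n p : nat).
Implicit Types (t : nat -> R) (X : 'M[R]_(n, p)) (e : 'cV[R]_n) (u v b h : 'cV[R]_p).

Definition dot m (v w : 'cV[R]_m) := \sum_i v i 0 * w i 0.

Lemma sqnormE m (v : 'cV[R]_m) : sqnorm v = dot v v.
Proof. by apply: eq_bigr => i _; rewrite expr2. Qed.

Lemma sqnorm_ge0 m (v : 'cV[R]_m) : 0 <= sqnorm v.
Proof. by apply: sumr_ge0 => i _; rewrite sqr_ge0. Qed.

Lemma sqnormD m (v w : 'cV[R]_m) : sqnorm (v + w) = sqnorm v + 2 * dot v w + sqnorm w.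
Proof.
rewrite /dot /sqnorm mulr_sumr -!big_split/=; apply: eq_bigr => i _.
by rewrite mxE; ring.
Qed.

Lemma sqnormZ m c (v : 'cV[R]_m) : sqnorm (c *: v) = c ^+ 2 * sqnorm v.
Proof. by rewrite /sqnorm mulr_sumr; apply: eq_bigr => i _; rewrite mxE exprMn. Qed.

Definition gram X j l := \sum_i X i j * X i l.
Definition score X e j := \sum_i X i j * e i 0.

Lemma dot_mul X u v : dot (X *m u) (X *m v) = \sum_j \sum_l gram X j l * (u j 0 * v l 0).
Proof.
rewrite /dot /gram.
under eq_bigr => i _ do rewrite !mxE big_distrlr/=.
rewrite exchange_big/=; apply: eq_bigr => j _.
rewrite exchange_big/=; apply: eq_bigr => l _.
by rewrite mulr_suml; apply: eq_bigr => i _; ring.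
Qed.

Lemma dot_score X e u : dot e (X *m u) = \sum_j score X e j * u j 0.
Proof.
rewrite /dot /score; under eq_bigr => i _ do rewrite mxE mulr_sumr.
rewrite exchange_big/=; apply: eq_bigr => j _.
by rewrite mulr_suml; apply: eq_bigr => i _; ring.
Qed.

Lemma slope_objE X e b0 t u :
  slope_obj X (X *m b0 + e) (fun i : 'I_p => t i) (b0 + u) =
  2^-1 * sqnorm e - \sum_j score X e j * u j 0 + 2^-1 * sqnorm (X *m u) + J t (b0 + u).
Proof.
rewrite /slope_obj -/(J t _) -dot_score mulmxDr.
rewrite (_ : X *m b0 + e - (X *m b0 + X *m u) = e + (-1) *: (X *m u)); last first.
  by rewrite scaleN1r opprD addrACA subrr add0r.
rewrite sqnormD sqnormZ (_ : dot e (-1 *: _) = - dot e (X *m u)); last first.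
  by rewrite /dot -sumrN; apply: eq_bigr => i _; rewrite !mxE; ring.
by congr (_ + _); field.
Qed.

Lemma abs_sum_le (f g : 'I_p -> R) : `|\sum_j f j * g j| <= \sum_j `|f j| * `|g j|.
Proof. by apply: le_trans (ler_norm_sum _ _ _) _; apply: ler_sum => j _; rewrite normrM. Qed.

Lemma J_convex (c : R) u t b0 : 0 <= c <= 1 -> (forall i, 0 <= t i) -> decr t ->
  J t (b0 + c *: u) - J t b0 <= c * (J t (b0 + u) - J t b0).
Proof.
move=> /andP[c0 c1] t0 dt.
have -> : b0 + c *: u = (1 - c) *: b0 + c *: (b0 + u).
  by apply/matrixP => i j; rewrite !mxE; ring.
have := J_triangle ((1 - c) *: b0) (c *: (b0 + u)) t0 dt.
have := J_scale (1 - c) b0 dt; have := J_scale c (b0 + u) dt.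
rewrite (ger0_norm c0) ger0_norm ?subr_ge0//.
lra.
Qed.

(** * Error bound and support inclusion for a given candidate support *)

Section step.
Variables (X : 'M[R]_(n, p)) (e : 'cV[R]_n) (b0 bh : 'cV[R]_p) (t : nat -> R)
  (I : pred 'I_p) (c gam Lam : R).
Let m := #|I|.
Let t' := fun i => t (m + i)%N.
Let z := score X e.
Hypothesis t_ge0 : forall i, 0 <= t i.
Hypothesis t_decr : decr t.
Hypothesis c_gt0 : 0 < c.
Hypothesis Lam_gt0 : 0 < Lam.
Hypothesis gam_ge0 : 0 <= gam.
Hypothesis b0I : restr I b0 = b0.
Hypothesis opt : is_slope_solution X (X *m b0 + e) (fun i : 'I_p => t i) bh.
Hypothesis score_dom : forall b, \sum_j `|z j| * `|b j 0| <= J t b.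
Hypothesis score_off : forall b,
  \sum_j `|z j| * `|restr (predC I) b j 0| <= (1 - 2 * c) * J t' (restr (predC I) b).
Hypothesis gram_off : forall l b, I l ->
  \sum_j `|gram X l j| * `|restr (predC I) b j 0| <= gam * J t' (restr (predC I) b).
Hypothesis isometry : forall b, 2^-1 * sqnorm (restr I b) <= sqnorm (X *m restr I b).
Hypothesis Lam_ge : \sum_(i < m) t i ^+ 2 <= Lam ^+ 2.
Hypothesis l1_small : forall b, sqnorm (restr I b) <= (9 * Lam) ^+ 2 ->
  gam * \sum_j `|restr I b j 0| <= c.

Lemma t'_decr : decr t'. Proof. by move=> i j ij; apply: t_decr; rewrite leq_add2l. Qed.
Lemma t'_ge0 i : 0 <= t' i. Proof. exact: t_ge0. Qed.

Lemma J_sq u : 2 * J t (restr I u) <= 8 * Lam ^+ 2 + 8^-1 * sqnorm (restr I u).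
Proof.
have := J_restr_sq I u t_ge0 t_decr; rewrite -/(sqnorm _) -/m.
have : 8 * (\sum_(i < m) t i ^+ 2) <= 8 * Lam ^+ 2 by rewrite ler_pM2l.
lra.
Qed.

(** Each row indexed by [I] acts on the part off [I] at cost [gam], hence the l1 norm on [I]. Its
    smallness is known only in the ball of radius [9 * Lam], which forces the shrinking in
    [error_bound]. *)
Lemma cross_small u : sqnorm (restr I u) <= (9 * Lam) ^+ 2 ->
  `|dot (X *m restr I u) (X *m restr (predC I) u)| <= c * J t' (restr (predC I) u).
Proof.
move=> hu; set w := restr (predC I) u.
have Jw : 0 <= J t' w by apply: J_ge0; exact: t'_ge0.
apply: (@le_trans _ _ ((gam * \sum_j `|restr I u j 0|) * J t' w)); last first.
  by rewrite ler_wpM2r// l1_small.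
rewrite dot_mul mulrC mulrA mulr_sumr; apply: le_trans (ler_norm_sum _ _ _) _.
apply: ler_sum => j _; rewrite restrE; case: ifPn => Ij; last first.
  by rewrite normr0 mulr0 big1 ?normr0// => l _; rewrite mul0r mulr0.
apply: le_trans (ler_norm_sum _ _ _) _.
rewrite (eq_bigr (fun l => `|u j 0| * (`|gram X j l| * `|w l 0|))); last first.
  by move=> l _; rewrite !normrM; ring.
by rewrite -mulr_sumr [leRHS]mulrC ler_wpM2l// [leRHS]mulrC gram_off.
Qed.

Lemma quad_lower u : sqnorm (restr I u) <= (9 * Lam) ^+ 2 ->
  4^-1 * sqnorm (restr I u) - c * J t' (restr (predC I) u) <= 2^-1 * sqnorm (X *m u).
Proof.
move=> hu; have := cross_small hu; have := isometry u.
rewrite [in sqnorm (X *m u)](restrD I u) mulmxDr sqnormD ler_norml => A /andP[B _].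
have := sqnorm_ge0 (X *m restr (predC I) u).
move: A B; move: (sqnorm _) (sqnorm _) (sqnorm _) (dot _ _) (J _ _) => ? ? ? ? ?.
lra.
Qed.

(** Of the margin [2 * c] off [I], one [c] pays for the cross term and the other is what remains in
    [support_incl]. *)
Lemma score_split u : \sum_j z j * u j 0 <=
  J t (restr I u) + (1 - 2 * c) * J t' (restr (predC I) u).
Proof.
apply: le_trans (ler_norm _) _.
rewrite [in X in `|X|](eq_bigr (fun j => z j * restr I u j 0 + z j * restr (predC I) u j 0)); last first.
  by move=> j _; rewrite -mulrDr {1}(restrD I u) mxE.
rewrite big_split/=; apply: le_trans (ler_normD _ _) _.
apply: lerD; apply: le_trans (abs_sum_le _ _) _; [exact: score_dom|exact: score_off].
Qed.

Lemma restr_off u : restr (predC I) (b0 + u) = restr (predC I) u.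
Proof.
apply/matrixP => i j; rewrite !mxE -[in LHS]b0I mxE /=.
by case: (I i) => //=; rewrite add0r.
Qed.

Lemma penalty_split u : J t b0 - J t (restr I u) + J t' (restr (predC I) u) <= J t (b0 + u).
Proof.
have := J_split I (b0 + u) t_decr; rewrite -/m -/t'.
rewrite restr_off.
have b0E : b0 = restr I (b0 + u) + (-1) *: restr I u.
  rewrite -[LHS]b0I; apply/matrixP => i j; rewrite !mxE.
  by case: (I i); rewrite ?ord1; ring.
have := J_triangle (restr I (b0 + u)) ((-1) *: restr I u) t_ge0 t_decr.
rewrite -b0E; have := J_scale (-1) (restr I u) t_decr; rewrite normrN1 mul1r.
lra.
Qed.

(** Adding up the preceding estimates gives [N / 4 + c * B <= 2 * A], and [J_sq] bounds [2 * A] by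
    [8 * Lam ^+ 2 + N / 8]. The radius obtained, [8 * Lam], is strictly below the assumed
    [9 * Lam]. *)
Lemma restr_bound u : sqnorm (restr I u) <= (9 * Lam) ^+ 2 ->
  2^-1 * sqnorm (X *m u) - \sum_j z j * u j 0 + J t (b0 + u) - J t b0 <= 0 ->
  sqnorm (restr I u) <= (8 * Lam) ^+ 2.
Proof.
move=> hu; have := quad_lower hu; have := score_split u; have := penalty_split u.
have := J_sq u; have : 0 <= J t' (restr (predC I) u) by apply: J_ge0; exact: t'_ge0.
have := c_gt0; rewrite !exprMn.
set N := sqnorm (restr I u); set A := J t (restr I u); set B := J t' _.
move: (sqnorm _) (\sum_j _) (J t (b0 + u)) (J t b0) => q s j1 j0 cp B0 h1 h2 h3 h4 h5.
have cB : 0 <= c * B by rewrite mulr_ge0// ltW.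
lra.
Qed.

Let h := bh - b0.
Let hE : bh = b0 + h. Proof. by rewrite /h addrC subrK. Qed.

Lemma basic_ineq u : 2^-1 * sqnorm (X *m h) - \sum_j z j * h j 0 + J t (b0 + h) <=
  2^-1 * sqnorm (X *m u) - \sum_j z j * u j 0 + J t (b0 + u).
Proof.
have := opt (b0 + u); rewrite hE !slope_objE -/z; lra.
Qed.

Lemma basic_ineq_scaled a : 0 <= a <= 1 ->
  2^-1 * sqnorm (X *m (a *: h)) - \sum_j z j * (a *: h) j 0 + J t (b0 + a *: h) - J t b0 <= 0.
Proof.
move=> /andP[a0 a1]; have := basic_ineq 0.
rewrite mulmx0 addr0 (_ : sqnorm 0 = 0); last by rewrite /sqnorm big1// => i _; rewrite mxE expr0n.
rewrite (_ : \sum_j z j * (0 : 'cV_p) j 0 = 0); last by rewrite big1// => i _; rewrite mxE mulr0.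
rewrite mulr0 subr0 add0r => H.
have a01 : 0 <= a <= 1 by rewrite a0.
have := J_convex h b0 a01 t_ge0 t_decr.
rewrite -scalemxAr sqnormZ (_ : \sum_j z j * (a *: h) j 0 = a * \sum_j z j * h j 0); last first.
  by rewrite mulr_sumr; apply: eq_bigr => j _; rewrite mxE; ring.
have aq : a ^+ 2 * sqnorm (X *m h) <= a * sqnorm (X *m h).
  by rewrite ler_wpM2r ?sqnorm_ge0// expr2 ler_piMr.
have : a * (2^-1 * sqnorm (X *m h) - \sum_j z j * h j 0 + J t (b0 + h) - J t b0) <= 0.
  by rewrite mulr_ge0_le0// subr_le0.
move: aq H; move: (sqnorm _) (\sum_j _) (J t (b0 + h)) (J t b0) (J t _) => *.
lra.
Qed.

Lemma error_bound : sqnorm (restr I h) <= (8 * Lam) ^+ 2.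
Proof.
have [hs|hb] := leP (sqnorm (restr I h)) ((9 * Lam) ^+ 2).
  apply: restr_bound => //; have := @basic_ineq_scaled 1; rewrite scale1r; apply.
  by rewrite ler01 lexx.
(* Otherwise shrink towards b0 until the norm is exactly 9 Lam. *)
set N := sqnorm _ in hb *.
have L0 : 0 < 9 * Lam by rewrite mulr_gt0.
have N0 : 0 < N by apply: le_lt_trans hb; rewrite sqr_ge0.
pose a := 9 * Lam / Num.sqrt N.
have sN : 0 < Num.sqrt N by rewrite sqrtr_gt0.
have a0 : 0 <= a by rewrite divr_ge0 ?ltW.
have a1 : a <= 1.
  rewrite ler_pdivrMr// mul1r -[leLHS](ger0_norm (ltW L0)) -sqrtr_sqr.
  by rewrite ler_wsqrtr// ltW.
have aN : sqnorm (restr I (a *: h)) = (9 * Lam) ^+ 2.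
  have -> : restr I (a *: h) = a *: restr I h.
    by apply/matrixP => i j; rewrite !mxE; case: (I i); rewrite ?mulr0.
  by rewrite sqnormZ /a expr_div_n sqr_sqrtr ?ltW// divfK// gt_eqF.
have := @restr_bound (a *: h); rewrite aN lexx => /(_ isT).
rewrite basic_ineq_scaled ?a0// => /(_ isT).
have : 0 < Lam ^+ 2 by rewrite exprn_gt0.
by rewrite !exprMn; lra.
Qed.

(** Dropping the part off [I] saves at least [B] in penalty, and loses at most [(1 - 2 * c) * B] in
    the score and [c * B] in the cross term. Optimality leaves [c * B <= 0], and [J_eq0] applies
    with first weight [t m]. *)
Lemma support_incl : (m < p)%N -> 0 < t m -> restr (predC I) bh = 0.
Proof.
move=> mp tm.
rewrite hE restr_off.
apply: (J_eq0 t'_ge0 t'_decr); last by rewrite /t' addn0.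
have H81 : sqnorm (restr I h) <= (9 * Lam) ^+ 2.
  by apply: le_trans error_bound _; rewrite !exprMn ler_wpM2r ?sqr_ge0//; lra.
have := cross_small H81; rewrite ler_norml => /andP[B _].
have := basic_ineq (restr I h).
rewrite [in sqnorm (X *m h)](restrD I h) mulmxDr sqnormD.
have := J_split I (b0 + h) t_decr; rewrite -/m -/t'.
rewrite restr_off.
have -> : restr I (b0 + h) = b0 + restr I h.
  by rewrite -[X in _ = X + _]b0I; apply/matrixP => i j; rewrite !mxE; case: (I i); rewrite ?addr0.
have -> : \sum_j z j * h j 0 = \sum_j z j * restr I h j 0 + \sum_j z j * restr (predC I) h j 0.
  rewrite -big_split/=; apply: eq_bigr => j _.
  by rewrite -mulrDr {1}(restrD I h) mxE.
have : \sum_j z j * restr (predC I) h j 0 <= (1 - 2 * c) * J t' (restr (predC I) h).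
  by apply: le_trans (score_off h); apply: le_trans (ler_norm _) (abs_sum_le _ _).
have := sqnorm_ge0 (X *m restr (predC I) h).
have : 0 <= J t' (restr (predC I) h) by apply: J_ge0; exact: t'_ge0.
move: B; set B := J t' _; move: (sqnorm _) (sqnorm _) (\sum_j _) (\sum_j _) (J t _) (J t _) (dot _ _).
move=> x1 x2 x3 x4 x5 x6 x7 H1 H2 H3 H4 H5 H6.
have : c * B <= 0 by lra.
by rewrite pmulr_rle0.
Qed.

End step.

(** Moving coordinate [j] alone by [a] raises the penalty by at most [t 0] times the size of [a], so
    at a minimiser the residual has inner product at most [t 0] with column [j]. *)
Lemma zero_coordinate X e b0 bh t j : decr t -> (forall i, 0 <= t i) ->
  is_slope_solution X (X *m b0 + e) (fun i : 'I_p => t i) bh ->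
  `|\sum_l gram X j l * (bh - b0) l 0| <= t 0 + `|score X e j|.
Proof.
move=> dt t0 opt; set h := bh - b0; set g := \sum_l _.
have key a : a * (score X e j - g) <= 2^-1 * a ^+ 2 * gram X j j + `|a| * t 0.
  pose v : 'cV[R]_p := a *: delta_mx j 0.
  have vE l : v l 0 = if l == j then a else 0.
    by rewrite !mxE eqxx andbT; case: eqP => _; rewrite ?mulr1 ?mulr0.
  have sumv (f : 'I_p -> R) : \sum_l f l * v l 0 = f j * a.
    rewrite (bigD1 j)//= vE eqxx big1 ?addr0// => l lj.
    by rewrite vE (negbTE lj) mulr0.
  have hE : bh = b0 + h by rewrite /h addrC subrK.
  have := opt (b0 + (h + v)); rewrite [in slope_obj _ _ _ bh]hE !slope_objE (mulmxDr X h v) (sqnormD (X *m h)).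
  have -> : dot (X *m h) (X *m v) = a * g.
    rewrite /dot; under eq_bigr do rewrite mulrC.
    rewrite -/(dot _ _) dot_mul /g exchange_big/= mulr_sumr; apply: eq_bigr => l _.
    under eq_bigr do rewrite mulrA mulrAC.
    by rewrite (sumv (fun i => gram X i l * h l 0)); ring.
  have -> : sqnorm (X *m v) = a ^+ 2 * gram X j j.
    rewrite sqnormE dot_mul.
    under eq_bigr => l _ do (under eq_bigr do rewrite mulrA; rewrite (sumv (fun i => gram X l i * v l 0)) mulrAC).
    by rewrite (sumv (fun l => gram X l j * a)); ring.
  have -> : \sum_l score X e l * (h + v) l 0 = \sum_l score X e l * h l 0 + score X e j * a.
    by rewrite -sumv -big_split/=; apply: eq_bigr => l _; rewrite mxE mulrDr.
  have := J_triangle (b0 + h) v t0 dt; rewrite -addrA.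
  have : J t v <= `|a| * t 0.
    apply: le_trans (J_le_l1 v dt) _; rewrite mulrC ler_wpM2r// (bigD1 j)//= vE eqxx.
    by rewrite big1 ?addr0// => l lj; rewrite vE (negbTE lj) normr0.
  lra.
have G0 : 0 <= gram X j j by apply: sumr_ge0 => i _; rewrite -expr2 sqr_ge0.
suff : `|score X e j - g| <= t 0.
  rewrite distrC => H; rewrite -[g](subrK (score X e j)).
  by apply: le_trans (ler_normD _ _) _; rewrite lerD2r.
rewrite leNgt; apply/negP => H.
(* A step this short makes the quadratic cost smaller than the linear gain; the [+ 1] keeps the
   denominator positive even for a zero column. *)
set s := score X e j - g in key H; pose r := (`|s| - t 0) / (gram X j j + 1).
have r0 : 0 < r by rewrite divr_gt0 ?subr_gt0// ltr_wpDl.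
have rE : r * (gram X j j + 1) = `|s| - t 0 by rewrite divfK// gt_eqF// ltr_wpDl.
have : r * `|s| <= r * (2^-1 * r * gram X j j + t 0).
  have := key (Num.sg s * r); rewrite mulrAC -normrEsg normrM (gtr0_norm r0).
  have [->|sn0] := eqVneq s 0.
    rewrite normr0 mul0r mulr0 => _; rewrite mulr_ge0 ?(ltW r0)// addr_ge0// mulr_ge0//.
    by rewrite mulr_ge0// ltW.
  rewrite normr_sg sn0 mul1r exprMn sqr_sg sn0 mul1r; lra.
rewrite ler_pM2l// -lerBlDr -rE => h2.
have : r * gram X j j + r <= 2^-1 * (r * gram X j j) by move: h2; lra.
have : 0 <= r * gram X j j by rewrite mulr_ge0// ltW.
by move: r0; lra.
Qed.

End deterministic.

(** * The good event *)

Section good_event.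
Context {R : realType} (n p : nat).
Variables (X : 'M[R]_(n, p)) (e : 'cV[R]_n) (b0 bh : 'cV[R]_p) (t xi : nat -> R).
Variables (rho lev c gam Lam mu eta0 beta : R).
Let z := score X e.
Let big : pred 'I_p := fun j => lev < `|z j|.
Let I : pred 'I_p := fun j => (b0 j 0 != 0) || big j.
Let m := #|I|.
Hypothesis t_ge0 : forall i, 0 <= t i.
Hypothesis t_decr : decr t.
Hypothesis rho_ge0 : 0 <= rho.
Hypothesis rho_le1 : rho <= 1.
Hypothesis c_gt0 : 0 < c.
Hypothesis c_le : 2 * c <= 1.
Hypothesis gam_ge0 : 0 <= gam.
Hypothesis Lam_gt0 : 0 < Lam.
Hypothesis mu_ge0 : 0 <= mu.
Hypothesis eta0_ge0 : 0 <= eta0.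
Hypothesis eta0_le : eta0 <= 4^-1.
Hypothesis m_lt : (m < p)%N.
Hypothesis tm_gt0 : 0 < t m.
Hypothesis opt : is_slope_solution X (X *m b0 + e) (fun i : 'I_p => t i) bh.
Hypothesis score_count : dominated (fun i => rho * t i) z.
Hypothesis off_level : forall i, (m + i < p)%N ->
  rho * t i <= (1 - 2 * c) * t (m + i)%N \/ lev <= (1 - 2 * c) * t (m + i)%N.
Hypothesis gram_count : forall l (i : 'I_p),
  (#|[pred j : 'I_p | (j != l) && (xi i < `|gram X l j|)%R]| <= i)%N.
Hypothesis xi_le : forall i, (m + i < p)%N -> xi i <= gam * t (m + i)%N.
Hypothesis xi0_le : xi 0 <= mu.
Hypothesis diag : forall l, `|gram X l l - 1| <= eta0.
Hypothesis m_mu : m%:R * mu <= 4^-1.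
Hypothesis Lam_ge : \sum_(i < m) t i ^+ 2 <= Lam ^+ 2.
Hypothesis Lam_gam : m%:R * (gam * (9 * Lam)) ^+ 2 <= c ^+ 2.
Hypothesis signal : forall j, b0 j 0 != 0 -> beta <= `|b0 j 0|.
Hypothesis beta_ge0 : 0 <= beta.
Hypothesis signal_strong : forall nu, 0 <= nu -> nu ^+ 2 <= m%:R * (mu * (8 * Lam)) ^+ 2 ->
  (1 + rho) * t 0 < (1 - eta0) * beta - nu.

Let p_gt0 : (0 < p)%N. Proof. exact: leq_ltn_trans m_lt. Qed.

Lemma J_scale_weights a u (b : 'cV[R]_p) : J (fun i => a * u i) b = a * J u b.
Proof. by rewrite /J /slope_penalty mulr_sumr; apply: eq_bigr => i _; rewrite mulrA. Qed.

(** Cauchy-Schwarz on [I], obtained by summing [(a - |b_j|)^2 >= 0] over [I] and taking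
    [a = L / m]. *)
Lemma l1_sq (b : 'cV[R]_p) : (\sum_j `|restr I b j 0|) ^+ 2 <= m%:R * sqnorm (restr I b).
Proof.
set L := \sum_j _; set N := sqnorm _.
have N0 : 0 <= N by exact: sqnorm_ge0.
have key a : 2 * (a * L) <= m%:R * a ^+ 2 + N.
  rewrite /L /N /sqnorm !mulr_sumr.
  have -> : m%:R * a ^+ 2 = \sum_j (if I j then a ^+ 2 else 0).
    by rewrite -big_mkcond sumr_const mulr_natl.
  rewrite -big_split/=; apply: ler_sum => j _; rewrite restrE.
  case: ifP => _; last by rewrite normr0 !mulr0 expr0n addr0.
  rewrite -[in leRHS](real_normK (num_real (b j 0))) -subr_ge0.
  rewrite (_ : _ - _ = (a - `|b j 0|) ^+ 2) ?sqr_ge0//; ring.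
have [m0|m0] := posnP m.
  rewrite m0 mul0r /L big1 ?expr0n// => j _; rewrite restrE; case: ifPn => [Ij|_]; last exact: normr0.
  by have : j \in I by []; rewrite (card0_eq m0).
have m0R : 0 < m%:R :> R by rewrite ltr0n.
have := key (L / m%:R).
have -> : m%:R * (L / m%:R) ^+ 2 = L ^+ 2 / m%:R by field; rewrite gt_eqF.
have -> : 2 * (L / m%:R * L) = 2 * (L ^+ 2 / m%:R) by field; rewrite gt_eqF.
move=> h; have : L ^+ 2 / m%:R <= N by move: h; move: (_ / _) => x; lra.
by rewrite ler_pdivrMr// mulrC.
Qed.

Lemma off_diag l j : j != l -> `|gram X l j| <= mu.
Proof.
move=> jl; apply: le_trans xi0_le; rewrite leNgt; apply/negP => h.
have := gram_count l (Ordinal p_gt0); rewrite leqn0 => /eqP/card0_eq/(_ j).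
by rewrite !inE jl h.
Qed.

(** An entrywise argument: the diagonal is at least 3/4, and the off-diagonal part is at most [mu]
    times the squared l1 norm, hence [m * mu <= 1/4] times [N]. The regime k^2 log p / n -> 0 is
    strong enough for this, so no singular value estimate enters. *)
Lemma gram_isometry (b : 'cV[R]_p) : 2^-1 * sqnorm (restr I b) <= sqnorm (X *m restr I b).
Proof.
set u := restr I b; set N := sqnorm u.
have N0 : 0 <= N by exact: sqnorm_ge0.
have hL := l1_sq b; rewrite -/u -/N in hL.
have -> : sqnorm (X *m u) = \sum_j gram X j j * u j 0 ^+ 2 +
    \sum_j \sum_(l | l != j) gram X j l * (u j 0 * u l 0).
  rewrite sqnormE dot_mul -big_split/=; apply: eq_bigr => j _.
  by rewrite (bigD1 j)//= expr2.
have h1 : (1 - eta0) * N <= \sum_j gram X j j * u j 0 ^+ 2.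
  rewrite mulr_sumr; apply: ler_sum => j _; rewrite ler_wpM2r ?sqr_ge0//.
  by have := diag j; rewrite ler_norml => /andP[h _]; move: h; lra.
have h2 : - (mu * (\sum_j `|u j 0|) ^+ 2) <= \sum_j \sum_(l | l != j) gram X j l * (u j 0 * u l 0).
  rewrite lerNl; apply: le_trans (ler_norm _) _; rewrite normrN.
  apply: le_trans (ler_norm_sum _ _ _) _.
  rewrite expr2 mulrA [mu * _]mulr_sumr mulr_suml; apply: ler_sum => j _.
  apply: le_trans (ler_norm_sum _ _ _) _.
  apply: (@le_trans _ _ (\sum_(l | l != j) mu * `|u j 0| * `|u l 0|)).
    apply: ler_sum => l lj; rewrite !normrM mulrA ler_wpM2r// ler_wpM2r//.
    exact: off_diag.
  rewrite mulr_sumr [leRHS](bigID (fun l => l != j))/= lerDl.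
  by apply: sumr_ge0 => l _; rewrite !mulr_ge0.
have h3 : mu * (\sum_j `|u j 0|) ^+ 2 <= 4^-1 * N.
  apply: le_trans (ler_wpM2l mu_ge0 hL) _.
  by rewrite mulrA (mulrC mu) ler_wpM2r.
have h4 : eta0 * N <= 4^-1 * N by rewrite ler_wpM2r.
move: h1 h2 h3 h4; lra.
Qed.

Let off (f : 'I_p -> R) j := if I j then 0 else f j.

Lemma off_sum (f : 'I_p -> R) (b : 'cV[R]_p) :
  \sum_j `|f j| * `|restr (predC I) b j 0| = \sum_j `|off f j| * `|restr (predC I) b j 0|.
Proof.
apply: eq_bigr => j _; rewrite /off restrE /=.
by case: (I j) => //=; rewrite normr0 !mulr0.
Qed.

(** Only [p - m] coordinates lie off [I], so ranks with [p <= m + i] are harmless even though the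
    shifted weights are not controlled there. *)
Lemma off_count (f : 'I_p -> R) (i : 'I_p) a : 0 <= a -> (p <= m + i)%N ->
  (#|[pred j : 'I_p | (a < `|off f j|)%R]| <= i)%N.
Proof.
move=> a0 pm; apply: (@leq_trans #|predC I|).
  apply: subset_leq_card; apply/fintype.subsetP => j; rewrite !inE /off.
  by case: (I j) => //; rewrite normr0 ltNge a0.
by have := cardC I; rewrite card_ord -/m => h; rewrite -(leq_add2l m) h.
Qed.

Let t'_decr a : 0 <= a -> decr (fun i => a * t (m + i)%N).
Proof. by move=> a0 i j ij; rewrite ler_wpM2l// t_decr// leq_add2l. Qed.

Lemma score_total (b : 'cV[R]_p) : \sum_j `|z j| * `|b j 0| <= J t b.
Proof.
have rt : decr (fun i => rho * t i) by move=> i j ij; rewrite ler_wpM2l// t_decr.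
apply: le_trans (dominated_sum b rt score_count) _.
apply: J_mono => // i; exact: ler_piMl.
Qed.

(** Off [I] the score of rank [i] has two bounds, [rho * t i] and [lev]. At the lowest ranks the
    first is too large for the shifted weight and the second takes over. *)
Lemma score_outside (b : 'cV[R]_p) : \sum_j `|z j| * `|restr (predC I) b j 0| <=
  (1 - 2 * c) * J (fun i => t (m + i)%N) (restr (predC I) b).
Proof.
have c0 : 0 <= 1 - 2 * c by rewrite subr_ge0.
rewrite off_sum -J_scale_weights; apply: dominated_sum; first exact: t'_decr.
move=> i; have [mi|mi] := ltnP (m + i) p; last by apply: off_count => //; exact: mulr_ge0.
have [h|h] := off_level mi.
  apply: leq_trans (score_count i); apply: subset_leq_card; apply/fintype.subsetP => j.
  rewrite !inE /off; case: (I j) => [|/(le_lt_trans h)//].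
  by rewrite normr0 ltNge mulr_ge0.
rewrite eq_card0// => j; rewrite !inE /off; apply/negbTE.
case Ij: (I j); first by rewrite normr0 -leNgt mulr_ge0.
rewrite -leNgt; apply: le_trans h; rewrite leNgt.
by move: Ij; rewrite /I => /norP[_]; rewrite /big.
Qed.

Lemma gram_outside l (b : 'cV[R]_p) : I l -> \sum_j `|gram X l j| * `|restr (predC I) b j 0| <=
  gam * J (fun i => t (m + i)%N) (restr (predC I) b).
Proof.
move=> Il; rewrite off_sum -J_scale_weights; apply: dominated_sum; first exact: t'_decr.
move=> i; have [mi|mi] := ltnP (m + i) p; last by apply: off_count => //; exact: mulr_ge0.
apply: leq_trans (gram_count l i); apply: subset_leq_card; apply/fintype.subsetP => j.
rewrite !inE /off; case Ij: (I j); first by rewrite normr0 ltNge mulr_ge0.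
(* The row index lies in [I] and [j] does not, so only off-diagonal entries are met. *)
move=> h; apply/andP; split; first by apply: contraFN Ij => /eqP ->.
exact: le_lt_trans (xi_le mi) h.
Qed.

Lemma l1_bound (b : 'cV[R]_p) : sqnorm (restr I b) <= (9 * Lam) ^+ 2 ->
  gam * \sum_j `|restr I b j 0| <= c.
Proof.
move=> hN; rewrite -(@ler_pXn2r _ 2)// ?nnegrE ?(ltW c_gt0) ?mulr_ge0 ?sumr_ge0//.
apply: le_trans Lam_gam; rewrite !exprMn.
apply: le_trans (ler_wpM2l (sqr_ge0 gam) (l1_sq b)) _.
rewrite [leLHS]mulrCA; apply: ler_wpM2l => //; apply: ler_wpM2l; first exact: sqr_ge0.
by rewrite -exprMn.
Qed.

Lemma b0_restr : restr I b0 = b0.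
Proof.
apply/matrixP => i j; rewrite ord1 mxE; case: ifPn => //.
by rewrite /I => /norP[/negPn/eqP -> _].
Qed.

Lemma error_small : sqnorm (restr I (bh - b0)) <= (8 * Lam) ^+ 2.
Proof.
exact: (error_bound t_ge0 t_decr c_gt0 Lam_gt0 b0_restr opt score_total score_outside
  gram_outside gram_isometry Lam_ge l1_bound).
Qed.

Lemma support_small j : bh j 0 != 0 -> I j.
Proof.
have := support_incl t_ge0 t_decr c_gt0 Lam_gt0 b0_restr opt score_total score_outside
  gram_outside gram_isometry Lam_ge l1_bound m_lt tm_gt0.
move=> /matrixP/(_ j 0); rewrite !mxE /=; case: (I j) => //= ->.
by rewrite eqxx.
Qed.

Lemma support_full j : b0 j 0 != 0 -> bh j 0 != 0.
Proof.
move=> bj; apply/negP => /eqP bhj.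
have := zero_coordinate j t_decr t_ge0 opt; rewrite -/z.
set h := bh - b0 => hz.
(* Both [bh] and [b0] vanish off [I], so the bound of [error_small] covers the whole error. *)
have hI : restr I h = h.
  apply/matrixP => i l; rewrite ord1 mxE; case: ifPn => // Ii.
  have /eqP : bh i 0 == 0 by apply: contraNT Ii; exact: support_small.
  have : b0 i 0 == 0 by move: Ii; rewrite /I => /norP[/negPn].
  by rewrite /h !mxE => /eqP -> ->; rewrite subrr.
have z1 : `|z j| <= rho * t 0.
  rewrite leNgt; apply/negP => hj.
  by have := score_count (Ordinal p_gt0); rewrite leqn0 => /eqP/card0_eq/(_ j); rewrite !inE hj.
(* [nu] bounds the interference of the other coordinates with column [j], where a missed signal
   contributes its full size. *)
pose nu := mu * \sum_l `|h l 0|.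
have nu0 : 0 <= nu by rewrite mulr_ge0 ?sumr_ge0.
have nu2 : nu ^+ 2 <= m%:R * (mu * (8 * Lam)) ^+ 2.
  have := l1_sq h; rewrite hI => hL; rewrite /nu !exprMn.
  apply: le_trans (ler_wpM2l (sqr_ge0 mu) hL) _.
  rewrite [leLHS]mulrCA; apply: ler_wpM2l => //; apply: ler_wpM2l; first exact: sqr_ge0.
  rewrite -exprMn.
  by rewrite -hI; exact: error_small.
have := signal_strong nu0 nu2; rewrite ltNge => /negP; apply.
apply: (@le_trans _ _ (t 0 + `|z j|)); last by rewrite mulrDl mul1r lerD2l.
apply: le_trans hz; rewrite (bigD1 j)//=.
have hj : `|h j 0| = `|b0 j 0| by rewrite /h !mxE bhj sub0r normrN.
have g1 : 1 - eta0 <= gram X j j by have := diag j; rewrite ler_norml => /andP[]; lra.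
have eta1 : 0 <= 1 - eta0 by move: eta0_le; lra.
have h1 : (1 - eta0) * beta <= `|gram X j j * h j 0|.
  rewrite normrM hj; apply: ler_pM => //; last exact: signal.
  by apply: le_trans g1 (ler_norm _).
have h2 : `|\sum_(i | i != j) gram X j i * h i 0| <= nu.
  apply: le_trans (ler_norm_sum _ _ _) _; rewrite /nu mulr_sumr [leRHS](bigID (fun i => i != j))/=.
  rewrite -[leLHS]addr0; apply: lerD; last by apply: sumr_ge0 => i _; rewrite mulr_ge0.
  by apply: ler_sum => i ij; rewrite normrM ler_wpM2r// off_diag.
apply: (@le_trans _ _ (`|gram X j j * h j 0| - `|\sum_(i | i != j) gram X j i * h i 0|)).
  exact: lerB.
exact: lerB_normD.
Qed.

Lemma discoveries_good :
  (nfalse_disc b0 bh <= #|big|)%N /\ ntrue_disc b0 bh = nsupp b0.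
Proof.
split.
  apply: subset_leq_card; apply/fintype.subsetP => j; rewrite !inE => /andP[/eqP bj hj].
  by have := support_small hj; rewrite /I bj eqxx.
apply: eq_card => j; apply/idP/idP => /set_mem /= h; apply: mem_set => /=.
  by case/andP: h.
by rewrite h; exact: support_full.
Qed.

End good_event.

(** * Size of the tuning sequence *)

(* With k signals and m <= 2k columns in the support, rank m + i is comparable to
   max(i, k). *)
Section ranks.
Variables k m i : nat.
Hypothesis k_gt0 : (0 < k)%N.
Hypothesis km : (k <= m)%N.
Hypothesis m2k : (m <= 2 * k)%N.
Let i' := maxn i k.-1.

Lemma rank_ratio : ((m + i).+1 <= 3 * i'.+1)%N. Proof. rewrite /i'; lia. Qed.
Lemma rank_diff : ((m + i).+1 <= 2 * k + i'.+1)%N. Proof. rewrite /i'; lia. Qed.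
Lemma rank_k : (k <= i'.+1)%N. Proof. rewrite /i'; lia. Qed.
Lemma rank_le : (i' <= m + i)%N. Proof. rewrite /i'; lia. Qed.

End ranks.

Section log_weights.
Context {R : realType}.
Variable p : nat.
Implicit Types i j k m : nat.

(** Up to constants this is the square of the normal quantile of rank [i], see [xq_sq_ub] and
    [xq_sq_lb]; the added 1 gives [ell_ge1]. *)
Definition ell i : R := 1 + ln (2 * p%:R / i.+1%:R).

Let pR i : (i < p)%N -> 0 < p%:R :> R.
Proof. by move=> ip; rewrite ltr0n (leq_ltn_trans _ ip). Qed.

Lemma ell_decr i j : (i <= j)%N -> (j < p)%N -> ell j <= ell i.
Proof.
move=> ij jp; have p0 := pR jp; rewrite lerD2l ler_ln ?posrE ?divr_gt0 ?mulr_gt0 ?ltr0Sn//.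
by rewrite ler_pM2l ?mulr_gt0// lef_pV2 ?posrE ?ltr0Sn// ler_nat.
Qed.

Lemma ell_ge1 i : (i < p)%N -> 1 <= ell i.
Proof.
move=> ip; rewrite lerDl ln_ge0// ler_pdivlMr ?ltr0Sn// mul1r -natrM ler_nat; lia.
Qed.

Lemma ell_add i j : (i <= j)%N -> (j < p)%N -> ell i = ell j + ln (j.+1%:R / i.+1%:R).
Proof.
move=> ij jp; have p0 := pR jp; rewrite /ell -addrA -lnM ?posrE ?divr_gt0 ?mulr_gt0 ?ltr0Sn//.
by rewrite mulrA divfK ?pnatr_eq0.
Qed.

Lemma ln_le_sub1 (y : R) : 0 < y -> ln y <= y - 1.
Proof.
move=> y0; have := @le_ln1Dx R (y - 1).
by rewrite (_ : 1 + (y - 1) = y); [apply; move: y0; lra|ring].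
Qed.

(** The excess over [m] copies of the last term is [ln (m^m / m!)], which is at most [m]. Hence the
    [m] largest squared weights add up to order m log (p / m), not m log p. *)
Lemma sum_ell m : (0 < m)%N -> (m <= p)%N -> \sum_(i < m) ell i <= 2 * m%:R * ell m.-1.
Proof.
move=> m0 mp; have m1p : (m.-1 < p)%N by lia.
have key N : \sum_(i < N) ln (N%:R / i.+1%:R) <= N%:R :> R.
  elim: N => [|N IH]; first by rewrite big_ord0.
  rewrite big_ord_recr/= divff ?pnatr_eq0// ln1 addr0.
  have [->|N0] := posnP N; first by rewrite big_ord0.
  have E (i : 'I_N) : ln (N.+1%:R / i.+1%:R) = ln (N.+1%:R / N%:R) + ln (N%:R / i.+1%:R) :> R.
    rewrite -lnM ?posrE ?divr_gt0 ?ltr0n//; congr ln.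
    by rewrite mulrA divfK// pnatr_eq0 -lt0n.
  have N0R : 0 < N%:R :> R by rewrite ltr0n.
  have hN : N%:R * ln (N.+1%:R / N%:R) <= 1 :> R.
    have := @ln_le_sub1 (N.+1%:R / N%:R) (divr_gt0 (ltr0Sn _ _) N0R).
    move/(ler_wpM2l (ltW N0R)) => h; apply: le_trans h _.
    by rewrite mulrBr mulrCA divff ?gt_eqF// -natr1; lra.
  under eq_bigr do rewrite E.
  rewrite big_split/= sumr_const card_ord -[ln _ *+ N]mulr_natl -[in leRHS]natr1 addrC.
  exact: lerD.
have E (i : 'I_m) : ell i = ell m.-1 + ln (m%:R / i.+1%:R).
  rewrite (@ell_add i m.-1) ?prednK//; have := ltn_ord i; lia.
under eq_bigr do rewrite E.
rewrite big_split/= sumr_const card_ord -[ell _ *+ m]mulr_natl.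
have h1 : m%:R <= m%:R * ell m.-1 by rewrite -[leLHS]mulr1 ler_wpM2l// ell_ge1.
by have := key m; move: h1; rewrite -mulrA; lra.
Qed.

Section rank_weights.
Variables k m i : nat.
Hypothesis k_gt0 : (0 < k)%N.
Hypothesis km : (k <= m)%N.
Hypothesis m2k : (m <= 2 * k)%N.
Hypothesis mi : (m + i < p)%N.

Let i' := maxn i k.-1.

Lemma ell_rank : ell i' <= 3 * ell (m + i).
Proof.
rewrite (ell_add (rank_le i k_gt0 km m2k) mi); have := ell_ge1 mi.
have h3 : (m + i).+1%:R / i'.+1%:R <= 3 :> R.
  by rewrite ler_pdivrMr ?ltr0Sn// -natrM ler_nat (rank_ratio i k_gt0 km m2k).
have r0 : 0 < (m + i).+1%:R / i'.+1%:R :> R by rewrite divr_gt0 ?ltr0Sn.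
move: h3 (ln_le_sub1 r0); move: (ell (m + i)) => a.
by move: ((m + i).+1%:R / i'.+1%:R) => y; move: (ln y) => l; lra.
Qed.

(** With [ell_div], this treats the two terms under the root in [gram_level]. The larger of [i] and
    [k.-1] is comparable to [m + i]; at the smaller one [ell] is at most [ell 0]. *)
Lemma ell_prod : ell i * ell k.-1 <= 3 * ell (m + i) * ell 0.
Proof.
have k1 : (k.-1 < p)%N by lia.
have ip : (i < p)%N by lia.
have e0 : 1 <= ell 0 by apply: ell_ge1; lia.
have [ik|ki] := leqP i k.-1.
  have hE : ell k.-1 <= 3 * ell (m + i) by have := ell_rank; rewrite /i' (maxn_idPr ik).
  rewrite mulrC; apply: ler_pM => //; last by apply: ell_decr.
  - by apply: le_trans (ell_ge1 k1).
  - by apply: le_trans (ell_ge1 ip).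
have hE : ell i <= 3 * ell (m + i) by have := ell_rank; rewrite /i' (maxn_idPl (ltnW ki)).
apply: ler_pM => //; last by apply: ell_decr.
- by apply: le_trans (ell_ge1 ip).
- by apply: le_trans (ell_ge1 k1).
Qed.

Lemma ell_div : ell k.-1 / i.+1%:R <= 6 * ell (m + i).
Proof.
have k1 : (k.-1 < p)%N by lia.
have ip : (i < p)%N by lia.
have e1 := ell_ge1 mi.
rewrite ler_pdivrMr ?ltr0Sn//.
have i1 : 1 <= i.+1%:R :> R by rewrite ler1n.
have [ik|ki] := leqP i k.-1.
  have hE : ell k.-1 <= 3 * ell (m + i) by have := ell_rank; rewrite /i' (maxn_idPr ik).
  apply: le_trans hE _; rewrite -[leLHS]mulr1; apply: ler_pM => //; first lra.
  by lra.
have hE : ell i <= 3 * ell (m + i) by have := ell_rank; rewrite /i' (maxn_idPl (ltnW ki)).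
rewrite (ell_add (ltnW ki) ip).
have k0R : 0 < k.-1.+1%:R :> R by rewrite ltr0Sn.
have r0 : 0 < i.+1%:R / k.-1.+1%:R :> R by rewrite divr_gt0 ?ltr0Sn.
have h1 : ln (i.+1%:R / k.-1.+1%:R) <= i.+1%:R :> R.
  apply: le_trans (ln_le_sub1 r0) _; apply: (@le_trans _ _ (i.+1%:R / k.-1.+1%:R)); first by rewrite gerBl ler01.
  by rewrite ler_pdivrMr// ler_peMr// ler1n.
have h2 : ell (m + i) <= ell (m + i) * i.+1%:R by rewrite ler_peMr//; lra.
have h3 : i.+1%:R <= ell (m + i) * i.+1%:R by rewrite ler_peMl//; lra.
move: e1 hE h1 h2 h3; move: (ln (i.+1%:R / k.-1.+1%:R)) => L.
by rewrite -mulrA; move: (i.+1%:R : R) => N; move: (ell (m + i)) (ell i) => a b; lra.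
Qed.

End rank_weights.
End log_weights.

Section weights.
Context {R : realType} (q : R).
Hypothesis q01 : 0 < q < 1.
Variable p : nat.
Implicit Types i j k m : nat.

Definition level i : R := q * i.+1%:R / (2 * p%:R).
Definition xq i : R := qt (level i).
Let q0 : 0 < q. Proof. by case/andP: q01. Qed.
Let q1 : q < 1. Proof. by case/andP: q01. Qed.

Let pR i : (i < p)%N -> 0 < p%:R :> R.
Proof. by move=> ip; rewrite ltr0n (leq_ltn_trans _ ip). Qed.

Lemma level_gt0 i : (i < p)%N -> 0 < level i.
Proof. by move=> ip; have p0 := pR ip; rewrite divr_gt0 ?mulr_gt0 ?ltr0Sn. Qed.

Lemma level_inv i : (i < p)%N -> (level i)^-1 = 2 * p%:R / i.+1%:R / q.
Proof.
move=> ip; have p0 := pR ip; have i0 : 0 < i.+1%:R :> R by rewrite ltr0Sn.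
rewrite /level; move: (i.+1%:R) (p%:R) i0 p0 => a b a0 b0; field.
by rewrite !gt_eqF.
Qed.

Lemma level_le i : (i < p)%N -> level i <= q / 2.
Proof.
move=> ip; have p0 := pR ip; rewrite /level ler_pdivrMr ?mulr_gt0//.
rewrite -mulrA ler_wpM2l ?(ltW q0)// mulrA mulVf ?mul1r ?ler_nat//.
Qed.

Lemma level_lt i : (i < p)%N -> level i < 2^-1.
Proof. by move=> ip; apply: le_lt_trans (level_le ip) _; move: q1; lra. Qed.

Lemma xq_gt0 i : (i < p)%N -> 0 < xq i.
Proof. by move=> ip; apply: qt_gt0; [exact: level_gt0|exact: level_lt]. Qed.

Lemma xq_decr i j : (i <= j)%N -> (j < p)%N -> xq j <= xq i.
Proof.
move=> ij jp; have ip := leq_ltn_trans ij jp.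
apply: qt_decr; [exact: level_gt0| |exact: level_lt].
by rewrite ler_pM2r ?invr_gt0 ?mulr_gt0 ?(pR ip)// ler_pM2l// ler_nat.
Qed.

Definition C1 : R := 2 * (1 - ln q).

Lemma C1_ge2 : 2 <= C1.
Proof. by rewrite /C1; have := ln_le0 (ltW q1); lra. Qed.

Lemma xq_sq_ub0 i : (i < p)%N -> xq i ^+ 2 <= 2 * (ell p i - 1 - ln q).
Proof.
move=> ip; have p0 := pR ip.
apply: le_trans (qt_sq_ub (level_gt0 ip) (level_lt ip)) _.
rewrite ler_pM2l// /ell (addrC 1) addrK -ln_div ?posrE ?divr_gt0 ?mulr_gt0 ?ltr0Sn//.
rewrite -lnV ?posrE ?level_gt0//.
rewrite level_inv//; exact: lexx.
Qed.

Lemma xq_sq_ub i : (i < p)%N -> xq i ^+ 2 <= C1 * ell p i.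
Proof.
move=> ip; apply: le_trans (xq_sq_ub0 ip) _.
have h1 := @ell_ge1 R p _ ip; have h2 := ln_le0 (ltW q1).
have : 0 <= - ln q * (ell p i - 1) by rewrite mulr_ge0 ?oppr_ge0 ?subr_ge0.
by rewrite /C1; lra.
Qed.

(** [x0] is [qt_lower] at the largest level [q / 2]. In [c1] it covers the ranks with
    [ell < 2 * D1]; for larger [ell], subtracting [D1] costs at most half. *)
Definition x0 : R := (1 - q) / 4.
Definition D1 : R := 1 + `|ln (@tail_const R / q)|.
Definition c1 : R := x0 ^+ 2 / (2 * D1).

Let x0_gt0 : 0 < x0. Proof. by rewrite divr_gt0// subr_gt0. Qed.
Let D1_ge1 : 1 <= D1. Proof. by rewrite lerDl. Qed.

Lemma c1_gt0 : 0 < c1.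
Proof. by apply: divr_gt0; [exact: exprn_gt0|apply: mulr_gt0 => //; exact: lt_le_trans D1_ge1]. Qed.

Lemma xq_ge i : (i < p)%N -> x0 <= xq i.
Proof.
move=> ip; apply: le_trans (qt_lower (level_gt0 ip) (level_lt ip)).
by have := level_le ip; rewrite /x0; lra.
Qed.

Lemma xq_sq_lb i : (i < p)%N -> c1 * ell p i <= xq i ^+ 2.
Proof.
move=> ip; have p0 := pR ip.
have l1 := @ell_ge1 R p _ ip.
have D0 : 0 < D1 by exact: lt_le_trans ltr01 D1_ge1.
have h : ell p i - D1 <= xq i ^+ 2.
  apply: le_trans (qt_sq_lb (level_gt0 ip) (level_lt ip)).
  have -> : @tail_const R / level i = 2 * p%:R / i.+1%:R * (@tail_const R / q).
    by rewrite level_inv//; ring.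
  rewrite lnM ?posrE; last first.
  - by apply: divr_gt0 => //; exact: tail_const_gt0.
  - by rewrite divr_gt0 ?mulr_gt0 ?ltr0Sn.
  rewrite /ell /D1; have := ler_norm (- ln (@tail_const R / q)); rewrite normrN; lra.
have x02 : x0 ^+ 2 <= xq i ^+ 2.
  by rewrite ler_sqr ?nnegrE ?(ltW x0_gt0) ?(ltW (xq_gt0 ip))// xq_ge.
have [hl|hl] := leP (2 * D1) (ell p i); last first.
  apply: le_trans x02; rewrite /c1 mulrAC ler_pdivrMr ?mulr_gt0// ler_wpM2l ?sqr_ge0//.
  exact: ltW.
have c12 : c1 <= 2^-1.
  rewrite /c1 ler_pdivrMr ?mulr_gt0// mulrA mulVf// mul1r.
  apply: le_trans D1_ge1; rewrite -[leRHS](expr1n _ 2) ler_sqr ?nnegrE ?(ltW x0_gt0)//.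
  by rewrite /x0; move: q0; lra.
apply: le_trans h; apply: (@le_trans _ _ (2^-1 * ell p i)); last by move: hl; lra.
by rewrite ler_wpM2r// (le_trans _ l1).
Qed.

Lemma xq_log i j : (i <= j)%N -> (j < p)%N ->
  xq i <= xq j + ln (j.+1%:R / i.+1%:R) / xq j.
Proof.
move=> ij jp; have ip := leq_ltn_trans ij jp.
have := qt_log (level_gt0 ip) (_ : level i <= level j) (level_lt jp).
have -> : level j / level i = j.+1%:R / i.+1%:R.
  have p0 := pR ip; have i0 : 0 < i.+1%:R :> R by rewrite ltr0Sn.
  rewrite level_inv// /level; move: (i.+1%:R) (p%:R) i0 p0 => a b a0 b0; field.
  by rewrite !gt_eqF.
apply; rewrite ler_pM2r ?invr_gt0 ?mulr_gt0 ?(pR ip)// ler_pM2l// ler_nat//.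
Qed.

Section rank_weights.
Variables k m i : nat.
Hypothesis k_gt0 : (0 < k)%N.
Hypothesis km : (k <= m)%N.
Hypothesis m2k : (m <= 2 * k)%N.
Hypothesis mi : (m + i < p)%N.

Let i' := maxn i k.-1.

(** With [A = 2 / (c1 * iota)], ranks where [ell < A] exceed a multiple [expR (- A)] of [p]; the
    bound makes [k] small compared with such ranks. *)
Definition frac_bound iota : R := iota * c1 * expR (- (2 / (c1 * iota))) / 3.

(** The logarithm of the rank ratio is at most [2 * k / N]. If [ell] is large, the trivial value 2
    is already a small part of the squared quantile; otherwise the rank is of order [p], and [k / N]
    itself is small. *)
Lemma xq_rank iota : 0 < iota -> k%:R / p%:R <= frac_bound iota ->
  xq i' <= (1 + iota) * xq (m + i).
Proof.
move=> io0 kp; have p0 := pR mi; have c10 := c1_gt0.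
have x0' := xq_gt0 mi; have e1 := @ell_ge1 R p _ mi.
apply: le_trans (xq_log (rank_le i k_gt0 km m2k) mi) _; rewrite mulrDl mul1r lerD2l.
set M := (m + i).+1%:R : R; set N := i'.+1%:R : R.
have M0 : 0 < M by rewrite ltr0Sn. have N0 : 0 < N by rewrite ltr0Sn.
have r0 : 0 < M / N by rewrite divr_gt0.
have MN : M <= 3 * N by rewrite /M /N -natrM ler_nat (rank_ratio i k_gt0 km m2k).
have MkN : M - N <= 2 * k%:R.
  by rewrite /M /N lerBlDr -natrM -natrD ler_nat (rank_diff i k_gt0 km m2k).
have kN : k%:R <= N by rewrite /N ler_nat (rank_k i k_gt0 km m2k).
have hln : ln (M / N) <= 2 * k%:R / N.
  apply: le_trans (ln_le_sub1 r0) _; rewrite -[X in _ - X](divff (lt0r_neq0 N0)) -mulrBl.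
  by rewrite ler_pM2r ?invr_gt0.
rewrite ler_pdivrMr// -mulrA -expr2.
apply: le_trans hln _.
apply: (@le_trans _ _ (iota * (c1 * ell p (m + i)))); last by rewrite ler_wpM2l ?(ltW io0)// xq_sq_lb.
set A := 2 / (c1 * iota).
have [hA|hA] := leP A (ell p (m + i)).
  apply: (@le_trans _ _ 2); first by rewrite ler_pdivrMr// ler_pM2l.
  have -> : 2 = iota * (c1 * A) by rewrite /A; field; rewrite !gt_eqF.
  by rewrite ler_pM2l// ler_pM2l.
apply: (@le_trans _ _ (iota * c1)); last by rewrite [leRHS]mulrA; apply: ler_peMr => //; rewrite mulr_ge0 ?ltW.
rewrite ler_pdivrMr//.
have hM : 2 * p%:R <= M * expR A.
  rewrite [leRHS]mulrC -ler_pdivrMr//.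
  have y0 : 2 * p%:R / M \is Num.pos by rewrite posrE divr_gt0 ?mulr_gt0.
  by rewrite -(lnK y0) ler_expR; move: hA; rewrite /ell -/M; lra.
have kpA : k%:R * (3 * expR A) <= iota * c1 * p%:R.
  move: kp; rewrite /frac_bound expRN -/A ler_pdivrMr// => h.
  have e0 := expR_gt0 A.
  have := ler_wpM2r (_ : 0 <= 3 * expR A) h; rewrite mulr_ge0 ?(ltW e0)// => /(_ isT) h'.
  apply: le_trans h' _; rewrite le_eqVlt; apply/orP; left; apply/eqP; field.
  by rewrite gt_eqF.
have h1 : M * expR A <= 3 * N * expR A by rewrite ler_wpM2r ?expR_ge0.
have ic0 : 0 <= iota * c1 by rewrite mulr_ge0 ?ltW.
have e0 := expR_gt0 A.
rewrite -(@ler_pM2r _ (3 * expR A)) ?mulr_gt0//.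
have h2 : iota * c1 * (2 * p%:R) <= iota * c1 * (3 * N * expR A).
  by rewrite ler_wpM2l// (le_trans hM).
by move: kpA h2; move: (iota * c1) (expR A) => y E; lra.
Qed.

End rank_weights.

End weights.

Lemma rank_bounds k m p : (0 < k)%N -> (k <= m)%N -> (m <= 2 * k)%N -> (2 * k < p)%N ->
  [/\ (0 < p)%N, (k.-1 < p)%N, (m < p)%N, (0 < m)%N & (m.-1 < p)%N /\ (k.-1 <= m.-1)%N].
Proof. by move=> *; split; try split; lia. Qed.

(** * Constants, and the numerical conditions for the good event *)

Section constants.
Context {R : realType} (sigma delta q : R).
Hypothesis sigma_gt0 : 0 < sigma.
Hypothesis delta_gt0 : 0 < delta.
Hypothesis q01 : 0 < q < 1.

Definition lscale : R := sigma * (1 + delta).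
(* Since (1 + kap)^2 < 1 + delta, there is room for rho < 1; when |eps| is at most
   (1 + kap) sigma sqrt n, a score above rho lambda_i requires a standard normal
   above (1 + kap) Phi^-1 (1 - qi / 2p). *)
Definition kap : R := Num.min delta 1 / 6.
Definition rho : R := (1 + kap) ^+ 2 / (1 + delta).
(** With [cst] and [iota0], the inequality [rho * (1 + iota0) <= 1 - 2 * cst] of [off_level] reads
    [0 <= (1 - rho)^2]. With [eta0], the slack left in [signal_strong] is
    [(1 - rho) / 4 + (1 - rho)^2 / 8]. *)
Definition cst : R := (1 - rho) / 4.
Definition iota0 : R := (1 - rho) / 2.
Definition eta0 : R := (1 - rho) / 8.
(** 15 is 9 from [ell_prod] with [ell p 0 <= 3 * L], plus 6 from [ell_div]; 16 is the square of the
    4 in [gram_level]. In [C3], the 4 is the 2 of [sum_ell] times the 2 of [m <= 2 * k]. *)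
Definition C2 : R := 15 * 16 / c1 q.
Definition C3 : R := 4 * C1 q.
(* The three terms serve the hypotheses m_mu, Lam_gam and signal_strong of
   discoveries_good, in this order. *)
Definition size_bound : R :=
  Num.min (Num.min ((64^-1) ^+ 2) (cst ^+ 2 / (2 * 9 ^+ 2 * (C2 * C3))))
    (cst ^+ 2 / (3 * 64 ^+ 2 * C3)).

Lemma lscale_gt0 : 0 < lscale. Proof. by rewrite mulr_gt0// addr_gt0. Qed.

Lemma kap_gt0 : 0 < kap. Proof. by rewrite divr_gt0// lt_min delta_gt0 ltr01. Qed.

Lemma kap_le : kap <= 6^-1.
Proof. by rewrite ler_pdivrMr// mulVf// ge_min lexx orbT. Qed.

Lemma rho_gt0 : 0 < rho.
Proof. by rewrite divr_gt0 ?exprn_gt0 ?addr_gt0 ?kap_gt0. Qed.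

Lemma rho_lt1 : rho < 1.
Proof.
rewrite ltr_pdivrMr ?addr_gt0// mul1r.
have k0 := kap_gt0; have k1 := kap_le.
have kd : 6 * kap <= delta by rewrite /kap mulrC divfK// ge_min lexx.
have : kap ^+ 2 <= kap * 6^-1 by rewrite expr2 ler_wpM2l// ltW.
by move: k0 k1 kd; lra.
Qed.

Lemma cst_gt0 : 0 < cst. Proof. by have := rho_lt1; rewrite /cst; lra. Qed.
Lemma cst_le : 2 * cst <= 1. Proof. by have := rho_gt0; rewrite /cst; lra. Qed.
Lemma iota0_gt0 : 0 < iota0. Proof. by have := rho_lt1; rewrite /iota0; lra. Qed.
Lemma eta0_gt0 : 0 < eta0. Proof. by have := rho_lt1; rewrite /eta0; lra. Qed.
Lemma eta0_le4 : eta0 <= 4^-1. Proof. by have := rho_gt0; rewrite /eta0; lra. Qed.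
Lemma C2_gt0 : 0 < C2. Proof. by apply: divr_gt0; [exact: mulr_gt0|exact: c1_gt0 q01]. Qed.
Lemma C3_gt0 : 0 < C3. Proof. by have := C1_ge2 q01; rewrite /C3; lra. Qed.

Lemma size_bound_gt0 : 0 < size_bound.
Proof.
have a := cst_gt0; have b := C2_gt0; have c := C3_gt0.
have h y : 0 < y -> 0 < cst ^+ 2 / y by move=> y0; apply: divr_gt0 => //; exact: exprn_gt0.
rewrite /size_bound !lt_min; apply/andP; split; last first.
  by apply: h; apply: mulr_gt0 => //; apply: mulr_gt0 => //; exact: exprn_gt0.
apply/andP; split; first by apply: exprn_gt0; rewrite invr_gt0.
by apply: h; apply: mulr_gt0; apply: mulr_gt0 => //; exact: exprn_gt0.
Qed.

Section design.
Variables (n p : nat) (b0 bh : 'cV[R]_p) (X : 'M[R]_(n, p)) (e : 'cV[R]_n).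
Let k := nsupp b0.
Let L : R := ln p%:R.

(* Zero beyond p, so that weight is nonincreasing on all of nat. *)
Definition weight i : R := if (i < p)%N then lscale * xq q p i else 0.
Definition cutoff : R := rho * weight k.-1.
(* Calibrated so that gram_bad has probability at most p^-4 (gram_bad_bound). *)
Definition gram_level i : R := 4 * Num.sqrt (ell p i + L / i.+1%:R) / Num.sqrt n%:R.

Hypothesis k_gt0 : (0 < k)%N.
Hypothesis k2p : (2 * k < p)%N.
Hypothesis n_gt0 : (0 < n)%N.
Hypothesis L_ge1 : 1 <= L.
Hypothesis L_q : ln (2 / q) <= eta0 * L.
Hypothesis k_frac : k%:R / p%:R <= frac_bound q iota0.
Hypothesis k_size : k%:R ^+ 2 * L / n%:R <= size_bound.
Hypothesis signal : forall j, b0 j 0 != 0 ->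
  2 * sigma * (1 + delta) * Num.sqrt (2 * L) <= `|b0 j 0|.
Hypothesis opt : is_slope_solution X (X *m b0 + e) (slope_lambda sigma delta q p) bh.
Hypothesis score_count : dominated (fun i => rho * weight i) (score X e).
Hypothesis cutoff_count : (#|[pred j | (cutoff < `|score X e j|)%R]| <= k)%N.
Hypothesis gram_count : forall l (i : 'I_p),
  (#|[pred j : 'I_p | (j != l) && (gram_level i < `|gram X l j|)%R]| <= i)%N.
Hypothesis diag : forall l, `|gram X l l - 1| <= eta0.

Let I : pred 'I_p := fun j => (b0 j 0 != 0) || (cutoff < `|score X e j|).
Let m := #|I|.
Let s := lscale.

Let km : (k <= m)%N.
Proof.
rewrite /k /nsupp; apply: subset_leq_card; apply/fintype.subsetP => j.
by move=> /set_mem /= h; rewrite unfold_in /I h.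
Qed.

Let m2k : (m <= 2 * k)%N.
Proof.
rewrite mul2n -addnn -[X in (_ <= X + _)%N]/(nsupp b0).
apply: leq_trans (leq_add (leqnn _) cutoff_count).
have -> : nsupp b0 = #|[pred j | b0 j 0 != 0]|.
  by apply: eq_card => j; rewrite !inE; apply/idP/idP => [/set_mem//|h]; exact: mem_set.
rewrite -cardUI; apply: leq_trans (leq_addr _ _).
by apply: subset_leq_card; apply/fintype.subsetP => j; rewrite !inE.
Qed.

Let p_gt0 : (0 < p)%N. Proof. by case: (rank_bounds k_gt0 km m2k k2p). Qed.
Let kp : (k.-1 < p)%N. Proof. by case: (rank_bounds k_gt0 km m2k k2p). Qed.
Let m_lt : (m < p)%N. Proof. by case: (rank_bounds k_gt0 km m2k k2p). Qed.
Let m_gt0 : (0 < m)%N. Proof. by case: (rank_bounds k_gt0 km m2k k2p). Qed.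
Let m1_lt : (m.-1 < p)%N. Proof. by case: (rank_bounds k_gt0 km m2k k2p) => _ _ _ _ []. Qed.
Let km1 : (k.-1 <= m.-1)%N. Proof. by case: (rank_bounds k_gt0 km m2k k2p) => _ _ _ _ []. Qed.

Let weightE i : (i < p)%N -> weight i = s * xq q p i.
Proof. by rewrite /weight => ->. Qed.

Let weight_gt0 i : (i < p)%N -> 0 < weight i.
Proof. by move=> ip; rewrite weightE// mulr_gt0 ?lscale_gt0 ?xq_gt0. Qed.

Let weight_ge0 i : 0 <= weight i.
Proof. by rewrite /weight; case: ifP => // ip; rewrite ltW// mulr_gt0 ?lscale_gt0 ?xq_gt0. Qed.

Lemma weight_decr : decr weight.
Proof.
move=> i j ij; have [jp|pj] := ltnP j p; last by rewrite [leLHS]/weight ltnNge pj.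
rewrite !weightE// ?(leq_ltn_trans ij)// ler_pM2l ?lscale_gt0//.
exact: xq_decr.
Qed.

Let ell0 : ell p 0 <= 3 * L :> R.
Proof.
have p0 : 0 < p%:R :> R by rewrite ltr0n.
rewrite /ell divr1 lnM ?posrE// -/L.
have := @ln_le_sub1 R 2 (ltr0Sn _ _); move: L_ge1; lra.
Qed.

Let n0 : 0 < n%:R :> R. Proof. by rewrite ltr0n. Qed.
Let L0 : 0 < L. Proof. exact: lt_le_trans L_ge1. Qed.
Let k0 : 0 < k%:R :> R. Proof. by rewrite ltr0n. Qed.
Let ek : 0 < ell p k.-1 :> R. Proof. exact: lt_le_trans (@ell_ge1 R p _ kp). Qed.
Let E := k%:R ^+ 2 * L / n%:R.
Let E0 : 0 <= E. Proof. by rewrite divr_ge0 ?mulr_ge0 ?sqr_ge0 ?ltW. Qed.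

Let Ln0 : 0 <= L / n%:R. Proof. by rewrite divr_ge0 ?ltW. Qed.
Let k0' : 0 <= k%:R :> R. Proof. exact: ltW. Qed.

Let mR : m%:R <= 2 * k%:R :> R.
Proof. by rewrite -natrM ler_nat. Qed.

(** [mu] dominates [gram_level 0], since [ell p 0 + L <= 4 * L]. The factor [ell p k.-1] in the
    denominator of [gam0] cancels the one in [Lam], so that [m * (gam0 * Lam)^2] is of order k^2 log
    p / n. *)
Definition mu : R := 8 * Num.sqrt (L / n%:R).
Definition gam0 : R := Num.sqrt (C2 * L / n%:R / ell p k.-1) / lscale.
Definition Lam : R := lscale * Num.sqrt (C3 * k%:R * ell p k.-1).

Let mu_sq : mu ^+ 2 = 64 * (L / n%:R).
Proof. by rewrite exprMn sqr_sqrtr ?divr_ge0 ?ltW//; lra. Qed.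

Let gam_sq : gam0 ^+ 2 = C2 * L / n%:R / ell p k.-1 / lscale ^+ 2.
Proof.
rewrite expr_div_n sqr_sqrtr// divr_ge0 ?(ltW ek)// divr_ge0 ?(ltW n0)//.
by rewrite mulr_ge0 ?ltW ?C2_gt0.
Qed.

Let Lam_sq : Lam ^+ 2 = lscale ^+ 2 * (C3 * k%:R * ell p k.-1).
Proof.
by rewrite exprMn sqr_sqrtr// ltW// (mulr_gt0 (mulr_gt0 C3_gt0 k0) ek).
Qed.

Let sq_le (a b : R) : 0 <= b -> a ^+ 2 <= b ^+ 2 -> a <= b.
Proof.
move=> b00 h; have [a0|/ltW a0] := leP 0 a; last exact: le_trans b00.
by rewrite -ler_sqr.
Qed.

(** [xq_rank] compares rank [m + i] with [maxn i k.-1]: the maximum is [k.-1], giving the cutoff, or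
    [i], giving the weight of rank [i]. *)
Let off_level i : (m + i < p)%N ->
  rho * weight i <= (1 - 2 * cst) * weight (m + i)%N \/
  cutoff <= (1 - 2 * cst) * weight (m + i)%N.
Proof.
move=> mi; have := xq_rank q01 k_gt0 km m2k mi iota0_gt0 k_frac.
have key a : (a < p)%N -> xq q p a <= (1 + iota0) * xq q p (m + i) ->
    rho * weight a <= (1 - 2 * cst) * weight (m + i)%N.
  move=> ap h; rewrite !weightE// mulrCA [leRHS]mulrCA ler_pM2l ?lscale_gt0//.
  apply: (@le_trans _ _ (rho * ((1 + iota0) * xq q p (m + i)))).
    by rewrite ler_wpM2l// ltW// rho_gt0.
  rewrite mulrA ler_pM2r ?xq_gt0// /iota0 /cst.
  have := rho_gt0; have := rho_lt1; move: rho => r r1 r0.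
  have : 0 <= (1 - r) * (1 - r) by rewrite mulr_ge0 ?subr_ge0 ?ltW.
  lra.
have [ik|ki] := leqP i k.-1.
  by move=> h; right; exact: key.
move=> h; left; apply: key => //.
exact: leq_ltn_trans (leq_addl m i) mi.
Qed.

Let xi_le i : (m + i < p)%N -> gram_level i <= gam0 * weight (m + i)%N.
Proof.
move=> mi; have ip : (i < p)%N := leq_ltn_trans (leq_addl m i) mi.
have g0 : 0 <= gam0 by rewrite divr_ge0 ?sqrtr_ge0 ?ltW ?lscale_gt0.
have ei : 1 <= ell p i :> R by exact: ell_ge1.
apply: sq_le; first by rewrite mulr_ge0.
rewrite [leRHS]exprMn gam_sq weightE// [(s * _) ^+ 2]exprMn [leRHS]mulrA divfK; last first.
  by rewrite gt_eqF// exprn_gt0// lscale_gt0.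
rewrite /gram_level expr_div_n sqr_sqrtr ?(ltW n0)// exprMn sqr_sqrtr; last first.
  by rewrite addr_ge0 ?divr_ge0 ?ltW// (lt_le_trans _ ei).
apply: (@le_trans _ _ (C2 * L / n%:R / ell p k.-1 * (c1 q * ell p (m + i)))); last first.
  rewrite ler_wpM2l ?xq_sq_lb//.
  by rewrite divr_ge0 ?(ltW ek)// divr_ge0 ?(ltW n0)// mulr_ge0 ?ltW ?C2_gt0.
have h1 := @ell_prod R p k m i k_gt0 km m2k mi; have h2 := @ell_div R p k m i k_gt0 km m2k mi.
have c10 := c1_gt0 q01; have em := @ell_ge1 R p _ mi.
have -> : C2 * L / n%:R / ell p k.-1 * (c1 q * ell p (m + i)) =
    15 * 16 * L * ell p (m + i) / ell p k.-1 / n%:R.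
  by rewrite /C2; field; rewrite !gt_eqF.
rewrite ler_pM2r ?invr_gt0// ler_pdivlMr//.
have -> : 4 ^+ 2 * (ell p i + L / i.+1%:R) * ell p k.-1 =
   16 * (ell p i * ell p k.-1) + 16 * L * (ell p k.-1 / i.+1%:R) by ring.
have h3 : 3 * ell p (m + i) * ell p 0 <= 3 * ell p (m + i) * (3 * L).
  by rewrite ler_wpM2l//; move: em; lra.
have h4 := ler_wpM2l (ltW L0) h2.
by move: h1 h3 h4; move: (ell p k.-1 / i.+1%:R) (ell p i * ell p k.-1) => y y'; lra.
Qed.

Let xi0_le : gram_level 0 <= mu.
Proof.
apply: sq_le; first by rewrite mulr_ge0 ?sqrtr_ge0.
have e0 : 1 <= ell p 0 :> R by exact: ell_ge1.
rewrite mu_sq /gram_level expr_div_n sqr_sqrtr ?(ltW n0)// exprMn sqr_sqrtr; last first.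
  by rewrite divr1 addr_ge0 ?ltW// (lt_le_trans _ e0).
rewrite [leRHS]mulrA ler_pM2r ?invr_gt0// divr1; move: ell0; lra.
Qed.

Let m_mu : m%:R * mu <= 4^-1.
Proof.
apply: sq_le => //; rewrite exprMn mu_sq.
have h : E <= (64^-1) ^+ 2 by apply: le_trans k_size _; rewrite !ge_min lexx.
have h2 : m%:R ^+ 2 <= (2 * k%:R) ^+ 2 :> R by rewrite ler_sqr ?nnegrE// mulr_ge0.
apply: (@le_trans _ _ ((2 * k%:R) ^+ 2 * (64 * (L / n%:R)))).
  by apply: ler_wpM2r => //; exact: mulr_ge0.
have -> : (2 * k%:R) ^+ 2 * (64 * (L / n%:R)) = 256 * E by rewrite /E; ring.
move: h; lra.
Qed.

Let Lam_ge : \sum_(i < m) weight i ^+ 2 <= Lam ^+ 2.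
Proof.
rewrite Lam_sq.
have mp := ltnW m_lt.
apply: (@le_trans _ _ (\sum_(i < m) (lscale ^+ 2 * C1 q) * ell p i)).
  apply: ler_sum => i _; have ip : (i < p)%N by apply: leq_trans mp.
  by rewrite weightE// exprMn -mulrA ler_wpM2l ?sqr_ge0// xq_sq_ub.
rewrite -mulr_sumr -mulrA ler_wpM2l ?sqr_ge0//.
have C10 : 0 <= C1 q by apply: le_trans (C1_ge2 q01).
have -> : C3 * k%:R * ell p k.-1 = C1 q * (2 * (2 * k%:R) * ell p k.-1) by rewrite /C3; ring.
rewrite ler_wpM2l//; apply: le_trans (@sum_ell R p m m_gt0 mp) _.
have em : ell p m.-1 <= ell p k.-1 :> R by exact: ell_decr.
have em1 : 1 <= ell p m.-1 :> R by exact: ell_ge1.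
apply: ler_pM => //; last by rewrite ler_pM2l.
exact: le_trans em1.
Qed.

Let mE : m%:R * k%:R * (L / n%:R) <= 2 * E.
Proof.
have -> : 2 * E = 2 * k%:R * k%:R * (L / n%:R) by rewrite /E; ring.
by apply: ler_wpM2r => //; exact: ler_wpM2r.
Qed.

Let Lam_gam : m%:R * (gam0 * (9 * Lam)) ^+ 2 <= cst ^+ 2.
Proof.
have c2 := C2_gt0; have c3 := C3_gt0; have l0 := lscale_gt0.
have -> : m%:R * (gam0 * (9 * Lam)) ^+ 2 = 9 ^+ 2 * (C2 * C3) * (m%:R * k%:R * (L / n%:R)).
  transitivity (m%:R * (gam0 ^+ 2 * (9 ^+ 2 * Lam ^+ 2))); first by ring.
  rewrite gam_sq Lam_sq; field.
  by rewrite !gt_eqF.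
apply: (@le_trans _ _ (9 ^+ 2 * (C2 * C3) * (2 * E))); first by
  apply: ler_wpM2l => //; apply: mulr_ge0; [exact: exprn_ge0|apply: mulr_ge0; exact: ltW].
have h : E <= cst ^+ 2 / (2 * 9 ^+ 2 * (C2 * C3)) by apply: le_trans k_size _; rewrite !ge_min lexx orbT.
have y0 := mulr_gt0 c2 c3; move: h; move: (C2 * C3) (cst ^+ 2) (E) y0 => y a f y0.
rewrite ler_pdivlMr; first by lra.
by rewrite mulr_gt0.
Qed.

(** The largest weight is at most [(1 + eta0) * lscale * r] and the signal is [2 * lscale * r]. One
    unit pays for the penalty and [rho] for the score; the rest absorbs [eta0] and the interference
    [nu], at most [cst * lscale * r]. *)
Let signal_strong nu : 0 <= nu -> nu ^+ 2 <= m%:R * (mu * (8 * Lam)) ^+ 2 ->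
  (1 + rho) * weight 0 < (1 - eta0) * (2 * sigma * (1 + delta) * Num.sqrt (2 * L)) - nu.
Proof.
move=> nu0 hnu; set r := Num.sqrt (2 * L).
have r0 : 0 < r by rewrite sqrtr_gt0 mulr_gt0.
have r2 : r ^+ 2 = 2 * L by rewrite sqr_sqrtr// mulr_ge0 ?ltW.
have l0 := lscale_gt0; have c3 := C3_gt0; have c0 := cst_gt0.
have pR : 0 < p%:R :> R by rewrite ltr0n.
have q0 : 0 < q by case/andP: q01.
have h1 : nu <= cst * lscale * r.
  apply: sq_le; first exact: (mulr_ge0 (mulr_ge0 (ltW c0) (ltW l0)) (ltW r0)).
  apply: le_trans hnu _.
  have -> : m%:R * (mu * (8 * Lam)) ^+ 2 =
      64 ^+ 2 * C3 * lscale ^+ 2 * ell p k.-1 * (m%:R * k%:R * (L / n%:R)).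
    transitivity (m%:R * (mu ^+ 2 * (64 * Lam ^+ 2))); first by ring.
    by rewrite mu_sq Lam_sq; ring.
  have ek3 : ell p k.-1 <= 3 * L by apply: le_trans ell0; exact: ell_decr.
  have cl0 : 0 <= 64 ^+ 2 * C3 * lscale ^+ 2.
    exact: (mulr_ge0 (mulr_ge0 (exprn_ge0 _ (ler0n _ _)) (ltW c3)) (sqr_ge0 _)).
  apply: (@le_trans _ _ (64 ^+ 2 * C3 * lscale ^+ 2 * (3 * L) * (2 * E))).
    apply: ler_pM => //; last exact: ler_wpM2l.
      exact: (mulr_ge0 cl0 (ltW ek)).
    by rewrite mulr_ge0// mulr_ge0.
  have h : E <= cst ^+ 2 / (3 * 64 ^+ 2 * C3) by apply: le_trans k_size _; rewrite !ge_min lexx !orbT.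
  have -> : (cst * lscale * r) ^+ 2 = cst ^+ 2 * lscale ^+ 2 * r ^+ 2 by ring.
  rewrite r2.
  have -> : 64 ^+ 2 * C3 * lscale ^+ 2 * (3 * L) * (2 * E) = lscale ^+ 2 * (2 * L) * (E * (3 * 64 ^+ 2 * C3)) by ring.
  have -> : cst ^+ 2 * lscale ^+ 2 * (2 * L) = lscale ^+ 2 * (2 * L) * cst ^+ 2 by ring.
  apply: ler_wpM2l; first by rewrite mulr_ge0 ?sqr_ge0// mulr_ge0// ltW.
  rewrite -ler_pdivlMr//; apply: mulr_gt0 => //; apply: mulr_gt0 => //; exact: exprn_gt0.
have e0 := eta0_gt0.
have h2 : xq q p 0 <= (1 + eta0) * r.
  apply: sq_le; first by exact: (mulr_ge0 (addr_ge0 ler01 (ltW e0)) (ltW r0)).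
  apply: le_trans (xq_sq_ub0 q01 p_gt0) _.
  rewrite [leRHS]exprMn r2 /ell divr1 lnM ?posrE// -/L.
  move: L_q; rewrite ln_div ?posrE// => hq.
  have : L * (1 + eta0) <= (1 + eta0) ^+ 2 * L.
    rewrite [leRHS]mulrC ler_pM2l// expr2 -[leLHS]mul1r; apply: ler_wpM2r.
      exact: (addr_ge0 ler01 (ltW e0)).
    by rewrite lerDl ltW.
  by move: hq; lra.
have wE : weight 0 = lscale * xq q p 0 by rewrite weightE.
have {}h2 : weight 0 <= lscale * ((1 + eta0) * r) by rewrite wE ler_pM2l.
have -> : 2 * sigma * (1 + delta) = 2 * lscale by rewrite /lscale; ring.
have rh0 := rho_gt0; have rh1 := rho_lt1.
have h3 : (1 + rho) * weight 0 <= (1 + rho) * (lscale * ((1 + eta0) * r)).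
  apply: ler_wpM2l => //; exact: (addr_ge0 ler01 (ltW rh0)).
have : 0 < (lscale * r) * ((1 - eta0) * 2 - cst - (1 + rho) * (1 + eta0)).
  apply: mulr_gt0; first exact: mulr_gt0.
  rewrite /eta0 /cst.
  have : 0 < (1 - rho) * (1 - rho) by rewrite mulr_gt0 ?subr_gt0.
  by move: rh0 rh1; move: rho => a; lra.
by move: h1 h3; lra.
Qed.

Lemma slope_good :
  (nfalse_disc b0 bh <= #|[pred j | (cutoff < `|score X e j|)%R]|)%N /\
  ntrue_disc b0 bh = nsupp b0.
Proof.
have rh0 := rho_gt0; have rh1 := rho_lt1.
have optE : is_slope_solution X (X *m b0 + e) (fun i : 'I_p => weight i) bh.
  rewrite (_ : (fun i : 'I_p => weight i) = slope_lambda sigma delta q p)//.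
  by apply/funext => i; rewrite weightE.
apply: (@discoveries_good R n p X e b0 bh weight gram_level rho cutoff cst gam0 Lam mu eta0
  (2 * sigma * (1 + delta) * Num.sqrt (2 * L))) => //.
- exact: weight_decr.
- exact: ltW.
- exact: ltW.
- exact: cst_gt0.
- exact: cst_le.
- by rewrite divr_ge0 ?sqrtr_ge0 ?ltW ?lscale_gt0.
- by rewrite (mulr_gt0 lscale_gt0)// sqrtr_gt0 (mulr_gt0 (mulr_gt0 C3_gt0 k0) ek).
- by rewrite mulr_ge0 ?sqrtr_ge0.
- exact: eta0_le4.
- exact: weight_gt0.
- rewrite mulr_ge0 ?sqrtr_ge0// mulr_ge0 ?addr_ge0 ?ltW//.
  exact: mulr_gt0.
Qed.

End design.
End constants.

(** * Probability of the bad event *)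

Section rate.
Context {R : realType}.
Implicit Types x y : R.

(** The Chernoff factor per exceedance in [exceed_prob], when the expected count is at most [x]
    times the allowed one: below 1 for [x < 1], and of order [x] near 0. *)
Definition rate x := x * expR (1 - x).

Lemma rate_le x y : 0 <= x -> x <= y -> y <= 1 -> rate x <= rate y.
Proof.
move=> x_ge0 xy y1.
have h : x <= y * expR (- (y - x)).
  apply: (@le_trans _ _ (y * (1 - (y - x)))).
    rewrite -subr_ge0 (_ : y * (1 - (y - x)) - x = (y - x) * (1 - y)); last by ring.
    by rewrite mulr_ge0 ?subr_ge0.
  by apply: ler_wpM2l; [exact: le_trans xy|exact: expR_ge1Dx].
rewrite /rate (_ : 1 - y = - (y - x) + (1 - x)); last by ring.
by rewrite [in leRHS]expRD [leRHS]mulrA; apply: ler_wpM2r => //; exact: expR_ge0.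
Qed.

Lemma rate_lt1 x : x < 1 -> rate x < 1.
Proof.
move=> x1; rewrite /rate -[1 - x]opprB expRN ltr_pdivrMr ?expR_gt0// mul1r.
have := @expR_gt1Dx R (x - 1); rewrite subr_eq0 lt_eqF// => /(_ isT).
by rewrite addrC subrK.
Qed.

Lemma rate_le_e x : 0 <= x -> rate x <= expR 1 * x.
Proof. by move=> x_ge0; rewrite /rate mulrC ler_wpM2r// ler_expR gerBl. Qed.

Lemma rate_ge0 x : 0 <= x -> 0 <= rate x.
Proof. by move=> x_ge0; rewrite mulr_ge0// expR_ge0. Qed.

Lemma rate_expX x r : 0 <= x -> x <= 1 -> (0 < r)%N -> rate x ^+ r <= expR 1 * x.
Proof.
move=> x_ge0 x1 r0; apply: le_trans (rate_le_e x_ge0).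
have r1 : rate x <= 1 by have := rate_le x_ge0 x1 (lexx 1); rewrite /rate subrr expR0 mulr1.
by rewrite -[leRHS]expr1 ler_wiXn2l// rate_ge0.
Qed.

(** For the union bound over all ranks: finitely many early ranks get a small uniform bound, the
    later ones a geometric series. *)
Lemma sum_split_geometric (a tau : R) (N p : nat) : 0 <= a -> 0 <= tau -> tau < 1 ->
  \sum_(i < p) (if (i < N)%N then a else tau ^+ i.+1) <= N%:R * a + tau ^+ N / (1 - tau).
Proof.
move=> a0 t0 t1; have t1' : 0 < 1 - tau by rewrite subr_gt0.
apply: (@le_trans _ _ ((minn p N)%:R * a + tau ^+ N / (1 - tau) - tau ^+ (maxn p N) / (1 - tau))).
  elim: p => [|p IH].
    by rewrite big_ord0 min0n max0n mul0r add0r subrr.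
  rewrite big_ord_recr/=; apply: le_trans (lerD IH (lexx _)) _.
  have [pN|Np] := ltnP p N.
    rewrite (minn_idPl pN) (maxn_idPr pN).
    by rewrite -natr1; lra.
  rewrite (minn_idPr (leqW Np)) (maxn_idPl (leqW Np)).
  rewrite -addrA lerD2l -subr_ge0.
  rewrite (_ : _ - _ = tau ^+ p * (1 - tau)); first by rewrite mulr_ge0 ?exprn_ge0// ltW.
  by rewrite exprS; field; rewrite gt_eqF.
have : (minn p N)%:R * a <= N%:R * a by rewrite ler_wpM2r// ler_nat geq_minr.
have : 0 <= tau ^+ maxn p N / (1 - tau) by rewrite divr_ge0 ?exprn_ge0// ltW.
lra.
Qed.

End rate.

Section bounded_event.
Context d (T : measurableType d) (R : realType) (P : probability T R).

Definition bounded_event (A : set T) (b : R) := measurable A /\ (P A <= b%:E)%E.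

Lemma bounded_eventU A B a b : bounded_event A a -> bounded_event B b ->
  bounded_event (A `|` B) (a + b).
Proof.
move=> [mA pA] [mB pB]; split; first exact: measurableU.
by apply: le_trans (measureU2 _ mA mB) _; rewrite EFinD; exact: leeD.
Qed.

Lemma bounded_event_big (K : finType) (A : K -> set T) (a : K -> R) :
  (forall j, bounded_event (A j) (a j)) ->
  bounded_event (\big[setU/set0]_j A j) (\sum_j a j).
Proof.
move=> h; elim/big_ind2 : _ => //.
  by split; [exact: measurable0|rewrite measure0].
by move=> *; exact: bounded_eventU.
Qed.

Lemma bigsetU_out (K : finType) (A : K -> set T) j w : ~ (\big[setU/set0]_j A j) w -> ~ A j w.
Proof. by rewrite (bigD1 j) //= => h hj; apply: h; left. Qed.

Lemma bounded_event_le A a b : bounded_event A a -> a <= b -> bounded_event A b.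
Proof. by move=> [mA pA] ab; split=> //; apply: le_trans pA _; rewrite lee_fin. Qed.

End bounded_event.

Lemma card_count (K : finType) (a : pred K) : #|[pred j | a j]| = count a (enum K).
Proof. by rewrite -sum1_card -sum1_count big_enum_cond; apply: eq_bigl. Qed.

Lemma sum_enum (V : nmodType) (K : finType) (f : K -> V) :
  \sum_(j <- enum K) f j = \sum_j f j.
Proof. by rewrite big_enum. Qed.

Section bad_events.
Context d (T : measurableType d) (R : realType) (P : probability T R).
Variables (sigma delta q : R).
Hypothesis sigma_gt0 : 0 < sigma.
Hypothesis delta_gt0 : 0 < delta.
Hypothesis q01 : 0 < q < 1.
Variables (n p : nat) (X : T -> 'M[R]_(n, p)) (eps : T -> 'cV[R]_n).
Hypothesis lawX : forall i j, has_normal_law P (fun w => X w i j) 0 (Num.sqrt (n%:R^-1)).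
Hypothesis lawE : forall i, has_normal_law P (fun w => eps w i 0) 0 sigma.
Hypothesis indep : mutually_independent P (design_noise_family X eps).
Hypothesis n_gt0 : (0 < n)%N.

Let Z := design_noise_family X eps.
Let s : R := Num.sqrt (n%:R^-1).
Let sv : R := Num.sqrt n%:R * (sigma * (1 + kap delta)).

Let mZ a : measurable_fun setT (Z a).
Proof. by case: a => [[i j]|i]; [have [] := lawX i j|have [] := lawE i]. Qed.

Let nR : 0 < n%:R :> R. Proof. by rewrite ltr0n. Qed.
Let s_gt0 : 0 < s. Proof. by rewrite sqrtr_gt0 invr_gt0. Qed.
Let s_sq : n%:R * s ^+ 2 = 1.
Proof. by rewrite sqr_sqrtr ?invr_ge0 ?ltW// divff// gt_eqF. Qed.
Let kap0 := kap_gt0 delta_gt0.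
Let sk_gt0 : 0 < sigma * (1 + kap delta). Proof. by rewrite mulr_gt0// addr_gt0. Qed.
Let sv_gt0 : 0 < sv. Proof. by rewrite mulr_gt0// sqrtr_gt0. Qed.
Let s_sv : s * sv = sigma * (1 + kap delta).
Proof.
rewrite /s /sv sqrtrV ?ltW// mulrA mulVf ?mul1r//.
by rewrite gt_eqF// sqrtr_gt0.
Qed.

(** The factor 1 is the sign in [chi_square_tail]. The relative excess [2 * kap delta] is admissible
    because [1 + 2 kap <= (1 + kap)^2]. *)
Definition noise_bad : set T :=
  [set w | n%:R * sigma ^+ 2 * (2 * kap delta) <=
     1 * (\sum_(i <- enum 'I_n) eps w i 0 ^+ 2 - n%:R * sigma ^+ 2)].

Lemma noise_bad_bound : bounded_event P noise_bad (expR (- (n%:R * (2 * kap delta) ^+ 2 / 16))).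
Proof.
split.
  rewrite -[noise_bad]setTI /noise_bad.
  have mf : measurable_fun setT
      (fun w => 1 * (\sum_(i <- enum 'I_n) eps w i 0 ^+ 2 - n%:R * sigma ^+ 2)).
    apply: measurable_funM => //; apply: measurable_funB => //.
    by apply: measurable_sum => i; apply: measurable_funX; exact: (mZ (inr i)).
  have := mf measurableT _ (measurable_itv `[n%:R * sigma ^+ 2 * (2 * kap delta), +oo[).
  by congr measurable; congr (_ `&` _); apply/seteqP; split => w /=; rewrite in_itv/= andbT.
have k6 := kap_le delta.
have := @chi_square_tail _ _ _ P _ Z mZ indep 'I_n inr sigma (2 * kap delta) 1 (enum 'I_n).
rewrite size_enum_ord; apply => //.
- by move=> ? ? [].
- exact: enum_uniq.
- by rewrite mulr_gt0.
- by move: k6; lra.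
- by rewrite expr1n.
Qed.

Lemma noise_good w : ~ noise_bad w -> \sum_i eps w i 0 ^+ 2 <= sv ^+ 2.
Proof.
move=> /negP; rewrite -ltNge mul1r sum_enum => h.
have k0 := kap0.
rewrite /sv exprMn sqr_sqrtr ?(ltW nR)// exprMn.
have : 0 <= n%:R * sigma ^+ 2 * kap delta ^+ 2.
  exact: (mulr_ge0 (mulr_ge0 (ltW nR) (sqr_ge0 _)) (sqr_ge0 _)).
move: h; move: (\sum_i _) => S; lra.
Qed.

Definition diag_bad (l : 'I_p) (sg : R) : set T :=
  [set w | eta0 delta <= sg * (\sum_(i <- enum 'I_n) X w i l ^+ 2 - 1)].

Lemma diag_bad_bound l sg : sg ^+ 2 = 1 ->
  bounded_event P (diag_bad l sg) (expR (- (n%:R * eta0 delta ^+ 2 / 16))).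
Proof.
move=> sg2; split.
  rewrite -[diag_bad l sg]setTI /diag_bad.
  have mf : measurable_fun setT (fun w => sg * (\sum_(i <- enum 'I_n) X w i l ^+ 2 - 1)).
    apply: measurable_funM => //; apply: measurable_funB => //.
    by apply: measurable_sum => i; apply: measurable_funX; exact: (mZ (inl (i, l))).
  have := mf measurableT _ (measurable_itv `[eta0 delta, +oo[).
  by congr measurable; congr (_ `&` _); apply/seteqP; split => w /=; rewrite in_itv/= andbT.
have e4 := eta0_le4 delta_gt0.
have := @chi_square_tail _ _ _ P _ Z mZ indep 'I_n (fun i => inl (i, l)) s (eta0 delta) sg (enum 'I_n).
rewrite size_enum_ord s_sq mul1r; apply => //.
- by move=> ? ? [].
- by move=> i; exact: lawX.
- exact: enum_uniq.
- exact: eta0_gt0.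
- by move: e4; lra.
Qed.

Lemma diag_good l w : ~ diag_bad l 1 w -> ~ diag_bad l (-1) w ->
  `|gram (X w) l l - 1| <= eta0 delta.
Proof.
move=> /negP; rewrite -ltNge mul1r sum_enum => h1.
move=> /negP; rewrite -ltNge mulN1r sum_enum => h2.
rewrite /gram; under eq_bigr do rewrite -expr2.
by rewrite ler_norml lerNl !ltW.
Qed.

Definition score_bad (t : R) (r : nat) : set T :=
  exceed Z (fun i j => inl (i, j)) inr (sv ^+ 2) t (enum 'I_p) r.

Let inl_inj (i i' : 'I_n) (j j' : 'I_p) :
  inl (i, j) = inl (i', j') :> ('I_n * 'I_p + 'I_n)%type -> i = i' /\ j = j'.
Proof. by case. Qed.

(** [rho * lscale] is [sigma * (1 + kap)^2], so the normalised threshold is [(1 + kap)] times the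
    quantile. [tail_qt_scale] applies, and [2 * p * level i] equals [q * (i + 1)]: the left side of
    the hypothesis bounds the expected count. *)
Lemma score_bad_bound i r r0 : (i < p)%N -> 0 < r0 < 1 ->
  q * expR (- (kap delta * xq q p i ^+ 2)) * i.+1%:R <= r0 * r%:R ->
  bounded_event P (score_bad (rho delta * weight sigma delta q p i) r) (rate r0 ^+ r).
Proof.
move=> ip r01 hr; split; first exact: measurable_exceed.
have x0 := xq_gt0 q01 ip; have l0 := lscale_gt0 sigma_gt0 delta_gt0.
have p0 : 0 < p%:R :> R by rewrite ltr0n (leq_ltn_trans _ ip).
have w0 : 0 < weight sigma delta q p i by rewrite /weight ip mulr_gt0.
have rh0 := rho_gt0 delta_gt0.
apply: (exceed_prob mZ indep inl_inj s_gt0) => //.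
- exact: exprn_gt0.
- by rewrite mulr_ge0// ltW.
- exact: enum_uniq.
rewrite size_enum_ord sqrtr_sqr gtr0_norm// s_sv.
have -> : rho delta * weight sigma delta q p i / (sigma * (1 + kap delta)) =
    (1 + kap delta) * xq q p i.
  rewrite /weight ip /rho /lscale; field.
  by rewrite !gt_eqF ?addr_gt0.
apply: le_trans hr.
have h := tail_qt_scale (level_gt0 q01 ip) (level_lt q01 ip) (ltW kap0).
have pw : 0 <= p%:R * 2 :> R by rewrite mulr_ge0 ?ltW.
rewrite mulrA; apply: le_trans (ler_wpM2l pw h) _.
rewrite /xq le_eqVlt; apply/orP; left; apply/eqP.
set E := expR _; rewrite /level; move: (i.+1%:R : R) (p%:R : R) p0 => a b b0; field.
by rewrite gt_eqF.
Qed.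

Lemma score_good t r w : ~ noise_bad w -> ~ score_bad t r w ->
  (#|[pred j | (t < `|score (X w) (eps w) j|)%R]| < r)%N.
Proof.
move=> /noise_good hn hs; rewrite ltnNge; apply/negP => h; apply: hs; split => //.
rewrite card_count in h; apply: leq_trans h _; rewrite leq_eqVlt; apply/orP; left; apply/eqP.
by apply: eq_count => j; rewrite /score; under eq_bigr do rewrite mulrC.
Qed.

Definition gram_bad (l : 'I_p) (i : nat) : set T :=
  exceed Z (fun i j => inl (i, j)) (fun i => inl (i, l)) 2 (gram_level n p i)
    [seq j <- enum 'I_p | j != l] i.+1.

Lemma gram_bad_bound l i : (i < p)%N ->
  bounded_event P (gram_bad l i) (expR (- (4 * ln p%:R))).
Proof.
move=> ip; split; first exact: measurable_exceed.
have pn : (0 < p)%N := leq_ltn_trans (leq0n i) ip.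
have p0 : 0 < p%:R :> R by rewrite ltr0n.
have L0 : 0 <= ln p%:R :> R by rewrite ln_ge0// ler1n.
have i0 : 0 < i.+1%:R :> R by rewrite ltr0Sn.
have e1 := @ell_ge1 R p _ ip.
pose A : R := ell p i + ln p%:R / i.+1%:R.
have A0 : 0 <= A by rewrite addr_ge0 ?(divr_ge0 L0)// ?ltW//; exact: lt_le_trans e1.
(* Chosen so that [expR 1 * r0] to the power [i + 1] is p^-4, which survives a union over p^2
   pairs. *)
pose r0 : R := expR (- 1 - 4 * ln p%:R / i.+1%:R).
have r01 : 0 < r0 < 1.
  rewrite expR_gt0/= -expR0 ltr_expR.
  have : 0 <= 4 * ln p%:R / i.+1%:R :> R by rewrite divr_ge0 ?mulr_ge0// ltW.
  by move: (4 * ln p%:R / i.+1%:R) => y; lra.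
have h : (size [seq j <- enum 'I_p | j != l])%:R * (2 * tail (gram_level n p i / (s * Num.sqrt 2)))
    <= r0 * i.+1%:R.
  have sp : (size [seq j <- enum 'I_p | j != l] <= p)%N.
    by rewrite size_filter -[leqRHS](size_enum_ord p) count_size.
  apply: (@le_trans _ _ (p%:R * (2 * expR (- (4 * A))))).
    apply: ler_pM => //; first by rewrite mulr_ge0// tail_ge0.
      by rewrite ler_nat.
    rewrite ler_pM2l//; apply: le_trans (tail_expR _) _.
      rewrite divr_ge0 ?mulr_ge0 ?sqrtr_ge0//.
    rewrite ler_expR /gram_level -/A /s sqrtrV ?(ltW nR)//.
    have n2 : 0 < Num.sqrt n%:R :> R by rewrite sqrtr_gt0.
    have t2 : 0 < Num.sqrt 2 :> R by rewrite sqrtr_gt0.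
    have -> : 4 * Num.sqrt A / Num.sqrt n%:R / ((Num.sqrt n%:R)^-1 * Num.sqrt 2) =
        4 * Num.sqrt A / Num.sqrt 2.
      by field; rewrite !gt_eqF.
    by rewrite expr_div_n exprMn !sqr_sqrtr//; lra.
  have -> : r0 * i.+1%:R = p%:R * (2 * (r0 * (i.+1%:R / (2 * p%:R)))).
    by field; rewrite gt_eqF.
  rewrite ler_pM2l// ler_pM2l//.
  have -> : i.+1%:R / (2 * p%:R) = expR (- ln (2 * p%:R / i.+1%:R)) :> R.
    by rewrite expRN lnK ?posrE ?divr_gt0 ?mulr_gt0// invf_div.
  rewrite -expRD ler_expR /A; move: e1; rewrite /ell.
  have -> : 4 * ln p%:R / i.+1%:R = 4 * (ln p%:R / i.+1%:R) :> R by rewrite mulrA.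
  by move: (ln p%:R / i.+1%:R) (ln (2 * p%:R / i.+1%:R)) => x y; lra.
have g0 : 0 <= gram_level n p i :> R by rewrite divr_ge0 ?mulr_ge0 ?sqrtr_ge0.
have XW (a i' : 'I_n) (j : 'I_p) : j \in [seq j <- enum 'I_p | j != l] ->
    inl (a, j) != inl (i', l) :> ('I_n * 'I_p + 'I_n)%type.
  by rewrite mem_filter => /andP[jl _]; apply/eqP => -[_ jl']; rewrite jl' eqxx in jl.
have ur : uniq [seq j <- enum 'I_p | j != l] by rewrite filter_uniq// enum_uniq.
have v0 : 0 < 2 :> R by [].
have := exceed_prob mZ indep inl_inj s_gt0 v0 g0 lawX ur XW r01 h.
move=> hP; apply: le_trans hP _; rewrite lee_fin.
apply: (@le_trans _ _ ((expR 1 * r0) ^+ i.+1)).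
  have r00 : 0 <= r0 by rewrite expR_ge0.
  by rewrite lerXn2r ?nnegrE ?(rate_ge0 r00) ?mulr_ge0 ?expR_ge0//; exact: rate_le_e.
rewrite -expRD -expRM_natl ler_expR.
have -> : 1 + (- 1 - 4 * ln p%:R / i.+1%:R) = - (4 * ln p%:R) / i.+1%:R :> R by ring.
by rewrite mulrC divfK ?gt_eqF.
Qed.

Lemma gram_good l i w : \sum_i X w i l ^+ 2 <= 2 -> ~ gram_bad l i w ->
  (#|[pred j : 'I_p | (j != l) && (gram_level n p i < `|gram (X w) l j|)%R]| <= i)%N.
Proof.
move=> hl hs; rewrite -ltnS ltnNge; apply/negP => h; apply: hs; split => //.
rewrite card_count in h; apply: leq_trans h _; rewrite leq_eqVlt; apply/orP; left; apply/eqP.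
by rewrite [RHS]count_filter; apply: eq_count => j /=; rewrite andbC.
Qed.

End bad_events.

Section slope_bad_event.
Context d (T : measurableType d) (R : realType) (P : probability T R).
Variables (sigma delta q : R).
Hypothesis sigma_gt0 : 0 < sigma.
Hypothesis delta_gt0 : 0 < delta.
Hypothesis q01 : 0 < q < 1.
Variables (n p : nat) (b0 : 'cV[R]_p) (X : T -> 'M[R]_(n, p)) (eps : T -> 'cV[R]_n).
Hypothesis lawX : forall i j, has_normal_law P (fun w => X w i j) 0 (Num.sqrt (n%:R^-1)).
Hypothesis lawE : forall i, has_normal_law P (fun w => eps w i 0) 0 sigma.
Hypothesis indep : mutually_independent P (design_noise_family X eps).
Let k := nsupp b0.
Let L : R := ln p%:R.
Hypothesis k_gt0 : (0 < k)%N.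
Hypothesis k2p : (2 * k < p)%N.
Hypothesis n_gt0 : (0 < n)%N.
Hypothesis L_ge1 : 1 <= L.
Hypothesis L_q : ln (2 / q) <= eta0 delta * L.
Hypothesis k_frac : k%:R / p%:R <= frac_bound q (iota0 delta).
Hypothesis k_size : k%:R ^+ 2 * L / n%:R <= size_bound delta q.
Hypothesis signal : forall j, b0 j 0 != 0 ->
  2 * sigma * (1 + delta) * Num.sqrt (2 * L) <= `|b0 j 0|.
Variables (et K1 K2 : R) (N : nat).
Hypothesis et_gt0 : 0 < et.
Hypothesis et_le1 : et <= 1.
Hypothesis N_gt0 : (0 < N)%N.
Hypothesis N_le : (N <= p)%N.
Hypothesis K1_ge0 : 0 <= K1.
Hypothesis K1_le : K1 <= xq q p N.-1.
Hypothesis K2_ge0 : 0 <= K2.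
Hypothesis K2_le : K2 <= xq q p k.-1.
Let g K := expR (- (kap delta * K ^+ 2)).
Hypothesis gK2 : g K2 < et.

Let kp : (k.-1 < p)%N.
Proof. by apply: leq_ltn_trans (leq_pred k) _; apply: leq_ltn_trans k2p; rewrite leq_pmull. Qed.

Let kap0 := kap_gt0 delta_gt0.

Let g_le K i : 0 <= K -> (i < p)%N -> K <= xq q p i -> g (xq q p i) <= g K.
Proof.
move=> K0 ip h; rewrite ler_expR lerN2 ler_pM2l//.
by rewrite ler_sqr ?nnegrE// (le_trans K0 h).
Qed.

Let q0 : 0 < q. Proof. by case/andP: q01. Qed.
Let q1 : q < 1. Proof. by case/andP: q01. Qed.

Let t i := rho delta * weight sigma delta q p i.
(** For an integer count, being below [r] is the same as being at most [et * k]. *)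
Let r := (Num.truncn (et * k%:R)).+1.

(** One term per event of [slope_bad], in the same order. In the third, ranks below [N] profit from
    quantiles above [K1], and later ranks only from the decay of [rate q]. *)
Definition bad_prob : R :=
  expR (- (n%:R * (2 * kap delta) ^+ 2 / 16)) +
  p%:R * (expR (- (n%:R * eta0 delta ^+ 2 / 16)) *+ 2) +
  (N%:R * (expR 1 * g K1) + rate q ^+ N / (1 - rate q)) +
  expR 1 * (g K2 / et) + p%:R * (p%:R * expR (- (4 * L))).

Definition slope_bad : set T :=
  noise_bad sigma delta eps
  `|` (\big[setU/set0]_(l : 'I_p) (diag_bad delta X l 1 `|` diag_bad delta X l (-1)))
  `|` (\big[setU/set0]_(i : 'I_p) score_bad sigma delta X eps (t i) i.+1)
  `|` score_bad sigma delta X eps (t k.-1) r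
  `|` (\big[setU/set0]_(l : 'I_p) \big[setU/set0]_(i : 'I_p) gram_bad X eps l i).

Lemma slope_bad_bound : bounded_event P slope_bad bad_prob.
Proof.
have g0 K : 0 < g K by exact: expR_gt0.
have g1 K : g K <= 1 by rewrite -expR0 ler_expR oppr_le0 mulr_ge0 ?sqr_ge0// ltW.
have et0 : 0 < et by [].
apply: bounded_eventU; last first.
  rewrite (_ : p%:R * _ = \sum_(l < p) \sum_(i < p) expR (- (4 * L))).
    apply: bounded_event_big => l; apply: bounded_event_big => i.
    exact: (gram_bad_bound lawX lawE).
  by rewrite !sumr_const !card_ord !mulr_natl.
apply: bounded_eventU; last first.
  (* The expected number of scores above the cutoff is at most [g K2 * k], which is this ratio times
     [et * k]. *)
  have r01 : 0 < g K2 / et < 1 by rewrite divr_gt0//= ltr_pdivrMr// mul1r.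
  have r0 := ltW (proj1 (andP r01)); have r1 := ltW (proj2 (andP r01)).
  apply: bounded_event_le (rate_expX r0 r1 (ltn0Sn _)).
  apply: (score_bad_bound sigma_gt0 delta_gt0 q01 lawX lawE) => //.
  rewrite prednK//.
  have h1 : et * k%:R <= r%:R by rewrite ltW// truncnS_gt.
  have h2 : q * g (xq q p k.-1) <= g K2.
    rewrite -[leRHS]mul1r; apply: ler_pM => //; [exact: ltW|exact: ltW|exact: ltW|exact: g_le].
  apply: (@le_trans _ _ (g K2 * k%:R)); first by rewrite ler_wpM2r.
  have -> : g K2 * k%:R = g K2 / et * (et * k%:R) by field; rewrite gt_eqF.
  by rewrite ler_wpM2l.
apply: bounded_eventU; last first.
  have rq0 : 0 <= rate q by rewrite rate_ge0// ltW.
  have rq1 := rate_lt1 q1.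
  have a0 : 0 <= expR 1 * g K1 by rewrite mulr_ge0 ?expR_ge0.
  apply: bounded_event_le (sum_split_geometric N p a0 rq0 rq1).
  apply: bounded_event_big => i; have ip := ltn_ord i.
  have gx0 := g0 (xq q p i); have gx1 := g1 (xq q p i).
  have r0 : 0 < q * g (xq q p i) by rewrite mulr_gt0.
  have rq : q * g (xq q p i) <= q by rewrite ler_piMr// ltW.
  have r01 : 0 < q * g (xq q p i) < 1 by rewrite r0 (le_lt_trans rq).
  apply: (@bounded_event_le _ _ _ _ _ (rate (q * g (xq q p i)) ^+ i.+1)).
    exact: (score_bad_bound sigma_gt0 delta_gt0 q01 lawX lawE).
  case: ifPn => iN; last first.
    by apply: lerXn2r; rewrite ?nnegrE ?(rate_ge0 (ltW r0))//; exact: (rate_le (ltW r0) rq (ltW q1)).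
  apply: le_trans (rate_expX (ltW r0) (le_trans rq (ltW q1)) (ltn0Sn _)) _.
  rewrite ler_pM2l ?expR_gt0//; apply: (@le_trans _ _ (g (xq q p i))).
    by rewrite ler_piMl// ltW.
  apply: g_le => //; apply: le_trans K1_le _; apply: xq_decr => //.
    by rewrite -ltnS prednK.
  by rewrite prednK.
apply: bounded_eventU; first exact: (noise_bad_bound _ _ lawX lawE).
rewrite (_ : p%:R * _ = \sum_(l < p) expR (- (n%:R * eta0 delta ^+ 2 / 16)) *+ 2).
  apply: bounded_event_big => l; rewrite mulr2n; apply: bounded_eventU.
    by apply: (diag_bad_bound delta_gt0 lawX lawE) => //; rewrite expr1n.
  by apply: (diag_bad_bound delta_gt0 lawX lawE) => //; rewrite sqrrN expr1n.
by rewrite sumr_const card_ord mulr_natl.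
Qed.

Lemma slope_bad_out w bh : ~ slope_bad w ->
  is_slope_solution (X w) (X w *m b0 + eps w) (slope_lambda sigma delta q p) bh ->
  (nfalse_disc b0 bh)%:R <= et * k%:R :> R /\ ntrue_disc b0 bh = k.
Proof.
move=> /not_orP[/not_orP[/not_orP[/not_orP[hn hd] hs] hc] hg] opt.
have k0 : 0 < k%:R :> R by rewrite ltr0n.
have diag l : `|gram (X w) l l - 1| <= eta0 delta.
  have /not_orP[h1 h2] := bigsetU_out (j := l) hd.
  exact: (diag_good h1 h2).
have count_cut : (#|[pred j | (cutoff sigma delta q b0 < `|score (X w) (eps w) j|)%R]|
    <= Num.truncn (et * k%:R))%N.
  by rewrite -ltnS; exact: (score_good delta_gt0 n_gt0 hn hc).
have etk : (Num.truncn (et * k%:R))%:R <= et * k%:R :> R by rewrite truncn_le mulr_ge0// ltW.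
have [|||h1 h2] := slope_good sigma_gt0 delta_gt0 q01 k_gt0 k2p n_gt0 L_ge1 L_q k_frac k_size signal opt _ _ _ diag.
- move=> i; rewrite -ltnS; apply: (score_good delta_gt0 n_gt0 hn).
  exact: (bigsetU_out (j := i) hs).
- apply: leq_trans count_cut _.
  rewrite -(ler_nat R); apply: le_trans etk _.
  by rewrite ler_piMl// ltW.
- move=> l i; apply: gram_good; last first.
    exact: (bigsetU_out (j := i) (bigsetU_out (j := l) hg)).
  have := diag l; rewrite ler_norml /gram => /andP[_].
  under eq_bigr do rewrite -expr2.
  have := eta0_le4 delta_gt0; move: (\sum_i _) => S; lra.
split=> //; apply: le_trans etk; rewrite ler_nat; exact: leq_trans h1 count_cut.
Qed.

End slope_bad_event.

(** * Asymptotics *)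

Lemma expRN_le (R : realType) (x : R) : 0 < x -> expR (- x) <= x^-1.
Proof.
move=> x0; rewrite expRN lef_pV2 ?posrE ?expR_gt0//.
by apply: le_trans (expR_ge1Dx x); rewrite lerDr.
Qed.

Lemma expRN_ln_le (R : realType) (y b : R) : 0 < y -> 2 * ln y <= b -> expR (- b) <= y^-1 / y.
Proof.
move=> y0 h; have -> : y^-1 = expR (- ln y) by rewrite expRN lnK.
by rewrite -expRD ler_expR; move: h; lra.
Qed.

Lemma gauss_small (R : realType) (a b e : R) : 0 < a -> 0 < b -> 0 < e ->
  exists2 K, 0 <= K & a * expR (- (b * K ^+ 2)) <= e.
Proof.
move=> a0 b0 e0; exists (Num.sqrt (a / (e * b))); first exact: sqrtr_ge0.
rewrite sqr_sqrtr; last by rewrite divr_ge0 ?mulr_ge0 ?ltW.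
have -> : b * (a / (e * b)) = a / e by field; rewrite !gt_eqF.
rewrite mulrC -ler_pdivlMr//; apply: le_trans (expRN_le _) _; first exact: divr_gt0.
by rewrite invf_div.
Qed.

Section slope_sequence.
Context d (T : measurableType d) (R : realType) (P : probability T R).
Variables (sigma delta q : R).
Hypothesis sigma_gt0 : 0 < sigma.
Hypothesis delta_gt0 : 0 < delta.
Hypothesis q01 : 0 < q < 1.
Variables (p : nat -> nat) (b0 : forall n, 'cV[R]_(p n)).
Variables (X : forall n, T -> 'M[R]_(n, p n)) (eps : forall n, T -> 'cV[R]_n).
Hypothesis lawX : forall n (i : 'I_n) (j : 'I_(p n)),
  has_normal_law P (fun w => X n w i j) 0 (Num.sqrt (n%:R^-1)).
Hypothesis lawE : forall n (i : 'I_n), has_normal_law P (fun w => eps n w i 0) 0 sigma.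
Hypothesis indep : forall n, mutually_independent P (design_noise_family (X n) (eps n)).
Hypothesis signal : forall n (j : 'I_(p n)), b0 n j 0 != 0 ->
  2 * sigma * (1 + delta) * Num.sqrt (2 * ln (p n)%:R) <= `|b0 n j 0|.
Hypothesis p_infty : (fun n => ((p n)%:R : R)) @ \oo --> +oo.
Hypothesis sparse : (fun n => ((nsupp (b0 n))%:R / (p n)%:R : R)) @ \oo --> 0.
Hypothesis sample_size :
  (fun n => ((nsupp (b0 n))%:R ^+ 2 * ln (p n)%:R / n%:R : R)) @ \oo --> 0.
Hypothesis supp_gt0 : \forall n \near \oo, (0 < nsupp (b0 n))%N.

Let q0 : 0 < q. Proof. by case/andP: q01. Qed.
Let q1 : q < 1. Proof. by case/andP: q01. Qed.
Let p_large M : \forall n \near \oo, M <= (p n)%:R :> R.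
Proof. by move/cvgryPge : p_infty; exact. Qed.

(** Eventually k >= 1, so k^2 log p / n dominates log p / n. *)
Let ln_p_small (a : R) : 0 < a -> \forall n \near \oo, ln (p n)%:R <= a * n%:R :> R.
Proof.
move=> a0; have hs := @cvgr_le R nat \oo _ _ _ sample_size a a0; near=> n.
have n0 : 0 < n%:R :> R by near: n; exact: nbhs_infty_gtr.
have p1 : 1 <= (p n)%:R :> R by near: n; exact: p_large.
have k0 : (0 < nsupp (b0 n))%N by near: n.
rewrite -ler_pdivrMr//.
apply: (@le_trans _ _ ((nsupp (b0 n))%:R ^+ 2 * ln (p n)%:R / n%:R)).
  rewrite ler_pM2r ?invr_gt0// ler_peMl ?ln_ge0//.
  by rewrite expr_ge1 ?ler1n.
by near: n; exact: hs.
Unshelve. all: by end_near. Qed.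

(** [N] is fixed by the geometric tail, then [K1] in terms of [N], and [K2] in terms of [et]; none
    depends on [n]. Each of the five terms gets [e / 5], the third split between its two
    summands. *)
Let bad_prob_small e et : 0 < e -> 0 < et -> exists K1 K2 N, [/\ 0 <= K1, 0 <= K2, (0 < N)%N,
  expR (- (kap delta * K2 ^+ 2)) < et &
  \forall n \near \oo, bad_prob delta q n (p n) et K1 K2 N <= e].
Proof.
move=> e0 et0; have kap0 := kap_gt0 delta_gt0; have h0 := eta0_gt0 delta_gt0.
have E0 : 0 < expR 1 :> R by exact: expR_gt0.
have E1 : 1 < expR 1 :> R by rewrite -expR0 ltr_expR.
have rq1 := rate_lt1 q1; have rq0 : 0 <= rate q by rewrite rate_ge0// ltW.
have t1 : 0 < 1 - rate q by rewrite subr_gt0.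
have e5 : 0 < e / 5 by rewrite divr_gt0.
have e10 : 0 < e / 10 by rewrite divr_gt0.
have [N N0 hN] : exists2 N, (0 < N)%N & rate q ^+ N / (1 - rate q) <= e / 10.
  have h : 0 < e / 10 * (1 - rate q) by rewrite mulr_gt0.
  have cv : (GRing.exp (rate q) : R ^nat) @ \oo --> 0 by apply: cvg_expr; rewrite ger0_norm.
  have [N0 _ hN] : \forall n \near \oo, rate q ^+ n <= e / 10 * (1 - rate q).
    exact: (@cvgr_le R nat \oo _ _ _ cv _ h).
  exists N0.+1 => //; rewrite ler_pdivrMr//; exact: (hN N0.+1 (leqnSn _)).
have N0R : 0 < N%:R * expR 1 :> R by rewrite mulr_gt0 ?ltr0n.
have [K1 K10 hK1] := gauss_small N0R kap0 e10.
have aet : 0 < expR 1 / et by rewrite divr_gt0.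
(* The bound by 1 is for [g K2 < et]: it gives [expR 1 * g K2 <= et], and [expR 1 > 1]. *)
have m0 : 0 < Num.min 1 (e / 5) by rewrite lt_min ltr01 e5.
have [K2 K20 hK2] := gauss_small aet kap0 m0.
exists K1, K2, N; split => //.
  have : expR 1 / et * expR (- (kap delta * K2 ^+ 2)) <= 1.
    by apply: le_trans hK2 _; rewrite ge_min lexx.
  rewrite mulrAC ler_pdivrMr// mul1r; apply: lt_le_trans.
  by rewrite ltr_pMl// expR_gt0.
near=> n.
have n0 : 0 < n%:R :> R by near: n; exact: nbhs_infty_gtr.
have p1 : 1 <= (p n)%:R :> R by near: n; exact: p_large.
have p0 : 0 < (p n)%:R :> R by exact: lt_le_trans ltr01 p1.
have T1 : expR (- (n%:R * (2 * kap delta) ^+ 2 / 16)) <= e / 5.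
  rewrite -mulrA; set a := (2 * kap delta) ^+ 2 / 16.
  have a0 : 0 < a by apply: divr_gt0 => //; apply: exprn_gt0; exact: mulr_gt0.
  have na0 : 0 < n%:R * a by exact: mulr_gt0.
  apply: le_trans (expRN_le na0) _.
  have hn : (e / 5)^-1 / a <= n%:R by near: n; exact: nbhs_infty_ger.
  by rewrite invf_ple ?posrE// -ler_pdivrMr.
have T2 : (p n)%:R * (expR (- (n%:R * eta0 delta ^+ 2 / 16)) *+ 2) <= e / 5.
  have hn : ln (p n)%:R <= eta0 delta ^+ 2 / 32 * n%:R.
    by near: n; apply: ln_p_small; rewrite divr_gt0// exprn_gt0.
  have h : expR (- (n%:R * eta0 delta ^+ 2 / 16)) <= (p n)%:R^-1 * (p n)%:R^-1.
    apply: expRN_ln_le => //.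
    have -> : n%:R * eta0 delta ^+ 2 / 16 = 2 * (eta0 delta ^+ 2 / 32 * n%:R) by field.
    by rewrite ler_pM2l.
  apply: (@le_trans _ _ ((p n)%:R * ((p n)%:R^-1 * (p n)%:R^-1 * 2))).
    by rewrite ler_pM2l// mulr_natr lerMn2r.
  have -> : (p n)%:R * ((p n)%:R^-1 * (p n)%:R^-1 * 2) = 2 / (p n)%:R :> R.
    by field; rewrite gt_eqF.
  rewrite ler_pdivrMr// -ler_pdivrMl//.
  by near: n; exact: p_large.
have T3 : N%:R * (expR 1 * expR (- (kap delta * K1 ^+ 2))) + rate q ^+ N / (1 - rate q) <= e / 5.
  rewrite mulrA; apply: le_trans (lerD hK1 hN) _.
  by rewrite le_eqVlt; apply/orP; left; apply/eqP; field.
have T4 : expR 1 * (expR (- (kap delta * K2 ^+ 2)) / et) <= e / 5.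
  by rewrite mulrCA mulrC; apply: le_trans hK2 _; rewrite ge_min lexx orbT.
have T5 : (p n)%:R * ((p n)%:R * expR (- (4 * ln (p n)%:R))) <= e / 5.
  have -> : (p n)%:R * ((p n)%:R * expR (- (4 * ln (p n)%:R))) = (p n)%:R^-1 * (p n)%:R^-1 :> R.
    by rewrite expRN expRM_natl lnK//; field; rewrite gt_eqF.
  apply: (@le_trans _ _ (p n)%:R^-1); first by rewrite ler_piMl ?invr_ge0 ?invf_le1// ltW.
  rewrite invf_ple ?posrE//.
  by near: n; exact: p_large.
rewrite /bad_prob; apply: le_trans (lerD (lerD (lerD (lerD T1 T2) T3) T4) T5) _.
by rewrite le_eqVlt; apply/orP; left; apply/eqP; field.
Unshelve. all: by end_near. Qed.

Lemma slope_eventually e et : 0 < e -> 0 < et -> et <= 1 ->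
  \forall n \near \oo, exists2 A, bounded_event P A e &
    forall w bh, ~ A w ->
      is_slope_solution (X n w) (X n w *m b0 n + eps n w) (slope_lambda sigma delta q (p n)) bh ->
      (nfalse_disc (b0 n) bh)%:R <= et * (nsupp (b0 n))%:R :> R /\
      ntrue_disc (b0 n) bh = nsupp (b0 n).
Proof.
move=> e0 et0 et1; have [K1 [K2 [N [K10 K20 N0 gK2 hbad]]]] := bad_prob_small e0 et0.
have h0 := eta0_gt0 delta_gt0.
have c0 K : 0 < tail_const * expR (- K ^+ 2) :> R by rewrite mulr_gt0 ?tail_const_gt0 ?expR_gt0.
near=> n.
have p1 : 1 <= (p n)%:R :> R by near: n; exact: p_large.
have p0 : 0 < (p n)%:R :> R by exact: lt_le_trans ltr01 p1.
have k0 : (0 < nsupp (b0 n))%N by near: n.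
have n0 : (0 < n)%N by near: n; exact: nbhs_infty_gt.
(* The three thresholds give, in order, [2 * k < p], the hypothesis of [xq_rank], and a quantile at
   rank [k] above [K2]. *)
have ks : (nsupp (b0 n))%:R / (p n)%:R < Num.min (2^-1) (Num.min (frac_bound q (iota0 delta))
    (tail_const * expR (- K2 ^+ 2))) :> R.
  near: n; apply: (@cvgr_lt R nat \oo _ _ _ sparse); rewrite !lt_min invr_gt0 ltr0n c0/= andbT.
  have i0 := iota0_gt0 delta_gt0; have c10 := c1_gt0 q01.
  exact: (divr_gt0 (mulr_gt0 (mulr_gt0 i0 c10) (expR_gt0 _)) (ltr0Sn _ 2)).
move: ks; rewrite !lt_min => /and3P[ks1 ks2 ks3].
have k2p : (2 * nsupp (b0 n) < p n)%N.
  by move: ks1; rewrite ltr_pdivrMr// -(ltr_nat R) natrM; lra.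
have L1 : 1 <= ln (p n)%:R :> R.
  rewrite -ler_expR lnK//; near: n; exact: p_large.
have Lq : ln (2 / q) <= eta0 delta * ln (p n)%:R.
  rewrite [leRHS]mulrC -ler_pdivrMr// -ler_expR [leRHS]lnK//.
  by near: n; exact: p_large.
have ksz : (nsupp (b0 n))%:R ^+ 2 * ln (p n)%:R / n%:R <= size_bound delta q.
  near: n; apply: (@cvgr_le R nat \oo _ _ _ sample_size); exact: size_bound_gt0.
have Np : (N <= p n)%N by rewrite -(ler_nat R); near: n; exact: p_large.
(* Quantiles at ranks negligible against [p] exceed any constant: this serves rank [N], fixed while
   [p] grows, and rank [k], since k / p -> 0. *)
have xq_large K i : 0 <= K -> (i < p n)%N -> i.+1%:R / (p n)%:R < tail_const * expR (- K ^+ 2) ->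
    K <= xq q (p n) i.
  move=> K0 ip hK; apply: qt_large => //; [exact: level_gt0|exact: level_lt|].
  apply: le_lt_trans hK; rewrite /level invfM mulrA ler_pM2r ?invr_gt0//.
  by rewrite mulrAC ler_piMl// ler_pdivrMr// mul1r (le_trans (ltW q1))// ler1n.
have h1 : K1 <= xq q (p n) N.-1.
  apply: xq_large => //; first by rewrite prednK.
  rewrite prednK// ltr_pdivrMr// mulrC -ltr_pdivrMr//.
  apply: (@lt_le_trans _ _ (N%:R / (tail_const * expR (- K1 ^+ 2)) + 1)); first by rewrite ltrDl.
  by near: n; exact: p_large.
have h2 : K2 <= xq q (p n) (nsupp (b0 n)).-1.
  apply: xq_large => //; last by rewrite prednK.
  by apply: leq_ltn_trans (leq_pred _) _; apply: leq_ltn_trans k2p; rewrite leq_pmull.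
exists (slope_bad sigma delta q (b0 n) (X n) (eps n) et).
  apply: (@bounded_event_le _ _ _ _ _ (bad_prob delta q n (p n) et K1 K2 N)); last by near: n.
  exact: (slope_bad_bound sigma_gt0 delta_gt0 q01 (@lawX n) (@lawE n)).
move=> w bh hA; apply: (slope_bad_out sigma_gt0 delta_gt0 q01 k0 k2p n0 L1 Lq _ ksz) => //.
  exact: ltW.
exact: signal.
Unshelve. all: by end_near. Qed.

End slope_sequence.

(** * From the bad event to expectations *)

Section expectation_bounds.
Context d (T : measurableType d) (R : realType) (P : probability T R).
Variables (h : T -> R) (A : set T) (e : R).
Hypothesis mh : measurable_fun setT h.
Hypothesis h0 : forall w, 0 <= h w.
Hypothesis PA : bounded_event P A e.

Lemma expectation_le_off a : 0 <= a -> (forall w, h w <= 1) -> (forall w, ~ A w -> h w <= a) ->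
  (\int[P]_w (h w)%:E <= (a + e)%:E)%E.
Proof.
move=> a0 h1 ha; have [mA pA] := PA.
apply: (@le_trans _ _ (\int[P]_w (a%:E + (\1_A w)%:E))%E).
  apply: ge0_le_integral => //.
  - by move=> w _; rewrite lee_fin.
  - exact/measurable_EFinP.
  - by apply: emeasurable_funD => //; apply/measurable_EFinP; exact: measurable_indic.
  move=> w _; rewrite -EFinD lee_fin indicE; have [wA|wA] := boolP (w \in A).
    by rewrite (le_trans (h1 w))// lerDr.
  by rewrite addr0; apply: ha => /mem_set; exact/negP.
have mI : measurable_fun setT (fun w => (\1_A w)%:E : \bar R).
  by apply/measurable_EFinP; exact: measurable_indic.
rewrite (ge0_integralD P measurableT _ _ _ mI)//.
rewrite integral_cst// integral_indic// setIT EFinD.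
by rewrite [X in (_ * X)%E]probability_setT mule1 leeD2l.
Qed.

Lemma expectation_ge_off c : 0 <= c -> (forall w, ~ A w -> c <= h w) ->
  ((c * (1 - e))%:E <= \int[P]_w (h w)%:E)%E.
Proof.
move=> c0 hc; have [mA pA] := PA.
apply: (@le_trans _ _ (\int[P]_w (c * \1_(~` A) w)%:E)%E); last first.
  apply: ge0_le_integral => //.
  - by move=> w _; rewrite lee_fin mulr_ge0.
  - apply/measurable_EFinP; apply: measurable_funM => //.
    by apply: measurable_indic; exact: measurableC.
  - exact/measurable_EFinP.
  move=> w _; rewrite lee_fin indicE; have [/set_mem wA|wA] := boolP (w \in ~` A).
    by rewrite mulr1 hc.
  by rewrite mulr0.
under eq_integral do rewrite EFinM.
have mI : measurable_fun setT (fun w => (\1_(~` A) w)%:E : \bar R).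
  by apply/measurable_EFinP; apply: measurable_indic; exact: measurableC.
rewrite (ge0_integralZl P measurableT mI)//.
rewrite integral_indic//; last exact: measurableC.
rewrite [X in (_ * X)%E](_ : _ = (1 - P A)%E); last by rewrite setIT; exact: probability_setC.
rewrite EFinM.
apply: lee_wpmul2l; first by rewrite lee_fin.
by rewrite EFinB leeB.
Qed.

End expectation_bounds.

Section random_support.
Context d (T : measurableType d) (R : realType) (p : nat) (bh : T -> 'cV[R]_p).
Hypothesis mbh : forall j, measurable_fun setT (fun w => bh w j 0).

(** All discovery counts factor through this random element of a finite type, so their measurability
    reduces to that of finitely many events. *)
Definition support w : {set 'I_p} := [set j | bh w j 0 != 0]%SET.

Lemma measurable_support (A : {set 'I_p}) : measurable [set w | support w = A].
Proof.
have -> : [set w | support w = A] =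
    \big[setI/setT]_(j : 'I_p) [set w | (bh w j 0 != 0) = (j \in A)].
  apply/seteqP; split => w /=.
    move=> <-; elim/big_ind : _ => //= j _; by rewrite inE.
  move=> h; apply/setP => j; rewrite inE.
  by move: h; rewrite (bigD1 j)//= => -[].
elim/big_ind : _ => //; first by move=> ? ?; exact: measurableI.
move=> j _; have m0 : measurable [set w | bh w j 0 = 0].
  have := mbh j measurableT (measurable_set1 0); rewrite setTI; congr measurable.
have [jA|jA] := boolP (j \in A).
  rewrite (_ : [set w | _] = ~` [set w | bh w j 0 = 0]); first exact: measurableC.
  by apply/seteqP; split => w /= /eqP.
rewrite (_ : [set w | _] = [set w | bh w j 0 = 0])//.
by apply/seteqP; split => w /=; [move/negbFE/eqP|move=> ->; rewrite eqxx].
Qed.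

Lemma measurable_support_fun (G : {set 'I_p} -> R) : measurable_fun setT (fun w => G (support w)).
Proof.
have -> : (fun w => G (support w)) =
    (fun w => \sum_(A : {set 'I_p}) G A * \1_[set w | support w = A] w).
  apply/funext => w; rewrite (bigD1 (support w))//= big1 ?addr0.
    by rewrite indicE mem_set// mulr1.
  move=> A hA; rewrite indicE memNset ?mulr0//= => h; by rewrite h eqxx in hA.
apply: measurable_sum => A; apply: measurable_funM => //.
by apply: measurable_indic; exact: measurable_support.
Qed.

Variable b0 : 'cV[R]_p.

Lemma nsupp_support w : nsupp (bh w) = #|support w|.
Proof. by apply: eq_card => j; rewrite !inE; apply/idP/idP => [/set_mem//|h]; exact: mem_set. Qed.

Lemma nfalse_support w : nfalse_disc b0 (bh w) = #|[set j in support w | b0 j 0 == 0]%SET|.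
Proof.
apply: eq_card => j; rewrite !inE andbC.
by apply/idP/idP => [/set_mem//|h]; exact: mem_set.
Qed.

Lemma ntrue_support w : ntrue_disc b0 (bh w) = #|[set j in support w | b0 j 0 != 0]%SET|.
Proof.
apply: eq_card => j; rewrite !inE andbC.
by apply/idP/idP => [/set_mem//|h]; exact: mem_set.
Qed.

Lemma measurable_fdp : measurable_fun setT
  (fun w => (nfalse_disc b0 (bh w))%:R / (maxn (nsupp (bh w)) 1)%:R : R).
Proof.
pose G (S : {set 'I_p}) : R := #|[set j in S | b0 j 0 == 0]%SET|%:R / (maxn #|S| 1)%:R.
have -> : (fun w => (nfalse_disc b0 (bh w))%:R / (maxn (nsupp (bh w)) 1)%:R : R) =
    (fun w => G (support w)).
  by apply/funext => w; rewrite nfalse_support nsupp_support.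
exact: (measurable_support_fun G).
Qed.

Lemma measurable_ntrue : measurable_fun setT (fun w => (ntrue_disc b0 (bh w))%:R : R).
Proof.
pose G (S : {set 'I_p}) : R := #|[set j in S | b0 j 0 != 0]%SET|%:R.
have -> : (fun w => (ntrue_disc b0 (bh w))%:R : R) = (fun w => G (support w)).
  by apply/funext => w; rewrite ntrue_support.
exact: (measurable_support_fun G).
Qed.

Lemma ntrue_le w : (ntrue_disc b0 (bh w) <= nsupp (bh w))%N.
Proof.
rewrite ntrue_support nsupp_support; apply: subset_leq_card; apply/fintype.subsetP => j.
by rewrite inE => /andP[].
Qed.

Lemma nfalse_le w : (nfalse_disc b0 (bh w) <= nsupp (bh w))%N.
Proof.
rewrite nfalse_support nsupp_support; apply: subset_leq_card; apply/fintype.subsetP => j.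
by rewrite inE => /andP[].
Qed.

Lemma ntrue_le_supp w : (ntrue_disc b0 (bh w) <= nsupp b0)%N.
Proof.
apply: subset_leq_card; apply/fintype.subsetP => j /set_mem /= /andP[h _].
exact: mem_set.
Qed.

End random_support.

Lemma cvge_squeeze_eventually (R : realType) (f : nat -> \bar R) (l : R) :
  (forall e : R, 0 < e -> \forall n \near \oo, ((l - e)%:E <= f n <= (l + e)%:E)%E) ->
  f @ \oo --> l%:E.
Proof.
move=> h.
have fin e n : ((l - e)%:E <= f n <= (l + e)%:E)%E -> f n \is a fin_num.
  move=> /andP[h1 h2]; rewrite fin_numE; apply/andP; split; apply/eqP => fE.
    by rewrite fE leeNy_eq in h1.
  by rewrite fE leye_eq in h2.
apply/fine_cvgP; split.
  by near=> n; apply: (fin 1); near: n; exact: h.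
apply/cvgrPdist_le => e e0; near=> n.
have hn : ((l - e)%:E <= f n <= (l + e)%:E)%E by near: n; exact: h.
have fn := fin _ _ hn.
move: hn; rewrite -{1 2}(fineK fn) !lee_fin => /andP[h1 h2] /=.
by rewrite ler_norml; apply/andP; split; move: h1 h2; move: (fine _) => x; lra.
Unshelve. all: by end_near. Qed.

Theorem theorem1 (R : realType) (d : measure_display) (T : measurableType d)
    (P : probability T R) (sigma delta q : R)
    (p : nat -> nat) (b0 : forall n, 'cV[R]_(p n))
    (X : forall n, T -> 'M[R]_(n, p n)) (eps : forall n, T -> 'cV[R]_n)
    (bh : forall n, T -> 'cV[R]_(p n)) :
  0 < sigma -> 0 < delta -> 0 < q < 1 ->
  (* Gaussian design and noise: X_ij ~ N(0, 1/n), eps_i ~ N(0, sigma^2),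
     all mutually independent *)
  (forall n (i : 'I_n) (j : 'I_(p n)),
      has_normal_law P (fun w => X n w i j) 0 (Num.sqrt (n%:R^-1))) ->
  (forall n (i : 'I_n), has_normal_law P (fun w => eps n w i 0) 0 sigma) ->
  (forall n, mutually_independent P (design_noise_family (X n) (eps n))) ->
  (* signal strength *)
  (forall n (j : 'I_(p n)), b0 n j 0 != 0 ->
      2 * sigma * (1 + delta) * Num.sqrt (2 * ln (p n)%:R) <= `|b0 n j 0|) ->
  (* asymptotic regime *)
  ((fun n => ((p n)%:R : R)) @ \oo --> +oo) ->
  ((fun n => ((nsupp (b0 n))%:R / (p n)%:R : R)) @ \oo --> 0) ->
  ((fun n => ((nsupp (b0 n))%:R ^+ 2 * ln (p n)%:R / n%:R : R)) @ \oo --> 0) ->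
  (\forall n \near \oo, (0 < nsupp (b0 n))%N) ->
  (* bh n is a (measurable) SLOPE solution for Y = X b0 + eps *)
  (forall n w, is_slope_solution (X n w) (X n w *m b0 n + eps n w)
                  (slope_lambda sigma delta q (p n)) (bh n w)) ->
  (forall n (j : 'I_(p n)), measurable_fun setT (fun w => bh n w j 0)) ->
  (* FDR -> 0 and Power -> 1 *)
  ((fun n => (\int[P]_w
        (((nfalse_disc (b0 n) (bh n w))%:R
          / (maxn (nsupp (bh n w)) 1)%:R : R)%:E))%E) @ \oo --> 0%E) /\
  ((fun n => ((\int[P]_w (((ntrue_disc (b0 n) (bh n w))%:R : R)%:E))
              * (((nsupp (b0 n))%:R : R)^-1)%:E)%E) @ \oo --> 1%E).
Proof.
move=> sigma0 delta0 q01 lawX lawE indep signal p_infty sparse sample supp0 opt mbh.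
have ev := slope_eventually sigma0 delta0 q01 lawX lawE indep signal p_infty sparse sample supp0.
split; apply: cvge_squeeze_eventually => e e0.
  pose a := Num.min 1 (e / 2).
  have e2 : 0 < e / 2 by rewrite divr_gt0.
  have a0 : 0 < a by rewrite lt_min ltr01.
  have a1 : a <= 1 by rewrite ge_min lexx.
  have ae : a <= e / 2 by rewrite ge_min lexx orbT.
  near=> n.
  have k0 : (0 < nsupp (b0 n))%N by near: n.
  have [A PA hA] : exists2 A, bounded_event P A (e / 2) & forall w bh, ~ A w ->
      is_slope_solution (X n w) (X n w *m b0 n + eps n w) (slope_lambda sigma delta q (p n)) bh ->
      (nfalse_disc (b0 n) bh)%:R <= a * (nsupp (b0 n))%:R :> R /\
      ntrue_disc (b0 n) bh = nsupp (b0 n).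
    by near: n; exact: ev.
  set h := fun w => (nfalse_disc (b0 n) (bh n w))%:R / (maxn (nsupp (bh n w)) 1)%:R : R.
  have h0 w : 0 <= h w by rewrite divr_ge0.
  have m0 w : 0 < (maxn (nsupp (bh n w)) 1)%:R :> R by rewrite ltr0n leq_max orbT.
  apply/andP; split.
    apply: (@le_trans _ _ 0%E); first by rewrite lee_fin sub0r oppr_le0 ltW.
    by apply: integral_ge0 => w _; rewrite lee_fin.
  apply: (@le_trans _ _ (a + e / 2)%:E); last by rewrite lee_fin; move: ae; lra.
  apply: (expectation_le_off (measurable_fdp (@mbh n) (b0 n)) h0 PA) => //; first exact: ltW.
    move=> w; rewrite /h ler_pdivrMr// mul1r ler_nat leq_max.
    by rewrite nfalse_le.
  move=> w wA; have [h1 h2] := hA w _ wA (opt n w).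
  (* All signals are found, so there are at least [k] discoveries, while false ones number at most
     [a * k]. *)
  rewrite /h ler_pdivrMr//; apply: le_trans h1 _.
  rewrite ler_pM2l// ler_nat leq_max -[in leqLHS]h2 ntrue_le//.
near=> n.
have k0 : (0 < nsupp (b0 n))%N by near: n.
have kR : 0 < (nsupp (b0 n))%:R :> R by rewrite ltr0n.
(* The tolerance on false discoveries is set to 1 here, since the power is read off the equality for
   true discoveries. *)
have [A PA hA] : exists2 A, bounded_event P A e & forall w bh, ~ A w ->
    is_slope_solution (X n w) (X n w *m b0 n + eps n w) (slope_lambda sigma delta q (p n)) bh ->
    (nfalse_disc (b0 n) bh)%:R <= 1 * (nsupp (b0 n))%:R :> R /\
    ntrue_disc (b0 n) bh = nsupp (b0 n).
  by near: n; exact: ev.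
set h := fun w => (ntrue_disc (b0 n) (bh n w))%:R : R.
have h0 w : 0 <= h w by [].
have mh : measurable_fun setT h := measurable_ntrue (@mbh n) (b0 n).
apply/andP; split.
  rewrite lee_pdivlMr// -EFinM mulrC.
  apply: (expectation_ge_off mh h0 PA) => //.
  by move=> w wA; have [_ h2] := hA w _ wA (opt n w); rewrite /h h2.
rewrite lee_pdivrMr// -EFinM.
apply: (@le_trans _ _ (\int[P]_w ((nsupp (b0 n))%:R : R)%:E)%E).
  apply: ge0_le_integral => //.
  - exact/measurable_EFinP.
  - by move=> w _; rewrite lee_fin ler_nat ntrue_le_supp.
rewrite integral_cst//= probability_setT mule1 lee_fin.
by rewrite ler_peMl ?lerDl// ltW.
Unshelve. all: by end_near. Qed.
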